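(* Let $X$ be a diffeological space and $G$ an abelian diffeological group such that all principal $G$-bundles over $X$ are D-numerable. There is a natural bijection between $\check{H}^1(X,G)$ and the set $[X,BG]$ of smooth homotopy classes of smooth maps from $X$ to the classifying space $BG$ of $G$.
   Context: A diffeological space is a set $X$ with a set $\mathcal{D}_X$ of maps $p\colon U_p\to X$ (plots), $U_p$ an open subset of some Euclidean space (any dimension), such that: all constant maps are plots; a map $U\to X$ that is locally a plot is a plot; if $p\colon U\to X$ is a plot and $f\colon V\to U$ is smooth then $p\circ f$ is a plot. A map $\varphi\colon X\to Y$ is smooth if $\varphi\circ p\in\mathcal{D}_Y$ for all $p\in\mathcal{D}_X$. Products, subsets, disjoint sums and quotients carry their standard diffeologies (product: componentwise plots; subset: plots with image in the subset; sum: locally plots of a summand; quotient: maps that locally lift to plots); fiber products carry the subset diffeology of the product. A diffeological group is a group with a diffeology making multiplication and inversion smooth. A principal $G$-bundle over $X$ is a diffeological space $P$ with a smooth right $G$-action and quotient map $\pi\colon P\to X$ for that action (so $P/G\cong X$) such that $P\times G\to P\times_X P$, $(p,g)\mapsto(p,p\cdot g)$, is a diffeomorphism. It is trivializable if isomorphic ($G$-equivariantly over $X$) to $X\times G$. The D-topology of $X$ is the finest topology making all plots continuous. A principal $G$-bundle $P\to X$ is D-numerable if there are a D-open cover $\{V_i\}$ of $X$ such that $P|_{V_i}$ is trivializable for each $i$ and a (locally finite) smooth partition of unity on $X$ subordinate to $\{V_i\}$. Classifying space: let $S\subseteq\left(\prod_{i\in\mathbb{N}}[0,1]\right)\times\left(\prod_{i\in\mathbb{N}}G\right)$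 be the set of $(t_i,g_i)_i$ with only finitely many $t_i$ nonzero and $\sum_i t_i=1$, with the subset diffeology of the product. Let $(t_i,g_i)\sim(t'_i,g'_i)$ if $t_i=t'_i$ for all $i$ and $g_i=g'_i$ whenever $t_i\ne0$. Then $EG=S/\!\sim$ with the quotient diffeology, $G$ acts on the right by $[(t_i,g_i)]\cdot g=[(t_i,g_ig)]$, and $BG=EG/G$ with the quotient diffeology. Smooth maps $f_0,f_1\colon X\to BG$ are smoothly homotopic if there is a smooth $H\colon X\times\mathbb{R}\to BG$ with $H(\cdot,0)=f_0$, $H(\cdot,1)=f_1$. Čech cohomology: a generating family of $X$ is a family $\mathcal{Q}\subseteq\mathcal{D}_X$ such that every plot $p$ restricts on the members $U_\alpha$ of some open cover of $U_p$ to $q_\alpha\circ f_\alpha$ with $q_\alpha\in\mathcal{Q}$ and $f_\alpha\colon U_\alpha\to U_{q_\alpha}$ smooth. $\mathcal{N}(\mathcal{Q})=\coprod_{q\in\mathcal{Q}}U_q$, $\mathrm{ev}\colon\mathcal{N}(\mathcal{Q})\to X$, $u\in U_q\mapsto q(u)$; $\mathcal{N}(\mathcal{Q})_k$ is the $(k+1)$-fold fiber product of $\mathcal{N}(\mathcal{Q})$ over $X$ and $d_i$ drops the $i$-th entry. $\check{H}^k(\mathcal{Q},G)$ is the cohomology of $\check{C}^k(\mathcal{Q},G)=C^\infty(\mathcal{N}(\mathcal{Q})_k,G)$, $\partial f=\sum_{i=0}^{k+1}(-1)^if\circ d_i$. A refinement of $\mathcal{Q}=\{q_\alpha\}_{\alpha\in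 A}$ is a generating family $\mathcal{R}=\{r_\beta\}_{\beta\in B}$ with a map $\varphi\colon B\to A$ and smooth maps $f_\beta\colon U_{r_\beta}\to U_{q_{\varphi(\beta)}}$ with $q_{\varphi(\beta)}\circ f_\beta=r_\beta$; pullback along $\coprod f_\beta$ induces $\check{H}^k(\mathcal{Q},G)\to\check{H}^k(\mathcal{R},G)$. $\check{H}^k(X,G)$ is the directed colimit over generating families ordered by refinement. Natural means compatible with pullback along smooth maps $Y\to X$ between spaces satisfying the hypothesis (the map induced on $\check{H}^1$ pulls back cocycles along smooth maps of nebulae covering $Y\to X$; the map induced on $[\cdot,BG]$ is precomposition). *)

(* Defs.v *)
From HB Require Import structures.
From Stdlib Require Import Relations.
From mathcomp Require Import all_boot all_order all_algebra.
From mathcomp Require Import all_classical all_reals all_analysis.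
Set Implicit Arguments.
Unset Strict Implicit.
Unset Printing Implicit Defensive.
Import Order.TTheory GRing.Theory Num.Theory.
Import numFieldNormedType.Exports.
Local Open Scope classical_set_scope.
Local Open Scope ring_scope.

Lemma near_eq_differentiable (K : numFieldType) (V W : normedModType K)
    (f g : V -> W) (x : V) :
  (\forall y \near x, f y = g y) -> differentiable f x -> differentiable g x.
Proof.
move=> fg /diff_locallyP[df fE].
have gx : g x = f x by rewrite (nbhs_singleton fg).
have gE : g \o shift x = cst (g x) + 'd f x +o_ 0 id.
  have /eqaddoP fE' := fE.
  apply/eqaddoP => e e0; have fge := fE' e e0.
  have fg0 : \forall y \near 0, f (y + x) = g (y + x).
    move: fg; rewrite (near_shift 0 x) subr0; exact.
  near=> y.
  rewrite (_ : _ y = (f \o shift x \- (cst (f x) + 'd f x)) y); first by near: y.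
  by rewrite /= gx; congr (_ - _); rewrite (near fg0).
by apply/diff_locallyP; rewrite (diff_unique df gE).
Unshelve. all: by end_near. Qed.

Lemma near_eq_continuous (T S : topologicalType) (f g : T -> S) (x : T) :
  (\forall y \near x, f y = g y) ->
  {for x, continuous f} -> {for x, continuous g}.
Proof.
move=> fg; rewrite /prop_for /continuous_at -(nbhs_singleton fg) => cf.
by apply: cvg_trans cf; exact: near_eq_cvg.
Qed.

Section scale.
Context {K : numFieldType} {V : normedModType K}.

Let scale_is_bilinear :
  bilinear_for
    (GRing.Scale.Law.clone _ _ *:%R _) (GRing.Scale.Law.clone _ _ *:%R _)
    (@GRing.scale K V).
Proof.
split=> [u'|u] a x y /=.
- by rewrite scalerDl scalerA.
- by rewrite scalerDr !scalerA mulrC.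
Qed.
HB.instance Definition _ := bilinear_isBilinear.Build K K V V _ _ (@GRing.scale K V)
  scale_is_bilinear.

Lemma is_diff_scale2 (W : normedModType K) (a : W -> K) (b : W -> V) x :
  differentiable a x -> differentiable b x ->
  is_diff x (fun y => a y *: b y) (fun y => a x *: 'd b x y + 'd a x y *: b x).
Proof.
move=> da db; have cs : continuous (fun p : K * V => p.1 *: p.2).
  by move=> p; exact: scale_continuous.
have dp : differentiable (fun y => (a y, b y)) x by exact: differentiable_pair.
have ds p : differentiable (fun p : K * V => p.1 *: p.2) p.
  exact: (@differentiable_bilin _ _ _ _ (@GRing.scale K V)).
apply: DiffDef.
  exact: (@differentiable_comp _ _ _ _ (fun y => (a y, b y)) (fun p => p.1 *: p.2)).
rewrite (@diff_comp _ _ _ _ (fun y => (a y, b y)) (fun p => p.1 *: p.2))//.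
by rewrite (@diff_bilin _ _ _ _ (@GRing.scale K V))// diff_pair.
Qed.

End scale.

Section Ck.
Context {R : realType}.

(* Meaningful for [U] open: class C^k on [U], through the directional
   derivatives. *)
Fixpoint Ck (k n : nat) (V : normedModType R) (U : set 'rV[R]_n)
    (f : 'rV[R]_n -> V) : Prop :=
  if k is k'.+1 then
    (forall x, U x -> differentiable f x) /\ forall v, Ck k' U ('D_v f)
  else forall x, U x -> {for x, continuous f}.

Definition smooth_on n (V : normedModType R) (U : set 'rV[R]_n)
  (f : 'rV[R]_n -> V) := forall k, Ck k U f.

Section lemmas.
Context {n : nat} {V : normedModType R}.
Implicit Types (U W : set 'rV[R]_n) (f g : 'rV[R]_n -> V).

Lemma Ck_local k U f :
  (forall x, U x -> exists W, [/\ open W, W x & Ck k W f]) -> Ck k U f.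
Proof.
elim: k f => [|k IH] f /= H.
  by move=> x /H [W [_ Wx]]; apply.
split=> [x /H [W [_ Wx [+ _]]]|v]; first exact.
by apply: IH => x /H [W [oW Wx [_ /(_ v)]]]; exists W.
Qed.

Lemma Ck_sub k U W f : W `<=` U -> Ck k U f -> Ck k W f.
Proof.
move=> WU; elim: k f => [|k IH] f /=; first by move=> H x /WU /H.
by move=> [df Df]; split=> [x /WU /df//|v]; exact: IH.
Qed.

Lemma eq_on_near U f g x : open U -> {in U, f =1 g} -> U x ->
  \forall y \near x, f y = g y.
Proof.
move=> oU fg Ux; have : nbhs x U by apply: open_nbhs_nbhs.
by apply: filterS => y Uy; apply: fg; rewrite inE.
Qed.

Lemma Ck_eq k U f g : open U -> {in U, f =1 g} -> Ck k U f -> Ck k U g.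
Proof.
move=> oU; elim: k f g => [|k IH] f g fg /=.
  move=> cf x Ux.
  exact: (near_eq_continuous (eq_on_near oU fg Ux)) (cf x Ux).
move=> [df Df]; split=> [x Ux|v].
  exact: (near_eq_differentiable (eq_on_near oU fg Ux)) (df x Ux).
apply: IH (Df v) => x; rewrite inE => Ux.
exact/near_eq_derive/(eq_on_near oU fg).
Qed.

Lemma CkS k U f : Ck k.+1 U f -> Ck k U f.
Proof.
elim: k f => [|k IH] f /= [df Df].
  by move=> x Ux; apply: differentiable_continuous; exact: df.
by split=> // v; apply: IH; exact: Df.
Qed.

Lemma Ck_cst k U (c : V) : Ck k U (fun=> c).
Proof.
elim: k c => [|k IH] c /=; first by move=> x _; exact: cst_continuous.
split=> [x _|v]; first exact: differentiable_cst.
rewrite (_ : 'D_v _ = fun=> 0)//; apply/funext => x.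
exact: derive_cst.
Qed.

Lemma CkD k U f g : open U -> Ck k U f -> Ck k U g -> Ck k U (f \+ g).
Proof.
move=> oU; elim: k f g => [|k IH] f g /=.
  by move=> cf cg x Ux; apply: continuousD; [exact: cf|exact: cg].
move=> [df Df] [dg Dg]; split=> [x Ux|v].
  by apply: differentiableD; [exact: df|exact: dg].
apply: Ck_eq (IH _ _ (Df v) (Dg v)) => // x; rewrite inE => Ux /=.
have [dfx dgx] := (df x Ux, dg x Ux).
by rewrite -[f \+ g]/(f + g) deriveD//; exact: diff_derivable.
Qed.

Lemma Ck_sum k U I (r : seq I) (F : I -> 'rV[R]_n -> V) : open U ->
  (forall i, Ck k U (F i)) -> Ck k U (fun x => \sum_(i <- r) F i x).
Proof.
move=> oU HF; elim: r => [|i r IH].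
  apply: Ck_eq (Ck_cst k U 0) => // x _; by rewrite big_nil.
by apply: Ck_eq (CkD oU (HF i) IH) => // x _ /=; rewrite big_cons.
Qed.

End lemmas.

Lemma CkZ n (V : normedModType R) k (U : set 'rV[R]_n) (a : 'rV[R]_n -> R)
    (b : 'rV[R]_n -> V) : open U ->
  Ck k U a -> Ck k U b -> Ck k U (fun x => a x *: b x).
Proof.
move=> oU; elim: k a b => [|k IH] a b.
  move=> /= ca cb x Ux; apply: continuousZ; [exact: ca|exact: cb].
move=> Ca Cb; have [[da Da] [db Db]] := (Ca, Cb); split=> [x Ux|v].
  by have [] := is_diff_scale2 (da x Ux) (db x Ux).
apply: Ck_eq (CkD oU (IH _ _ (CkS Ca) (Db v)) (IH _ _ (Da v) (CkS Cb))) => //.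
move=> x; rewrite inE => Ux /=; have dx := is_diff_scale2 (da x Ux) (db x Ux).
rewrite [RHS]deriveE; last by case: dx.
by rewrite (@diff_val _ _ _ _ _ _ _ dx) (deriveE _ (da x Ux)) (deriveE _ (db x Ux)).
Qed.

Lemma Ck_coord n m k (U : set 'rV[R]_n) (f : 'rV[R]_n -> 'rV[R]_m) j : open U ->
  Ck k U f -> Ck k U (fun x => f x 0 j).
Proof.
move=> oU; elim: k f => [|k IH] f /=.
  move=> cf x Ux; apply: (@continuous_comp _ _ _ f (fun M : 'rV_m => M 0 j)).
    exact: cf.
  exact: coord_continuous.
move=> [df Df]; split=> [x Ux|v].
  apply: (@differentiable_comp _ _ _ _ f (fun M : 'rV[R]_m => M 0 j)).
    exact: df.
  exact: differentiable_coord.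
apply: Ck_eq (IH _ (Df v)) => // x; rewrite inE => Ux.
have dfx := df x Ux.
have dc : differentiable (fun M : 'rV[R]_m => M 0 j) (f x).
  exact: differentiable_coord.
have dfc : differentiable ((fun M : 'rV[R]_m => M 0 j) \o f) x.
  exact: differentiable_comp.
rewrite -[fun x => f x 0 j]/((fun M : 'rV[R]_m => M 0 j) \o f).
rewrite !deriveE// (@diff_comp _ _ _ _ f (fun M : 'rV[R]_m => M 0 j))//.
have lin : linear (fun M : 'rV[R]_m => M 0 j : R) by move=> a u w; rewrite !mxE.
pose h : {linear 'rV[R]_m -> R} := HB.pack (fun M : 'rV[R]_m => M 0 j : R)
  (GRing.isLinear.Build _ _ _ _ _ lin).
have := @diff_lin _ _ _ h (f x) (@coord_continuous _ _ _ 0 j).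
by move=> /(congr1 (fun F => F ('d f x v))) E; exact: (esym E).
Qed.

Lemma Ck_comp n m k (V : normedModType R) (U : set 'rV[R]_n)
    (W : set 'rV[R]_m) (f : 'rV[R]_n -> 'rV[R]_m) (g : 'rV[R]_m -> V) : open U ->
  (forall x, U x -> W (f x)) -> Ck k U f -> Ck k W g -> Ck k U (g \o f).
Proof.
move=> oU; elim: k f g => [|k IH] f g UW.
  by move=> /= cf cg x Ux; apply: continuous_comp; [exact: cf|exact/cg/UW].
move=> Cf Cg; have [[df Df] [dg Dg]] := (Cf, Cg); split=> [x Ux|v].
  by apply: differentiable_comp; [exact: df|exact/dg/UW].
apply: (@Ck_eq _ _ _ _ (fun x => \sum_(j < m) ('D_v f x) 0 j *: ('D_('e_j) g \o f) x)) => //.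
  move=> x; rewrite inE => Ux; have [dfx dgx] := (df x Ux, dg _ (UW x Ux)).
  rewrite [RHS]deriveE; last exact: differentiable_comp.
  rewrite (@diff_comp _ _ _ _ f g)//= -[in RHS](deriveE v dfx).
  rewrite [X in _ = 'd g _ X]row_sum_delta linear_sum.
  by apply: eq_bigr => j _; rewrite linearZ /= [in LHS](deriveE _ dgx).
apply: Ck_sum => // j; apply: CkZ => //; first exact: (Ck_coord j oU (Df v)).
exact: (IH _ _ UW (CkS Cf) (Dg _)).
Qed.

Lemma Ck_id n k (U : set 'rV[R]_n) : Ck k U (fun x => x).
Proof.
case: k => [|k] /=; first by move=> x _; exact: cvg_id.
split=> [x _|v]; first by have [] := @is_diff_id R 'rV[R]_n x.
rewrite (_ : 'D_v _ = fun=> v); first exact: Ck_cst.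
by apply/funext => x; rewrite derive_id.
Qed.

End Ck.

Section EuclideanDomains.
Context {R : realType}.

(* Open subsets of the Euclidean spaces, the possible domains of plots. *)
Record edom := Edom {
  edim : nat;
  eset :> set 'rV[R]_edim;
  eopen : open eset }.

Implicit Types U W : edom.

(* [g] is constrained on the open set [U] only, so it is any extension of [f]. *)
Definition smooth_map U (V : normedModType R) (f : U -> V) : Prop :=
  exists2 g : 'rV[R]_(edim U) -> V, smooth_on U g & forall u : U, g (\val u) = f u.

Definition edom_smooth W U (f : W -> U) : Prop :=
  smooth_map (fun w => \val (f w)).

(* [P] holds of the inclusion [W -> U] of some open neighbourhood [W] of [u]. *)
Definition locally U (u : U) (P : forall W, (W -> U) -> Prop) : Prop :=
  exists (W : set 'rV[R]_(edim U)) (oW : open W) (WU : W `<=` U),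
    W (\val u) /\ P (Edom oW) (subfun WU).

Lemma locally_mono U (u : U) (P Q : forall W, (W -> U) -> Prop) :
  (forall W i, P W i -> Q W i) -> locally u P -> locally u Q.
Proof. by move=> PQ [W [oW [WU [Wu PW]]]]; exists W, oW, WU; split=> //; exact: PQ. Qed.

Lemma locally_self U (u : U) (P : forall W, (W -> U) -> Prop) :
  P U id -> locally u P.
Proof.
case: U u P => n U oU u P PU; exists U, oU, (@subset_refl _ U).
split; first exact: set_valP.
rewrite (_ : subfun _ = id)//; apply/funext => x; exact: val_inj.
Qed.

Lemma locally_trans U (u : U) (P : forall W, (W -> U) -> Prop) :
  locally u (fun W i => forall w : W, locally w (fun W' j => P W' (i \o j))) ->
  locally u P.
Proof.
move=> [W [oW [WU [Wu /(_ (SigSub (mem_set Wu))) [W' [oW' [W'W [W'u PW']]]]]]]].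
exists W', oW', (subset_trans W'W WU); split=> //.
rewrite (_ : subfun _ = subfun WU \o subfun W'W)//.
by apply/funext => x; exact: val_inj.
Qed.

Lemma smooth_map_local U (V : normedModType R) (f : U -> V) :
  (forall u, locally u (fun W i => smooth_map (f \o i))) -> smooth_map f.
Proof.
move=> H; pose g (x : 'rV[R]_(edim U)) :=
  if pselect (@eset U x) is left Ux then f (SigSub (mem_set Ux)) else 0.
have gE (u : U) : g (\val u) = f u.
  rewrite /g; case: pselect => [Ux|/(_ (set_valP u))//].
  by congr f; exact: val_inj.
exists g => // k; apply: Ck_local => x Ux.
have [W [oW [WU [Wx [h hW hE]]]]] := H (SigSub (mem_set Ux)).
exists W; split=> //; apply: Ck_eq (hW k) => // y Wy.
by rewrite -[y]/(\val (SigSub Wy : W)) (hE (SigSub Wy)) /= -gE.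
Qed.

Lemma edom_smooth_subfun U (W : set 'rV[R]_(edim U)) (oW : open W)
  (WU : W `<=` U) : @edom_smooth (Edom oW) U (subfun WU).
Proof. by exists id => // k; exact: Ck_id. Qed.

Lemma edom_smooth_id U : @edom_smooth U U id.
Proof. by exists id => // k; exact: Ck_id. Qed.

Lemma edom_smooth_cst U W (u : U) : @edom_smooth W U (fun=> u).
Proof. by exists (fun=> \val u) => // k; exact: Ck_cst. Qed.

Lemma smooth_map_comp W U (V : normedModType R) (f : W -> U) (g : U -> V) :
  edom_smooth f -> smooth_map g -> smooth_map (g \o f).
Proof.
move=> [f' fs fE] [g' gs gE]; exists (g' \o f') => [k|w]; last first.
  by rewrite /= fE gE.
have WU x : @eset W x -> @eset U (f' x).
  move=> Wx; by rewrite (fE (SigSub (mem_set Wx))); exact: set_valP.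
exact: (Ck_comp (@eopen W) WU (fs k) (gs k)).
Qed.

Lemma edom_smooth_comp W U U' (f : W -> U) (g : U -> U') :
  edom_smooth f -> edom_smooth g -> edom_smooth (g \o f).
Proof. exact: smooth_map_comp. Qed.

Lemma edom_smooth_local U U' (f : U -> U') :
  (forall u, locally u (fun W i => edom_smooth (f \o i))) -> edom_smooth f.
Proof. exact: smooth_map_local. Qed.

Lemma locally_comp W U (f : W -> U) (w : W) (P : forall U', (U' -> U) -> Prop)
    (Q : forall W', (W' -> W) -> Prop) : edom_smooth f ->
  (forall U' i W' j (h : W' -> U'), edom_smooth h -> f \o j = i \o h ->
    P U' i -> Q W' j) ->
  locally (f w) P -> locally w Q.
Proof.
move=> fs PQ [U' [oU' [U'U [U'fw PU']]]]; have [g gs gE] := fs.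
pose W' := [set x | @eset W x /\ U' (g x)].
have W'W : W' `<=` W by move=> x [].
have oW' : open W'.
  rewrite openE => x [Wx U'gx]; rewrite /interior.
  have cg : {for x, continuous g} := gs 0%N x Wx.
  have nW : nbhs x W by apply: open_nbhs_nbhs; split=> //; exact: eopen.
  have nU : nbhs x (g @^-1` U') by apply: cg; exact: open_nbhs_nbhs.
  by apply: filterS2 nW nU => y; split.
have U'f (v : Edom oW') : U' (\val (f (subfun W'W v))).
  by rewrite -gE; case: (set_valP v).
exists W', oW', W'W; split; first by split; [exact: set_valP|rewrite gE].
apply: (PQ _ _ _ _ (fun v : Edom oW' => SigSub (mem_set (U'f v)) : Edom oU')) PU'.
  apply: (@edom_smooth_comp (Edom oW') W U _ f (edom_smooth_subfun oW' W'W) fs).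
by apply/funext => v; exact: val_inj.
Qed.

End EuclideanDomains.
Arguments edom : clear implicits.


Section DiffeologicalSpaces.
Context {R : realType}.
Implicit Types U W : edom R.

Record diffeology (T : Type) := Diffeology {
  plots : forall U, set (U -> T);
  plots_cst : forall U (t : T), plots (fun _ : U => t);
  plots_local : forall U (p : U -> T),
    (forall u, locally u (fun W i => plots (p \o i))) -> plots p;
  plots_comp : forall U W (p : U -> T) (f : W -> U),
    plots p -> edom_smooth f -> plots (p \o f) }.

Record diffSpace := DiffSpace {
  dcarrier :> Type;
  dstruct : diffeology dcarrier }.

Definition plot (X : diffSpace) U (p : U -> X) : Prop := plots (dstruct X) p.

Definition dsmooth (X Y : diffSpace) (f : X -> Y) : Prop :=
  forall U (p : U -> X), plot p -> plot (f \o p).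

Record smap (X Y : diffSpace) := SMap {
  smap_fun :> X -> Y;
  smapP : dsmooth smap_fun }.

Definition diffeomorphism (X Y : diffSpace) (f : X -> Y) : Prop :=
  dsmooth f /\ exists g : Y -> X, [/\ dsmooth g, cancel f g & cancel g f].

Lemma dsmooth_comp (X Y Z : diffSpace) (f : X -> Y) (g : Y -> Z) :
  dsmooth f -> dsmooth g -> dsmooth (g \o f).
Proof. by move=> fs gs U p /fs /gs. Qed.

Lemma smap_ext (X Y : diffSpace) (f g : smap X Y) : f =1 g -> f = g.
Proof.
case: f g => [f fs] [g gs] /= /funext E; subst g.
by congr SMap; exact: Prop_irrelevance.
Qed.

Definition smap_id (X : diffSpace) : smap X X :=
  @SMap X X id (fun U p pp => pp).

Definition smap_comp (X Y Z : diffSpace) (g : smap Y Z) (f : smap X Y) :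
  smap X Z := SMap (dsmooth_comp (@smapP _ _ f) (@smapP _ _ g)).

Program Definition edomSpace (U : edom R) : diffSpace :=
  @DiffSpace U (@Diffeology U (fun W f => edom_smooth f) _ _ _).
Next Obligation. by move=> U W u; exact: edom_smooth_cst. Qed.
Next Obligation. by move=> U W f; exact: edom_smooth_local. Qed.
Next Obligation. by move=> U W W' p f ps fs; exact: edom_smooth_comp fs ps. Qed.

Program Definition realSpace : diffSpace :=
  @DiffSpace R (@Diffeology R (fun W f => smooth_map f) _ _ _).
Next Obligation. by move=> U t; exists (fun=> t) => // k; exact: Ck_cst. Qed.
Next Obligation. by move=> U f; exact: smooth_map_local. Qed.
Next Obligation. by move=> U W p f ps fs; exact: smooth_map_comp fs ps. Qed.

Program Definition prodSpace (X Y : diffSpace) : diffSpace :=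
  @DiffSpace (X * Y) (@Diffeology (X * Y)
    (fun U p => plot (fst \o p) /\ plot (snd \o p)) _ _ _).
Next Obligation. by move=> X Y U [x y]; split; exact: plots_cst. Qed.
Next Obligation.
move=> X Y U p H; split; apply: plots_local => u;
  by apply: locally_mono (H u) => W i [].
Qed.
Next Obligation.
by move=> X Y U W p f [p1 p2] fs; split; [exact: (plots_comp p1 fs)|exact: (plots_comp p2 fs)].
Qed.

Program Definition famSpace (I : Type) (X : I -> diffSpace) : diffSpace :=
  @DiffSpace (forall i, X i) (@Diffeology (forall i, X i)
    (fun U p => forall i, plot (fun u => p u i)) _ _ _).
Next Obligation. by move=> I X U t i; exact: plots_cst. Qed.
Next Obligation.
move=> I X U p H i; apply: plots_local => u.
by apply: locally_mono (H u) => W j /(_ i).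
Qed.
Next Obligation.
by move=> I X U W p f ps fs i; exact: (plots_comp (ps i) fs).
Qed.

Program Definition subSpace (X : diffSpace) (A : set X) : diffSpace :=
  @DiffSpace A (@Diffeology A (fun U p => @plot X U (fun u => \val (p u))) _ _ _).
Next Obligation. by move=> X A U t; exact: plots_cst. Qed.
Next Obligation. by move=> X A U p; exact: plots_local. Qed.
Next Obligation. by move=> X A U W p f ps fs; exact: (plots_comp ps fs). Qed.

Program Definition sumSpace (I : Type) (X : I -> diffSpace) : diffSpace :=
  @DiffSpace {i & X i} (@Diffeology {i & X i}
    (fun U p => forall u, locally u (fun W j =>
       exists k (s : W -> X k), plot s /\ p \o j = existT _ k \o s)) _ _ _).
Next Obligation.
move=> I X U [k t] u; apply: locally_self.
by exists k, (fun=> t); split=> //; exact: plots_cst.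
Qed.
Next Obligation.
move=> I X U p H u; apply: locally_trans.
by apply: locally_mono (H u) => W j.
Qed.
Next Obligation.
move=> I X U W p f ps fs w; move: (ps (f w)); apply: (locally_comp fs).
move=> U' i W' j h hs E [k [s [sp sE]]]; exists k, (s \o h); split.
  exact: plots_comp.
by rewrite -compA E compA sE.
Qed.

(* [p] lifts locally along [q] to plots of [X]. *)
Definition lift_plot (X : diffSpace) (T : Type) (q : X -> T) U (p : U -> T) :=
  forall u, locally u (fun W j => exists2 s : W -> X, plot s & p \o j = q \o s).

Definition subduction (X Y : diffSpace) (q : X -> Y) : Prop :=
  (forall y, exists x, q x = y) /\
  forall U (p : U -> Y), plot p <-> lift_plot q p.

(* The quotient of [T] by the equivalence relation generated by [E] (by [E]
   itself when [E] is an equivalence relation), as a set of classes. *)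
Definition quot (T : Type) (E : T -> T -> Prop) : Type :=
  range (fun x : T => [set y | clos_refl_sym_trans T E x y]).

Definition qclass T (E : T -> T -> Prop) (x : T) : quot E :=
  SigSub (mem_set (imageT (fun x => [set y | clos_refl_sym_trans T E x y]) x)).

Lemma qclass_surj T (E : T -> T -> Prop) (q : quot E) :
  exists x, qclass E x = q.
Proof.
by case: q => C CE; have [x _ xE] := set_mem CE; exists x; exact: val_inj.
Qed.

Lemma qclassP T (E : T -> T -> Prop) x y :
  qclass E x = qclass E y <-> clos_refl_sym_trans T E x y.
Proof.
split=> [/(congr1 val)/= H|H].
  have : [set z | clos_refl_sym_trans T E y z] y by exact: rst_refl.
  by rewrite -H.
apply: val_inj => /=; apply/seteqP; split=> z /= Hz.
  by apply: rst_trans Hz; exact: rst_sym.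
exact: rst_trans Hz.
Qed.

Definition qrepr T (E : T -> T -> Prop) (q : quot E) : T :=
  projT1 (cid (qclass_surj q)).

Definition qmap T T' (E : T -> T -> Prop) (E' : T' -> T' -> Prop) (f : T -> T')
    (fE : forall x y, E x y -> E' (f x) (f y)) (q : quot E) : quot E' :=
  qclass E' (f (qrepr q)).

Lemma qmapE T T' (E : T -> T -> Prop) (E' : T' -> T' -> Prop) (f : T -> T')
  (fE : forall x y, E x y -> E' (f x) (f y)) x :
  qmap fE (qclass E x) = qclass E' (f x).
Proof.
apply/qclassP; rewrite /qrepr; case: cid => y /= /qclassP.
elim=> {x y} [x y /fE|x|x y _|x y z _ + _]; [exact: rst_step|exact: rst_refl|
  exact: rst_sym|exact: rst_trans].
Qed.

Program Definition quotSpace (X : diffSpace) (E : X -> X -> Prop) : diffSpace :=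
  @DiffSpace (quot E) (@Diffeology (quot E)
    (fun U p => lift_plot (qclass E) p) _ _ _).
Next Obligation.
move=> X E U t u; apply: locally_self; have [x <-] := qclass_surj t.
by exists (fun=> x) => //; exact: plots_cst.
Qed.
Next Obligation.
move=> X E U p H u; apply: locally_trans.
by apply: locally_mono (H u) => W j.
Qed.
Next Obligation.
move=> X E U W p f ps fs w; move: (ps (f w)); apply: (locally_comp fs).
move=> U' i W' j h hs e [s sp sE]; exists (s \o h); first exact: plots_comp.
by rewrite -compA e compA sE.
Qed.

(* The sets that are open for the finest topology making all plots continuous;
   openness of a subset of [U] does not depend on whether it is taken in [U] or
   in the ambient Euclidean space. *)
Definition D_open (X : diffSpace) (A : set X) : Prop :=
  forall U (p : U -> X), plot p -> open (\val @` (p @^-1` A)).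

Definition D_closure (X : diffSpace) (A : set X) : set X :=
  \bigcap_(C in [set C | D_open (~` C) /\ A `<=` C]) C.

End DiffeologicalSpaces.
Arguments diffSpace : clear implicits.
Arguments realSpace : clear implicits.

Section PrincipalBundles.
Context {R : realType}.
Local Open Scope group_scope.

Record diffGroup := DiffGroup {
  dgroup :> groupType;
  dgroup_diffeology : @diffeology R dgroup;
  dgroup_mul : @dsmooth R (prodSpace (DiffSpace dgroup_diffeology)
      (DiffSpace dgroup_diffeology)) (DiffSpace dgroup_diffeology)
    (fun gh => gh.1 * gh.2);
  dgroup_inv : @dsmooth R (DiffSpace dgroup_diffeology)
    (DiffSpace dgroup_diffeology) (fun g => g^-1) }.

Coercion groupSpace (G : diffGroup) : diffSpace R :=
  DiffSpace (dgroup_diffeology G).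

(* A smooth right [G]-space over [X]; it need not be principal. *)
Record Gspace (G : diffGroup) (X : diffSpace R) := GSpace {
  total :> diffSpace R;
  action : total -> G -> total;
  proj : total -> X;
  action_smooth : @dsmooth R (prodSpace total G) total
    (fun pg => action pg.1 pg.2);
  action1 : forall p, action p 1 = p;
  actionM : forall p g h, action (action p g) h = action p (g * h);
  proj_smooth : dsmooth proj;
  proj_action : forall p g, proj (action p g) = proj p }.

Section PrincipalBundlesOver.
Context {G : diffGroup} {X : diffSpace R}.
Implicit Types (P : Gspace G X).

Definition fiber_square P : set (prodSpace P P) :=
  [set pq | proj pq.1 = proj pq.2].

(* The map (p, g) |-> (p, p.g) into the fiber product of [P] with itself. *)
Definition shear P (pg : prodSpace P G) : subSpace (@fiber_square P) :=
  SigSub (mem_set (esym (proj_action pg.1 pg.2) :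
    @fiber_square P (pg.1, action pg.1 pg.2))).

(* The first two conditions say that [proj] is a quotient map for the action,
   that is, that it induces a diffeomorphism from P/G onto X. *)
Definition principal P : Prop :=
  [/\ subduction (@proj G X P),
      forall p q : P, proj p = proj q <-> exists g, q = action p g &
      diffeomorphism (@shear P)].

Definition trivializable P : Prop :=
  exists Phi : P -> prodSpace X G,
    [/\ diffeomorphism Phi,
        forall p, (Phi p).1 = proj p &
        forall p g, Phi (action p g) = ((Phi p).1, (Phi p).2 * g)].

End PrincipalBundlesOver.

Program Definition restrict_bundle (G : diffGroup) (X : diffSpace R) (P : Gspace G X)
    (A : set X) : Gspace G (subSpace A) :=
  @GSpace G (subSpace A) (@subSpace R P (@proj _ _ P @^-1` A))
    (fun p g => SigSub (mem_set (_ : (@proj _ _ P @^-1` A) (action (\val p) g))))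
    (fun p => SigSub (mem_set (set_valP p : A (proj (\val p)))))
    _ _ _ _ _.
Next Obligation.
by move=> G X P A p g; rewrite /preimage /= proj_action; exact: (set_valP p).
Qed.
Next Obligation.
move=> G X P A U p [p1 p2].
exact: (@action_smooth _ _ P U (fun u => (\val (p u).1, (p u).2)) (conj p1 p2)).
Qed.
Next Obligation. by move=> G X P A p; apply: val_inj; exact: action1. Qed.
Next Obligation. by move=> G X P A p g h; apply: val_inj; exact: actionM. Qed.
Next Obligation. by move=> G X P A U p pp; exact: proj_smooth pp. Qed.
Next Obligation. by move=> G X P A p g; apply: val_inj; exact: proj_action. Qed.

Definition D_support (X : diffSpace R) (f : X -> realSpace R) : set X :=
  D_closure [set x | f x <> 0%R].

Definition partition_of_unity (X : diffSpace R) (I : choiceType)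
    (V : I -> set X) (zeta : I -> smap X (realSpace R)) : Prop :=
  [/\ forall i x, (0 <= zeta i x :> R)%R,
      forall i, D_support (zeta i) `<=` V i,
      forall x, exists W, [/\ D_open W, W x &
        finite_set [set i | W `&` D_support (zeta i) !=set0]] &
      forall x, (\sum_(i \in [set: I]) (zeta i x : R))%R = 1%R].

Definition D_numerable (G : diffGroup) (X : diffSpace R) (P : Gspace G X) :=
  exists (I : choiceType) (V : I -> set X) (zeta : I -> smap X (realSpace R)),
    [/\ forall i, D_open (V i),
        forall x, exists i, V i x,
        forall i, trivializable (restrict_bundle P (V i)) &
        partition_of_unity V zeta].

Definition all_D_numerable (G : diffGroup) (X : diffSpace R) : Prop :=
  forall P : Gspace G X, principal P -> D_numerable P.

End PrincipalBundles.
Arguments diffGroup : clear implicits.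

Section ClassifyingSpace.
Context {R : realType} (G : diffGroup R).
Local Open Scope group_scope.

Definition unitSpace : diffSpace R := @subSpace R (realSpace R) `[0%R, 1%R].

Definition joinSpace : diffSpace R :=
  prodSpace (famSpace (fun _ : nat => unitSpace))
            (famSpace (fun _ : nat => G : diffSpace R)).

Definition join_set : set joinSpace :=
  [set s | finite_set [set i | \val (s.1 i) <> 0%R] /\
           (\sum_(i \in [set: nat]) \val (s.1 i))%R = 1%R].

Definition join_rel (s s' : subSpace join_set) : Prop :=
  forall i, (\val s).1 i = (\val s').1 i /\
    (\val ((\val s).1 i) <> 0%R -> (\val s).2 i = (\val s').2 i).

Definition EG : diffSpace R := quotSpace join_rel.

Definition join_act (g : G) (s : subSpace join_set) : subSpace join_set :=
  SigSub (mem_set (set_valP s :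
    join_set ((\val s).1, fun i => (\val s).2 i * g))).

Lemma join_act_rel g s s' :
  join_rel s s' -> join_rel (join_act g s) (join_act g s').
Proof. by move=> E i; have [E1 E2] := E i; split=> //= /E2 ->. Qed.

(* The action of [g] is induced on classes; [join_act_rel] makes it well defined
   (see [qmapE]). *)
Definition EG_act (e : EG) (g : G) : EG := qmap (join_act_rel g) e.

Definition BG : diffSpace R :=
  quotSpace (fun e e' : EG => exists g, e' = EG_act e g).

End ClassifyingSpace.

Section Homotopy.
Context {R : realType}.
Implicit Types X Y B : diffSpace R.

Definition smooth_homotopic X B (f0 f1 : smap X B) : Prop :=
  exists H : smap (prodSpace X (realSpace R)) B,
    (forall x, H (x, 0) = f0 x) /\ (forall x, H (x, 1) = f1 x).

Definition htpy X B : Type := quot (@smooth_homotopic X B).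

Lemma smooth_homotopic_precomp X Y B (f : smap Y X) (g0 g1 : smap X B) :
  smooth_homotopic g0 g1 ->
  smooth_homotopic (smap_comp g0 f) (smap_comp g1 f).
Proof.
move=> [H [H0 H1]].
have Hs : @dsmooth R (prodSpace Y (realSpace R)) B (fun yt => H (f yt.1, yt.2)).
  move=> U p [p1 p2].
  apply: (@smapP _ _ _ H U (fun u => (f (p u).1, (p u).2))); split=> //.
  exact: (@smapP _ _ _ f U (fst \o p)).
by exists (SMap Hs); split=> y /=.
Qed.

(* Precomposition with [f] on homotopy classes. *)
Definition htpy_precomp X Y B (f : smap Y X) : htpy X B -> htpy Y B :=
  qmap (@smooth_homotopic_precomp X Y B f).

End Homotopy.

Section Cech.
Context {R : realType}.
Implicit Types X Y : diffSpace R.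

Record plotOf X := PlotOf {
  pdom : edom R;
  pmap :> pdom -> X;
  pmapP : plot pmap }.

Definition generating X (Q : set (plotOf X)) : Prop :=
  forall (U : edom R) (p : U -> X), plot p ->
    forall u, locally u (fun W j => exists2 q, Q q &
      exists2 f : W -> pdom q, edom_smooth f & p \o j = q \o f).

Record genFamily X := GenFamily {
  gfam :> set (plotOf X);
  gfamP : generating gfam }.

Definition nebula X (Q : genFamily X) : diffSpace R :=
  sumSpace (fun q : Q => edomSpace (pdom (\val q))).

Definition ev X (Q : genFamily X) (v : nebula Q) : X :=
  pmap (tagged v).

(* [nerve Q k] is the [k.+1]-fold fiber product of [nebula Q] over [X]. *)
Definition nerve X (Q : genFamily X) (k : nat) : diffSpace R :=
  @subSpace R (famSpace (fun _ : 'I_k.+1 => nebula Q))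
    [set v | forall i j, ev (v i) = ev (v j)].

Program Definition face X (Q : genFamily X) k (i : 'I_k.+2)
    (v : nerve Q k.+1) : nerve Q k :=
  SigSub (mem_set (_ : [set w | forall a b, ev (w a) = ev (w b)]
    (fun j : 'I_k.+1 => \val v (lift i j)))).
Next Obligation.
by move=> X Q k i v a b /=; exact: (set_valP v).
Qed.

Section Cochains.
Context (G : diffGroup R).
Local Open Scope group_scope.

(* Since [G] is written multiplicatively, the sign (-1)^i becomes an inverse. *)
Definition cobound X (Q : genFamily X) k (f : nerve Q k -> G)
    (v : nerve Q k.+1) : G :=
  \prod_(i < k.+2) (if odd i then (f (face i v))^-1 else f (face i v)).

Record cocycle X (Q : genFamily X) k := Cocycle {
  cochain :> smap (nerve Q k) G;
  cocycleP : forall v, cobound cochain v = 1 }.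

Definition cohomologous X (Q : genFamily X) k : cocycle Q k -> cocycle Q k -> Prop :=
  match k with
  | 0 => fun c c' => c = c'
  | k'.+1 => fun c c' => exists h : smap (nerve Q k') G,
      forall v, c v = c' v * cobound h v
  end.

Definition cechFam X (Q : genFamily X) (k : nat) : Type :=
  quot (@cohomologous X Q k).

End Cochains.

(* Smooth maps of nebulae covering a smooth map [f : Y -> X]. *)
Record nebulaMap X Y (f : smap Y X) (Q : genFamily X) (P : genFamily Y) :=
  NebulaMap {
    nmap :> smap (nebula P) (nebula Q);
    nmapP : forall v, ev (nmap v) = f (ev v) }.

Section Pullback.
Context {X Y : diffSpace R} {f : smap Y X} {Q : genFamily X} {P : genFamily Y}.
Context (F : nebulaMap f Q P).

Program Definition nerve_fun k (v : nerve P k) : nerve Q k :=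
  SigSub (mem_set (_ : [set w | forall a b, ev (w a) = ev (w b)]
    (fun j : 'I_k.+1 => F (\val v j)))).
Next Obligation. by move=> k v a b /=; rewrite !nmapP (set_valP v a b). Qed.

Lemma nerve_fun_smooth k : dsmooth (@nerve_fun k).
Proof. by move=> U p pp i; exact: (@smapP _ _ _ F U _ (pp i)). Qed.

Definition nerve_map k : smap (nerve P k) (nerve Q k) :=
  SMap (@nerve_fun_smooth k).

Context {G : diffGroup R}.

Lemma cobound_pull k (h : nerve Q k -> G) v :
  cobound (h \o nerve_map k) v = cobound h (nerve_map k.+1 v).
Proof.
apply: eq_bigr => i _ /=.
by rewrite (_ : nerve_fun (face i v) = face i (nerve_fun v))//; exact: val_inj.
Qed.

Program Definition cocycle_pull k (c : cocycle G Q k) : cocycle G P k :=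
  @Cocycle G Y P k (smap_comp c (nerve_map k)) _.
Next Obligation. by move=> k c v; rewrite (cobound_pull c) cocycleP. Qed.

Lemma cohomologous_pull k (c c' : cocycle G Q k) :
  cohomologous c c' -> cohomologous (cocycle_pull c) (cocycle_pull c').
Proof.
case: k c c' => [|k] c c' /=; first by move=> ->.
move=> [h hE]; exists (smap_comp h (nerve_map k)) => v /=.
by rewrite hE (cobound_pull h).
Qed.

(* The map induced in cohomology by pulling back cocycles along [F]. *)
Definition cech_pull k : cechFam G Q k -> cechFam G P k :=
  qmap (@cohomologous_pull k).

End Pullback.

Record refinement X (Q P : genFamily X) := Refinement {
  rindex : P -> Q;
  rmap : forall b : P, pdom (\val b) -> pdom (\val (rindex b));
  rmap_smooth : forall b, edom_smooth (@rmap b);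
  rmapP : forall b u, pmap (@rmap b u) = pmap u }.

Program Definition refinement_map X (Q P : genFamily X) (r : refinement Q P) :
    nebulaMap (smap_id X) Q P :=
  @NebulaMap X X (smap_id X) Q P
    (@SMap R (nebula P) (nebula Q)
      (fun v => existT _ (rindex r (tag v)) (@rmap _ _ _ r _ (tagged v))) _) _.
Next Obligation.
move=> X Q P r U p pp u; apply: locally_mono (pp u) => W j [k [s [sp sE]]].
exists (rindex r k), (@rmap _ _ _ r k \o s); split.
  exact: (edom_smooth_comp sp (rmap_smooth r k)).
by apply/funext => w; have /funeqP/(_ w)/= -> := sE.
Qed.
Next Obligation. by move=> X Q P r [b u]; exact: rmapP. Qed.

(* The colimit over generating families: classes of pairs of a family and a
   cohomology class, a class being identified with its image under refinement. *)
Definition cech_step (G : diffGroup R) X k (a b : {Q : genFamily X & cechFam G Q k}) :=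
  exists r : refinement (tag a) (tag b),
    tagged b = cech_pull (refinement_map r) (tagged a).

Definition cech (G : diffGroup R) X (k : nat) : Type := quot (@cech_step G X k).

Definition cech_class (G : diffGroup R) X k (Q : genFamily X) (a : cechFam G Q k) :
  cech G X k := qclass (@cech_step G X k) (existT _ Q a).

(* Every smooth map is covered by a map of nebulae. *)
Lemma nebulaMap_exists X Y (f : smap Y X) (Q : genFamily X) :
  exists P : genFamily Y, inhabited (nebulaMap f Q P).
Proof.
pose lifts (r : plotOf Y) (q : Q) (g : pdom r -> pdom (\val q)) :=
  edom_smooth g /\ forall u, f (r u) = \val q (g u).
pose P0 := [set r : plotOf Y | exists q g, @lifts r q g].
have P0gen : generating P0.
  move=> U p pp u; have pfp : plot (f \o p) := @smapP _ _ _ f U p pp.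
  have [W [oW [WU [Wu [q Qq [g gs gE]]]]]] := @gfamP _ Q U _ pfp u.
  exists W, oW, WU; split=> //.
  have pW : plot (p \o @subfun _ W U WU : Edom oW -> Y).
    exact: (plots_comp pp (edom_smooth_subfun oW WU)).
  exists (PlotOf pW); last by exists id; [exact: edom_smooth_id|].
  exists (SigSub (mem_set Qq)), g; split=> // w.
  by have /funeqP/(_ w) := gE.
pose P := GenFamily P0gen; exists P.
have H (r : P) : exists z : {q : Q & pdom (\val r) -> pdom (\val q)},
    lifts (\val r) (tag z) (tagged z).
  by have [q [g gP]] := set_valP r; exists (existT _ q g).
pose z r := projT1 (cid (H r)); have zP r := projT2 (cid (H r)).
have Fs : @dsmooth R (nebula P) (nebula Q)
    (fun v => existT _ (tag (z (tag v))) (tagged (z (tag v)) (tagged v))).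
  move=> U p pp u; apply: locally_mono (pp u) => W j [k [s [sp sE]]].
  exists (tag (z k)), (tagged (z k) \o s); split.
    exact: (edom_smooth_comp sp (zP k).1).
  by apply/funext => w; have /funeqP/(_ w)/= -> := sE.
have FE v : ev (SMap Fs v) = f (ev v).
  by case: v => r u; rewrite /ev /=; have [_ ->] := zP r.
exact: inhabits (NebulaMap FE).
Qed.

End Cech.

(* Main.v *)
Require Import Defs.
From HB Require Import structures.
From Stdlib Require Import Relations.
From mathcomp Require Import all_boot all_order all_algebra.
From mathcomp Require Import all_classical all_reals all_analysis.
From mathcomp Require Import ring lra.
Set Implicit Arguments.
Unset Strict Implicit.
Unset Printing Implicit Defensive.
Import Order.TTheory GRing.Theory Num.Theory.
Import numFieldNormedType.Exports.
Local Open Scope classical_set_scope.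
Local Open Scope ring_scope.

(** A class in the first cohomology and a map [f] to [BG] correspond to each
    other when, for a cocycle [c] on a generating family [Q], the map [f] lifts
    to a smooth map [F] from the nebula of [Q] to [EG] with [F v' = EG_act (F
    v) (c v v')] over each point of [X]. This relation is [Lifts], or
    [classified] once [F] is existentially quantified. The theorem says that it
    induces a bijection between cohomology classes and homotopy classes;
    naturality is then precomposition of [F] with a map of nebulae.

    Every [f] has a class: the plots of [X] along which [f] lifts to [EG] form
    a generating family, and the difference of the lifts in the fibres of [EG
    -> BG] is a cocycle ([classified_exists]). The class is unique: two lifts
    on one family differ by a cochain ([classified_unique]), two families have
    a common refinement, and a lift on a refinement descends
    ([classified_descend]), so that the relation depends on [f] and on the
    class in the colimit only ([ClassifiedP]).

    Every cocycle is realized ([cocycle_classified]). It defines a principal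
    bundle, which is D-numerable by hypothesis, hence trivial over the supports
    of a partition of unity indexed by an arbitrary set. The [m]-th slot of the
    lift is switched on where the values of the partition leave a gap around
    the scale [1 / (m + 1)]; there the set of indices above the gap is finite,
    nonempty and locally constant, so that one of its elements can be selected
    and its trivialization used.

    Two maps with the same cocycle are homotopic ([classified_homotopic]).
    Lifts that share their group components are joined by the segment between
    their weights ([compatible_homotopic]). Every lift is joined in this way,
    in two steps, to one that uses only slots of a prescribed parity
    ([spreadE]), and a lift on even slots and one on odd slots always share
    their group components.

    Homotopic maps have the same cocycles ([classified_homotopy]). A lift is
    carried along a short piece of the homotopy by keeping constant the group
    component of one slot whose weight stays nonzero ([transports_slot]). As
    [X] need not be locally compact, the length of the pieces is a smooth
    positive function on [X], chosen against the variation of the weights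
    uniformly in time ([step_size]). Suprema over the unit interval are not
    smooth; they are replaced by integrals, which dominate them by the
    fundamental theorem of calculus ([majorant]) and are smooth along plots by
    differentiation under the integral sign ([Ck_intp]). *)

(** * Flat functions *)

Section Flat.
Context {R : realType}.

(** The factor [z ^- n] makes the family closed under derivation, up to linear
    combinations ([is_derive_flat]), which gives smoothness by one induction
    ([Ck_flat]). *)
Definition flat (n : nat) (z : R) : R :=
  if 0 < z then z ^- n * expR (- z^-1) else 0.

Lemma flat_le0 n z : z <= 0 -> flat n z = 0.
Proof. by rewrite /flat; case: ltP. Qed.

Lemma flat_gt0 n z : 0 < z -> 0 < flat n z.
Proof. by move=> z0; rewrite /flat z0 mulr_gt0 ?expR_gt0 ?invr_gt0 ?exprn_gt0. Qed.

Lemma flat_ge0 n z : 0 <= flat n z.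
Proof. by have [/(flat_le0 n)->//|/(flat_gt0 n)/ltW] := leP z 0. Qed.

(** Near zero the exponential beats every power of [z^-1]; a quadratic bound is
    what the derivative at the origin requires. *)
Lemma flat_le_sqr n z : flat n z <= n.+2`!%:R * z ^+ 2.
Proof.
have [z0|z0] := leP z 0; first by rewrite flat_le0 // mulr_ge0 ?sqr_ge0.
rewrite /flat z0 expRN ler_pdivrMr ?expR_gt0 //.
have E : z ^- n.+2 / n.+2`!%:R <= expR (z^-1).
  rewrite -exprVn; apply: le_trans (expR_ge1Dxn n.+1 _); last by rewrite invr_ge0 ltW.
  by rewrite lerDr.
have f0 : 0 < n.+2`!%:R :> R by rewrite ltr0n fact_gt0.
apply: le_trans (ler_wpM2l _ E); last by rewrite mulr_ge0 ?sqr_ge0 // ltW.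
have -> : z ^+ n.+2 = z ^+ n * z ^+ 2 by rewrite -exprD addn2.
move: (n.+2`!%:R) f0 => c c0; rewrite le_eqVlt; apply/orP; left; apply/eqP.
by field; rewrite expf_neq0 ?gt_eqF.
Qed.

Lemma flat0_mono (z z' : R) : z <= z' -> flat 0 z <= flat 0 z'.
Proof.
move=> zz'; have [z0|z0] := leP z 0; first by rewrite (flat_le0 _ z0) flat_ge0.
rewrite /flat z0 (lt_le_trans z0 zz') !expr0 invr1 !mul1r ler_expR lerN2.
by rewrite lef_pV2 ?posrE // (lt_le_trans z0).
Qed.

Lemma flat0_le1 (z : R) : flat 0 z <= 1.
Proof.
rewrite /flat; case: ifP => // z0; rewrite expr0 invr1 mul1r.
by rewrite -expR0 ler_expR oppr_le0 invr_ge0 ltW.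
Qed.

Lemma is_derive_flat n (z : R) :
  is_derive z 1 (flat n) (flat n.+2 z - n%:R * flat n.+1 z).
Proof.
have [z0|z0|->] := ltgtP z 0.
- rewrite !flat_le0 ?ltW // mulr0 subr0.
  apply: (@near_eq_is_derive _ _ _ (cst 0)).
  by near=> y; rewrite flat_le0 // ltW //; near: y; exact: lt_nbhsl.
- have zn : z != 0 by rewrite gt_eqF.
  apply: (@near_eq_is_derive _ _ _ (fun y : R => y ^- n * expR (- y^-1))).
  + near=> y; rewrite /flat; case: ltP => //; rewrite leNgt.
    suff -> : 0 < y by []. by near: y; exact: lt_nbhsr.
  + have dV : is_derive z 1 (fun y : R => y^-1) (- z ^- 2).
      apply: DeriveDef; first exact: diff_derivable (differentiable_Rinv zn).
      rewrite (deriveE _ (differentiable_Rinv zn)) (diff_Rinv zn).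
      by rewrite -[LHS]/(_ * _) mulr1.
    have dX : is_derive z 1 (fun y : R => y ^- n) (- (n%:R * z ^- n.+1)).
      rewrite (_ : (fun y => _) = (fun y : R => y^-1) ^+ n); last first.
        by apply/funext => y; rewrite exprfctE exprVn.
      case: n => [|n]; first by rewrite expr0 mul0r oppr0; exact: is_derive_cst.
      apply: is_derive_eq; rewrite -!exprVn -[LHS]/(_ * _) /= !exprS !exprVn.
      by rewrite expr0; field; rewrite expf_neq0 zn.
    have dE : is_derive z 1 (fun y : R => expR (- y^-1)) (z ^- 2 * expR (- z^-1)).
      have := @is_derive1_comp R expR (fun y => - y^-1) z _ _
        (is_derive_expR (- z^-1)) (is_deriveN dV).
      by rewrite opprK /= mulrC.
    have := is_deriveM dX dE; rewrite /flat z0 => D.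
    apply: is_derive_eq; rewrite -!exprVn -![_ *: _]/(_ * _) /= !exprS !exprVn.
    by rewrite ?expr0; field; rewrite expf_neq0 zn.
- rewrite !flat_le0 // mulr0 subr0.
  have lim : (fun h : R => h^-1 *: (flat n (h *: 1 + 0) - flat n 0)) @ 0^' --> (0 : R).
    pose K : R := n.+2`!%:R.
    have K0 : 0 <= K by [].
    apply/cvgr0Pnorm_le => e e0; near=> h.
    have h0 : h != 0 by near: h; exact: nbhs_dnbhs_neq.
    rewrite (flat_le0 _ (lexx 0)) subr0 addr0 -[h *: 1]/(h * 1) mulr1.
    rewrite -[_ *: _]/(_ * _) normrM normfV ler_pdivrMl ?normr_gt0 //.
    rewrite ger0_norm ?flat_ge0 // (le_trans (flat_le_sqr _ _)) // -/K.
    rewrite -real_normK ?num_real // expr2 mulrCA ler_wpM2l //.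
    rewrite (@le_trans _ _ ((K + 1) * `|h|)) ?ler_wpM2r ?lerDl //.
    rewrite -ler_pdivlMl; last by rewrite ltr_wpDl.
    near: h; apply: dnbhs0_le; rewrite mulr_gt0 ?invr_gt0 // ltr_wpDl //.
  apply: DeriveDef; last exact/cvg_lim.
  by apply/cvg_ex; exists 0.
Unshelve. all: by end_near. Qed.

Lemma derive_comp1 (V : normedModType R) (f : V -> R) (g : R -> R) (dg : R) x v :
  differentiable f x -> is_derive (f x) 1 g dg ->
  differentiable (g \o f) x /\ 'D_v (g \o f) x = 'D_v f x *: dg.
Proof.
move=> df [dg1 dgE].
have dgf : differentiable g (f x) by exact/derivable1_diffP.
have dc : differentiable (g \o f) x by exact: differentiable_comp.
split=> //; rewrite (deriveE _ dc) (diff_comp df dgf) /= diff1E //.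
by rewrite derive1E dgE (deriveE _ df).
Qed.

Lemma Ck_flat d k n (U : set 'rV[R]_d) (f : 'rV[R]_d -> R) : open U ->
  Ck k U f -> Ck k U (flat n \o f).
Proof.
move=> oU; elim: k n f => [|k IH] n f.
  move=> cf x Ux; apply: continuous_comp; first exact: cf.
  apply: differentiable_continuous; apply/derivable1_diffP.
  by have [] := is_derive_flat n (f x).
move=> Cf; have [df Df] := Cf; split=> [x Ux|v].
  by have [] := derive_comp1 0 (df x Ux) (is_derive_flat n (f x)).
apply: (@Ck_eq _ _ _ _ _ (fun x => 'D_v f x *:
  (flat n.+2 (f x) + (- n%:R) *: flat n.+1 (f x)))) => //.
  move=> x; rewrite inE => Ux.
  have [_ ->] := derive_comp1 v (df x Ux) (is_derive_flat n (f x)).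
  by rewrite -mulNr.
apply: (CkZ oU (Df v)); apply: (CkD oU (IH _ _ (CkS Cf))).
exact: (CkZ oU (Ck_cst k U (- n%:R : R)) (IH n.+1 _ (CkS Cf))).
Qed.

Lemma Ck_inv d k (U : set 'rV[R]_d) (f : 'rV[R]_d -> R) : open U ->
  (forall x, U x -> f x != 0) -> Ck k U f -> Ck k U (fun x => (f x)^-1).
Proof.
move=> oU f0; elim: k => [|k IH].
  by move=> cf x Ux; apply: continuousV; [exact: f0|exact: cf].
move=> Cf; have [df Df] := Cf; split=> [x Ux|v].
  by apply: differentiableV; [exact: df|exact: f0].
have IHf := IH (CkS Cf).
apply: (@Ck_eq _ _ _ _ _ (fun x => (- 1) *: ('D_v f x *:
  ((f x)^-1 *: (f x)^-1)))) => //.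
  move=> x; rewrite inE => Ux.
  rewrite deriveV ?f0 //; last exact/diff_derivable/df.
  by rewrite -!exprVn -![_ *: _]/(_ * _) expr2; ring.
apply: CkZ => //; first exact: Ck_cst.
by apply: (CkZ oU (Df v)); exact: (CkZ oU IHf).
Qed.

End Flat.

(** * Neighbourhoods in plot domains and smooth real functions *)

Section LocalPlots.
Context {R : realType}.
Implicit Types (U W : edom R) (X Y : diffSpace R).

(** The neighbourhood filter of the open subset [U], read off in the ambient
    space. *)
Definition nb U (u : U) : set (set U) :=
  [set A | nbhs (\val u) [set y | forall w : U, \val w = y -> A w]].

Lemma nb_self U (u : U) (A : set U) : nb u A -> A u.
Proof. by move=> /nbhs_singleton; exact. Qed.

Global Instance nb_filter U (u : U) : ProperFilter (nb u).
Proof.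
split; first by move=> /nb_self.
split; first by rewrite /nb /=; apply: filterS filterT => y _ w.
- move=> A B HA HB; apply: (@filterS2 _ (nbhs (\val u)) _ _ _ _ _ HA HB).
  by move=> y Ay By w wy; split; [exact: Ay|exact: By].
- by move=> A B AB; apply: (@filterS _ (nbhs (\val u))) => y Ay w wy; exact/AB/Ay.
Qed.

Lemma nb_locally U (u : U) (A : set U) (P : forall W, (W -> U) -> Prop) :
  nb u A ->
  (forall W (j : W -> U), edom_smooth j -> (forall w, A (j w)) -> P W j) ->
  locally u P.
Proof.
rewrite /nb /= nbhsE => -[B [oB Bu BA]] H.
have oOU : open (B `&` (@eset R U)) by apply: openI => //; exact: eopen.
exists (B `&` @eset R U), oOU, (@subIsetr _ _ _); split; first by split=> //; exact: set_valP.
apply: H; first exact: edom_smooth_subfun.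
move=> w; apply: (BA (\val w)); last by [].
by have := set_valP w => -[].
Qed.

Lemma plot_near X U (p : U -> X) :
  (forall u, exists2 A : set U, nb u A & forall W (j : W -> U), edom_smooth j ->
     (forall w, A (j w)) -> plot (p \o j)) ->
  plot p.
Proof. by move=> H; apply: plots_local => u; have [A nA] := H u; exact: nb_locally. Qed.

Lemma plot_near_eq X U (p : U -> X) :
  (forall u, exists2 p' : U -> X, plot p' & nb u [set w | p w = p' w]) -> plot p.
Proof.
move=> H; apply: plot_near => u; have [p' pp' e] := H u.
exists [set w | p w = p' w] => // W j js E.
have -> : p \o j = p' \o j by apply/funext => w; exact: E.
exact: plots_comp pp' js.
Qed.

(** The maps out of a quotient are tested on plots that lift globally, up to
    localization. *)
Lemma plot_quot_rect (Z : diffSpace R) (E : Z -> Z -> Prop) U (p : U -> quotSpace E) Y (r : U -> Y) :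
  plot p ->
  (forall W (j : W -> U) (s : W -> Z), edom_smooth j -> plot s ->
    (forall w, p (j w) = qclass E (s w)) -> plot (r \o j)) ->
  plot r.
Proof.
move=> pp H; apply: plots_local => u.
have [W [oW [WU [Wu [s sp sE]]]]] := pp u; exists W, oW, WU; split=> //.
apply: (H _ _ s) => //; first exact: edom_smooth_subfun.
by move=> w; have /funeqP/(_ w) := sE.
Qed.

Lemma nb_gt U (f : U -> R) (u : U) (c : R) :
  smooth_map f -> c < f u -> nb u [set w | c < f w].
Proof.
move=> [g gs gE] cu; have cg : {for \val u, continuous g} := gs 0%N _ (set_valP u).
have := cg [set y | c < y]; rewrite gE => /(_ (lt_nbhsr cu)).
by apply: (@filterS _ (nbhs (\val u))) => y /= Hy w wy; rewrite /= -gE /= wy.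
Qed.

Lemma nb_lt U (f : U -> R) (u : U) (c : R) :
  smooth_map f -> f u < c -> nb u [set w | f w < c].
Proof.
move=> [g gs gE] cu; have cg : {for \val u, continuous g} := gs 0%N _ (set_valP u).
have := cg [set y | y < c]; rewrite gE => /(_ (lt_nbhsl cu)).
by apply: (@filterS _ (nbhs (\val u))) => y /= Hy w wy; rewrite /= -gE /= wy.
Qed.

Lemma nb_all_in (I : eqType) U (u : U) (r : seq I) (P : I -> set U) :
  (forall i, i \in r -> nb u (P i)) -> nb u [set w | forall i, i \in r -> P i w].
Proof.
elim: r => [|i r IH] H; first by apply: filterS filterT => w.
have Hr : nb u [set w | forall i, i \in r -> P i w].
  by apply: IH => j jr; apply: H; rewrite in_cons jr orbT.
apply: filterS2 (H i (mem_head _ _)) Hr => w Pi Pr j.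
by rewrite in_cons => /predU1P[->//|]; exact: Pr.
Qed.

Lemma smooth_mapD U (f g : U -> R) :
  smooth_map f -> smooth_map g -> smooth_map (fun u => f u + g u).
Proof.
move=> [f' fs fE] [g' gs gE]; exists (f' \+ g') => [k|u]; last by rewrite /= fE gE.
exact: (CkD (@eopen R U) (fs k) (gs k)).
Qed.

Lemma smooth_mapM U (f g : U -> R) :
  smooth_map f -> smooth_map g -> smooth_map (fun u => f u * g u).
Proof.
move=> [f' fs fE] [g' gs gE]; exists (fun x => f' x *: g' x) => [k|u].
  exact: (CkZ (@eopen R U) (fs k) (gs k)).
by rewrite fE gE.
Qed.

Lemma smooth_map_flat U n (f : U -> R) :
  smooth_map f -> smooth_map (fun u => flat n (f u)).
Proof.
move=> [f' fs fE]; exists (flat n \o f') => [k|u]; last by rewrite /= fE.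
exact: (Ck_flat n (@eopen R U) (fs k)).
Qed.

Lemma smooth_mapV U (f : U -> R) :
  smooth_map f -> (forall u, f u != 0) -> smooth_map (fun u => (f u)^-1).
Proof.
move=> [f' fs fE] f0; exists (fun x => (f' x)^-1) => [k|u]; last by rewrite fE.
apply: (Ck_inv (@eopen R U)) => // x Ux; by rewrite (fE (SigSub (mem_set Ux))) f0.
Qed.

(** Fixes the target to the real line, whose diffeology cannot be inferred from
    the bare type [R]. *)
Definition sm X (f : X -> R) : Prop := @dsmooth R X (realSpace R) f.

Section Algebra.
Context {X : diffSpace R}.
Implicit Types f g : X -> R.

Lemma sm_cst c : sm (fun _ : X => c).
Proof. by move=> U p _; exact: (plots_cst (dstruct (realSpace R)) U c). Qed.

Lemma smD f g : sm f -> sm g -> sm (fun x => f x + g x).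
Proof. by move=> fs gs U p pp; exact: smooth_mapD (fs U p pp) (gs U p pp). Qed.

Lemma smM f g : sm f -> sm g -> sm (fun x => f x * g x).
Proof. by move=> fs gs U p pp; exact: smooth_mapM (fs U p pp) (gs U p pp). Qed.

Lemma smN f : sm f -> sm (fun x => - f x).
Proof.
move=> fs; rewrite (_ : (fun x => _) = fun x => -1 * f x).
  by apply: smM => //; exact: sm_cst.
by apply/funext => x; rewrite mulN1r.
Qed.

Lemma smB f g : sm f -> sm g -> sm (fun x => f x - g x).
Proof. by move=> fs gs; apply: smD => //; exact: smN. Qed.

Lemma sm_flat n f : sm f -> sm (fun x => flat n (f x)).
Proof. by move=> fs U p pp; exact: smooth_map_flat (fs U p pp). Qed.

Lemma smV f : sm f -> (forall x, f x != 0) -> sm (fun x => (f x)^-1).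
Proof. by move=> fs f0 U p pp; apply: smooth_mapV (fs U p pp) _ => u; exact: f0. Qed.

Lemma sm_div f g : sm f -> sm g -> (forall x, g x != 0) -> sm (fun x => f x / g x).
Proof. by move=> fs gs g0; apply: smM => //; exact: smV. Qed.

Lemma sm_sum I (r : seq I) (F : I -> X -> R) :
  (forall i, sm (F i)) -> sm (fun x => \sum_(i <- r) F i x).
Proof.
move=> Fs; elim: r => [|i r IH].
  rewrite (_ : (fun x => _) = fun=> 0); first exact: sm_cst.
  by apply/funext => x; rewrite big_nil.
rewrite (_ : (fun x => _) = fun x => F i x + \sum_(i <- r) F i x); first exact: smD.
by apply/funext => x; rewrite big_cons.
Qed.

End Algebra.

Lemma sm_comp X Y (f : X -> Y) (g : Y -> R) : dsmooth f -> sm g -> sm (fun x => g (f x)).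
Proof. by move=> fs gs U p pp; exact: gs U _ (fs U p pp). Qed.

(** Local finiteness is required along plots only: these are the open sets on
    which smoothness is tested. *)
Definition locfin X (I : choiceType) (F : I -> X -> R) : Prop :=
  forall U (p : U -> X), plot p -> forall u, exists2 r : seq I, uniq r &
    nb u [set w | forall i, i \notin r -> F i (p w) = 0].

Lemma fsumE (I : choiceType) (r : seq I) (F : I -> R) : uniq r ->
  (forall i, i \notin r -> F i = 0) ->
  \sum_(i \in [set: I]) F i = \sum_(i <- r) F i.
Proof.
move=> ur F0; rewrite (fsbigE r) //; last by move=> i _ /F0.
by apply: eq_bigl => i; rewrite in_setT.
Qed.

Lemma sm_fsum X (I : choiceType) (F : I -> X -> R) :
  (forall i, sm (F i)) -> locfin F -> sm (fun x => \sum_(i \in [set: I]) F i x).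
Proof.
move=> Fs lF U p pp; apply: (@plot_near_eq (realSpace R)) => u.
have [r ur nr] := lF U p pp u.
exists (fun w => \sum_(i <- r) F i (p w)); first exact: (sm_sum r Fs pp).
by apply: filterS nr => w Hw /=; exact: fsumE.
Qed.

Lemma locfin_sub X (I : choiceType) (F G : I -> X -> R) :
  (forall i x, F i x = 0 -> G i x = 0) -> locfin F -> locfin G.
Proof.
move=> FG lF U p pp u; have [r ur nr] := lF U p pp u; exists r => //.
by apply: filterS nr => w Hw i /Hw; exact: FG.
Qed.

Lemma locfin_comp X Y (I : choiceType) (f : X -> Y) (F : I -> Y -> R) :
  dsmooth f -> locfin F -> locfin (fun i x => F i (f x)).
Proof. by move=> fs lF U p pp u; exact: lF (fs U p pp) u. Qed.

Lemma locfin_pt X (I : choiceType) (F : I -> X -> R) (x : X) : locfin F ->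
  exists2 r : seq I, uniq r & forall i, i \notin r -> F i x = 0.
Proof.
move=> lF; pose U := @Edom R 0 setT openT.
pose u : U := SigSub (mem_set (Logic.I : [set: 'rV[R]_0] 0)).
have [r ur nr] := lF U (fun=> x) (plots_cst _ U x) u.
by exists r => //; exact: nb_self nr.
Qed.

Lemma fsum_gt0 (I : choiceType) (F : I -> R) (r : seq I) (i : I) : uniq r ->
  (forall i, i \notin r -> F i = 0) -> (forall i, 0 <= F i) -> 0 < F i ->
  0 < \sum_(i \in [set: I]) F i.
Proof.
move=> ur F0 Fp Fi; rewrite (fsumE ur F0).
have ir : i \in r by apply: contraLR Fi => /F0 ->; rewrite ltxx.
by rewrite (big_rem i ir) /= ltr_pwDl // sumr_ge0.
Qed.

Lemma fsum_ge (I : choiceType) (F : I -> R) (r : seq I) (i : I) : uniq r ->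
  (forall i, i \notin r -> F i = 0) -> (forall i, 0 <= F i) ->
  F i <= \sum_(i \in [set: I]) F i.
Proof.
move=> ur F0 Fp; rewrite (fsumE ur F0).
have [ir|/F0->] := boolP (i \in r); last by rewrite sumr_ge0.
by rewrite (big_rem i ir) /= lerDl sumr_ge0.
Qed.

End LocalPlots.

(** * Locally finite refinement of a sequence of functions *)

Section Refinement.
Context {R : realType}.
Implicit Types a : nat -> R.

(** The weights of a plot of [EG] are finitely many at each point, but need not
    be so locally. Subtracting [m] times the sum of the earlier values kills
    all late indices wherever some earlier value is bounded below, which makes
    the family locally finite; the first positive value survives unchanged up
    to [flat]. *)
Definition cutoff a (m : nat) : R := flat 0 (a m - m%:R * \sum_(l < m) a l).

Definition refine a (m : nat) : R :=
  cutoff a m / \sum_(l \in [set: nat]) cutoff a l.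

Lemma cutoff_ge0 a m : 0 <= cutoff a m.
Proof. exact: flat_ge0. Qed.

Lemma cutoff_eq0 a m : a m <= m%:R * \sum_(l < m) a l -> cutoff a m = 0.
Proof. by move=> H; rewrite /cutoff flat_le0 // subr_le0. Qed.

(** The bound [n] depends on the lower bound [c] for one value only, so it is
    valid on a neighbourhood. *)
Lemma cutoff_eq0_of_le a (m n : nat) (c : R) : (forall m, 0 <= a m <= 1) ->
  (m < n)%N -> 0 < c -> c < a m -> c^-1 <= n%:R -> cutoff a n = 0.
Proof.
move=> a01 mn c0 cam cn; apply: cutoff_eq0.
have [_ an1] := andP (a01 n); apply: (le_trans an1).
apply: (@le_trans _ _ (c^-1 * c)); first by rewrite mulVf ?lt0r_neq0.
apply: ler_pM; rewrite ?invr_ge0 ?(ltW c0) //.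
have -> : \sum_(l < n) a l = \sum_(l < n | true && (l != Ordinal mn)) a l + a m.
  by rewrite (bigD1 (Ordinal mn)) //= addrC.
rewrite (le_trans (ltW cam)) // lerDr sumr_ge0 // => i _.
by have [] := andP (a01 i).
Qed.

Definition admissible a : Prop :=
  (forall m, 0 <= a m <= 1) /\ exists m, 0 < a m.

Lemma cutoff_fin a : admissible a ->
  exists N, forall m, m \notin iota 0 N -> cutoff a m = 0.
Proof.
move=> [a01 [m am]]; pose c := a m / 2.
have c0 : 0 < c by rewrite divr_gt0.
have cm : c < a m by rewrite /c; lra.
exists (maxn m.+1 (Num.bound c^-1)) => n.
rewrite mem_iota /= add0n -leqNgt geq_max => /andP[mn bn].
apply: (cutoff_eq0_of_le a01 mn c0 cm).
apply: (@le_trans _ _ (Num.bound c^-1)%:R); last by rewrite ler_nat.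
by rewrite ltW // archi_boundP // invr_ge0 ltW.
Qed.

Lemma cutoff_gt0 a : admissible a -> exists m, 0 < cutoff a m.
Proof.
move=> [a01 ex].
have ex' : exists m, (fun m => 0 < a m) m by exact: ex.
exists (ex_minn ex'); case: ex_minnP => m am mmin.
rewrite /cutoff big1 ?mulr0 ?subr0 ?flat_gt0 // => l _.
apply/eqP; rewrite eq_le; have [-> _] := andP (a01 l); rewrite andbT leNgt.
by apply/negP => /mmin; rewrite leqNgt ltn_ord.
Qed.

Lemma cutoff_sum_gt0 a : admissible a -> 0 < \sum_(l \in [set: nat]) cutoff a l.
Proof.
move=> aa; have [N HN] := cutoff_fin aa; have [m cm] := cutoff_gt0 aa.
exact: (fsum_gt0 (iota_uniq 0 N) HN (cutoff_ge0 a) cm).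
Qed.

Lemma refine_eq0 a m : cutoff a m = 0 -> refine a m = 0.
Proof. by rewrite /refine => ->; rewrite mul0r. Qed.

Lemma refine_ge0 a m : admissible a -> 0 <= refine a m.
Proof. by move=> aa; rewrite divr_ge0 ?cutoff_ge0 // ltW // cutoff_sum_gt0. Qed.

Lemma refine_fin a : admissible a ->
  exists N, forall m, m \notin iota 0 N -> refine a m = 0.
Proof.
by move=> /cutoff_fin[N H]; exists N => m /H; exact: refine_eq0.
Qed.

Lemma refine_le1 a m : admissible a -> refine a m <= 1.
Proof.
move=> aa; have s0 := cutoff_sum_gt0 aa; rewrite ler_pdivrMr // mul1r.
have [N HN] := cutoff_fin aa; exact: (fsum_ge m (iota_uniq 0 N) HN (cutoff_ge0 a)).
Qed.

Lemma refine_sum a : admissible a -> \sum_(m \in [set: nat]) refine a m = 1.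
Proof.
move=> aa; have s0 := cutoff_sum_gt0 aa.
by rewrite /refine -mulr_fsuml mulfV // gt_eqF.
Qed.

Lemma refine_neq0 a m : admissible a -> refine a m != 0 -> 0 < a m.
Proof.
move=> [a01 _] /eqP H; rewrite ltNge; apply/negP => am; apply: H.
apply/refine_eq0/cutoff_eq0/(le_trans am); rewrite mulr_ge0 // sumr_ge0 // => i _.
by have [] := andP (a01 i).
Qed.

Lemma refine_gt0 a : admissible a -> exists m, 0 < refine a m.
Proof.
by move=> aa; have [m cm] := cutoff_gt0 aa; exists m; rewrite divr_gt0 // cutoff_sum_gt0.
Qed.

Context {X : diffSpace R}.
Variable A : nat -> X -> R.
Hypothesis A_sm : forall m, sm (A m).
Hypothesis A_adm : forall x, admissible (A^~ x).

Lemma sm_cutoff m : sm (fun x => cutoff (A^~ x) m).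
Proof.
apply: sm_flat; apply: smB => //; apply: smM; first exact: sm_cst.
exact: (sm_sum _ (fun l : 'I_m => A_sm l)).
Qed.

Lemma locfin_cutoff : locfin (fun m x => cutoff (A^~ x) m).
Proof.
move=> U p pp u; have [_ [m am]] := A_adm (p u); pose c := A m (p u) / 2.
have c0 : 0 < c by rewrite divr_gt0.
have cm : c < A m (p u) by rewrite /c; lra.
exists (iota 0 (maxn m.+1 (Num.bound c^-1))); first exact: iota_uniq.
apply: filterS (nb_gt (A_sm m pp) cm) => w /= cw n.
rewrite mem_iota /= add0n -leqNgt geq_max => /andP[mn bn].
have [a01 _] := A_adm (p w); apply: (cutoff_eq0_of_le a01 mn c0 cw).
apply: (@le_trans _ _ (Num.bound c^-1)%:R); last by rewrite ler_nat.
by rewrite ltW // archi_boundP // invr_ge0 ltW.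
Qed.

Lemma sm_refine m : sm (fun x => refine (A^~ x) m).
Proof.
apply: sm_div; [exact: sm_cutoff|exact: (sm_fsum sm_cutoff locfin_cutoff)|].
by move=> x; rewrite gt_eqF // cutoff_sum_gt0.
Qed.

Lemma locfin_refine : locfin (fun m x => refine (A^~ x) m).
Proof. by apply: locfin_sub locfin_cutoff => m x; exact: refine_eq0. Qed.

End Refinement.

(** * Integrals depending on a parameter *)

Section ParameterIntegral.
Context {R : realType}.

Local Notation I01 phi := (\int[@lebesgue_measure R]_(s in `[0%R, 1%R]) (phi s)).

Lemma integrable01 (phi : R -> R) :
  (forall s, s \in `[0, 1] -> {for s, continuous phi}) ->
  (@lebesgue_measure R).-integrable `[0%R, 1%R] (EFin \o phi).
Proof.
move=> cphi; apply: continuous_compact_integrable; first exact: segment_compact.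
apply: continuous_in_subspaceT => s; rewrite inE; exact: cphi.
Qed.

Lemma I01_le (phi : R -> R) (e : R) :
  (forall s, s \in `[0, 1] -> {for s, continuous phi}) ->
  (forall s, s \in `[0, 1] -> phi s <= e) -> I01 phi <= e.
Proof.
move=> cphi phie; have -> : e = I01 (fun=> e).
  by rewrite Rintegral_cst //= lebesgue_measure_itv /= lte_fin ltr01 oppr0 adde0 mulr1.
by apply: le_Rintegral => //; apply: integrable01 => // s _; exact: cst_continuous.
Qed.

Lemma I01_norm_le (phi : R -> R) (e : R) :
  (forall s, s \in `[0, 1] -> {for s, continuous phi}) ->
  (forall s, s \in `[0, 1] -> `|phi s| <= e) -> `|I01 phi| <= e.
Proof.
move=> cphi phie; apply: (@le_trans _ _ (I01 (fun s => `|phi s|))).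
  by apply: le_normr_Rintegral => //; exact: integrable01.
apply: I01_le => // s s01; apply: continuous_comp; first exact: cphi.
exact: norm_continuous.
Qed.

(** The tube lemma for the compact segment. *)
Lemma unif01 (V : normedModType R) (G : V * R -> R) (u : V) (e : R) : 0 < e ->
  (forall s, s \in `[0, 1] -> {for (u, s), continuous G}) ->
  \forall u' \near u, forall s, s \in `[0, 1] -> `|G (u', s) - G (u, s)| <= e.
Proof.
move=> e0 cG.
have /compact_near_coveringP/(_ V (nbhs u)
  (fun u' s => `|G (u', s) - G (u, s)| <= e) _) := @segment_compact R 0 1.
move=> H; suff : \forall u' \near u, `[0%R, 1%R]%classic `<=`
    (fun s => `|G (u', s) - G (u, s)| <= e).
  by apply: filterS => u' Hu' s s01; exact: Hu'.
apply: H => s s01.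
have /cvgrPdist_lt/(_ (e / 2)) := cG s s01; rewrite divr_gt0 // => /(_ isT).
move=> [[A B] /= [nA nB] AB]; exists (B, A) => //= -[s' u'] [/= Bs' Au'].
have H1 := AB (u', s') (conj Au' Bs'); have H2 := AB (u, s') (conj (nbhs_singleton nA) Bs').
rewrite /= in H1 H2.
rewrite (_ : _ - _ = (G (u, s) - G (u, s')) - (G (u, s) - G (u', s'))); last by ring.
rewrite (le_trans (ler_normB _ _)) // [e]splitr lerD // ltW //.
Qed.

Context {n : nat}.

(** Space and time form one Euclidean variable, so that a cylinder is again an
    admissible domain of plots. *)
Definition pt (u : 'rV[R]_n) (s : R) : 'rV[R]_(n + 1) := row_mx u s%:M.

Lemma ptD u v s t : pt (u + v) (s + t) = pt u s + pt v t.
Proof. by rewrite /pt add_row_mx raddfD. Qed.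

Lemma ptB u v s t : pt (u - v) (s - t) = pt u s - pt v t.
Proof. by apply: (addIr (pt v t)); rewrite -ptD !subrK. Qed.

Lemma ptZ (c : R) u s : pt (c *: u) (c * s) = c *: pt u s.
Proof. by rewrite /pt scale_row_mx scale_scalar_mx. Qed.

Lemma lsubmx_pt u s : lsubmx (pt u s) = u.
Proof. by rewrite row_mxKl. Qed.

Lemma rsubmx_pt u s : rsubmx (pt u s) 0 0 = s.
Proof. by rewrite row_mxKr mxE eqxx. Qed.

Lemma norm_pt u s : `|pt u s| <= `|u| + `|s|.
Proof.
rewrite [X in X <= _]mx_normrE; apply: bigmax_le => [|[i j] _ /=].
  by rewrite addr_ge0.
rewrite (ord1 i) -(splitK j); case: (fintype.split j) => k.
  rewrite row_mxEl (@le_trans _ _ `|u|) ?lerDl //.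
  by rewrite [X in _ <= X]mx_normrE (le_bigmax _ (fun ij => `|u ij.1 ij.2|) (0, k)).
by rewrite row_mxEr (ord1 k) mxE eqxx mulr1n lerDr.
Qed.

Lemma norm_coord (h : 'rV[R]_n) i : `|h 0 i| <= `|h|.
Proof. by rewrite [X in _ <= X]mx_normrE (le_bigmax _ (fun ij => `|h ij.1 ij.2|) (0, i)). Qed.

Lemma pt_continuous : continuous (fun us : 'rV[R]_n * R => pt us.1 us.2).
Proof.
move=> [u s]; apply/cvgrPdist_lt => e e0; have e20 : 0 < e / 2 by rewrite divr_gt0.
exists (ball u (e / 2), ball s (e / 2)).
  by split; apply: nbhsx_ballx.
move=> [u' s'] /= []; rewrite -!ball_normE /= => Hu Hs.
by rewrite -ptB (le_lt_trans (norm_pt _ _)) // [e]splitr ltrD.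
Qed.

Variable U : set 'rV[R]_n.
Hypothesis oU : open U.

Definition cyl : set 'rV[R]_(n + 1) := [set x | U (lsubmx x)].

Lemma open_cyl : open cyl.
Proof.
apply: open_comp oU => x _; exact: differentiable_continuous (differentiable_lsubmx _).
Qed.

Lemma cyl_pt u s : U u -> cyl (pt u s).
Proof. by rewrite /cyl /= lsubmx_pt. Qed.

Definition intp (f : 'rV[R]_(n + 1) -> R) (u : 'rV[R]_n) : R := I01 (fun s => f (pt u s)).

Lemma joint_continuous (f : 'rV[R]_(n + 1) -> R) u s :
  (forall x, cyl x -> {for x, continuous f}) -> U u ->
  {for (u, s), continuous (fun us => f (pt us.1 us.2))}.
Proof.
move=> cf Uu; apply: (@continuous_comp _ _ _ (fun us => pt us.1 us.2) f).
  exact: pt_continuous.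
exact/cf/cyl_pt.
Qed.

Lemma slice_continuous (f : 'rV[R]_(n + 1) -> R) u s :
  (forall x, cyl x -> {for x, continuous f}) -> U u ->
  {for s, continuous (fun s => f (pt u s))}.
Proof.
move=> cf Uu; apply: (@continuous_comp _ _ _ (fun s => (u, s)) (fun us => f (pt us.1 us.2))).
  move=> A [[B C] /= [nB nC] BC]; apply: filterS nC => t Ct.
  exact: (BC (u, t) (conj (nbhs_singleton nB) Ct)).
exact: joint_continuous.
Qed.

Lemma intp_continuous f u : (forall x, cyl x -> {for x, continuous f}) -> U u ->
  {for u, continuous (intp f)}.
Proof.
move=> cf Uu; rewrite /prop_for /continuous_at.
apply/(@cvgrPdist_le _ _ _ (nbhs u) (nbhs_filter u)) => e e0; near=> u'.
have Uu' : U u' by near: u'; exact: open_nbhs_nbhs.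
have H : forall s, s \in `[0, 1] -> `|f (pt u' s) - f (pt u s)| <= e.
  near: u'; apply: (@unif01 _ (fun us => f (pt us.1 us.2)) u e e0) => s _.
  exact: joint_continuous.
rewrite /intp -RintegralB //; last 2 first.
- by apply: integrable01 => s _; exact: slice_continuous.
- by apply: integrable01 => s _; exact: slice_continuous.
apply: I01_norm_le => [s s01|s s01]; last by rewrite distrC H.
by apply: continuousB; exact: slice_continuous.
Unshelve. all: by end_near. Qed.

End ParameterIntegral.

(** * Differentiation under the integral sign *)

Section DiffUnderIntegral.
Context {R : realType}.

Lemma diff_of_remainder (V W : normedModType R) (f : V -> W) (x : V)
    (L : {linear V -> W}) : continuous L ->
  (forall e, 0 < e -> \forall h \near 0, `|f (h + x) - (f x + L h)| <= e * `|h|) ->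
  differentiable f x /\ 'd f x = L :> (V -> W).
Proof.
move=> cL H; have E : f \o shift x = cst (f x) + L +o_ 0 id.
  by apply/eqaddoP => e e0; exact: H.
have dE := diff_unique cL E.
by split=> //; apply/diff_locallyP; rewrite dE; split.
Qed.

Lemma is_derive_line (V : normedModType R) (f : V -> R) (x v : V) (t : R) :
  differentiable f (x + t *: v) ->
  is_derive t 1 (fun t => f (x + t *: v)) ('D_v f (x + t *: v)).
Proof.
move=> df.
have did : differentiable (id : R -> R) t by have [] := @is_diff_id R R t.
have dZ : differentiable (fun t : R => t *: v) t by exact: (differentiableZl _ did).
have dl : differentiable (fun t : R => x + t *: v) t.
  by apply: differentiableD => //; exact: differentiable_cst.
have dc : differentiable (f \o (fun t : R => x + t *: v)) t by exact: differentiable_comp.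
apply: DeriveDef; first exact: diff_derivable.
rewrite deriveE // (diff_comp dl df) /= (deriveE _ df); congr ('d f _ _).
rewrite (diffD (differentiable_cst _ _) dZ) diff_cst (diffZl _ did).
have := @diff_val _ _ _ _ _ _ _ (@is_diff_id R R t) => ->.
by rewrite /= -[LHS]/(0 + _) add0r scale1r.
Qed.

Context {n : nat}.
Variable U : set 'rV[R]_n.
Hypothesis oU : open U.

Lemma derive_pt (f : 'rV[R]_(n + 1) -> R) x (h : 'rV[R]_n) : differentiable f x ->
  'D_(pt h 0) f x = \sum_(i < n) h 0 i * 'D_(pt 'e_i 0) f x.
Proof.
move=> df; rewrite (deriveE _ df).
have -> : pt h 0 = \sum_(i < n) h 0 i *: pt 'e_i 0.
  rewrite {1}[h]row_sum_delta; elim/big_rec2: _ => [|i y z _ <-].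
    by rewrite /pt raddf0 row_mx0.
  by rewrite -ptZ mulr0 -ptD addr0.
by rewrite linear_sum; apply: eq_bigr => i _; rewrite linearZ /= deriveE.
Qed.

Variable f : 'rV[R]_(n + 1) -> R.
Hypothesis df : forall x, cyl U x -> differentiable f x.
Hypothesis cdf : forall v x, cyl U x -> {for x, continuous ('D_v f)}.

Let cf x : cyl U x -> {for x, continuous f}.
Proof. by move=> /df; exact: differentiable_continuous. Qed.

(** By the mean value theorem on the segment from [u] to [u + h], the remainder
    is a variation of partial derivatives, and is therefore controlled
    uniformly in [s]. *)
Lemma pt_remainder (u : 'rV[R]_n) (r e : R) (h : 'rV[R]_n) (s : R) :
  (forall h', `|h'| < r -> U (u + h')) ->
  (forall h' i, `|h'| < r ->
     `|'D_(pt 'e_i 0) f (pt (u + h') s) - 'D_(pt 'e_i 0) f (pt u s)| <= e) ->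
  `|h| < r ->
  `|f (pt (u + h) s) - f (pt u s) - \sum_(i < n) h 0 i * 'D_(pt 'e_i 0) f (pt u s)|
    <= (n%:R * e) * `|h|.
Proof.
move=> HU He hr.
have small (t : R) : t \in `[0, 1] -> `|t *: h| < r.
  rewrite in_itv /= => /andP[t0 t1]; rewrite normrZ ger0_norm //.
  by rewrite (le_lt_trans _ hr) // ler_piMl.
have ptl (t : R) : pt u s + t *: pt h 0 = pt (u + t *: h) s.
  by rewrite -ptZ mulr0 -ptD addr0.
have dl (t : R) : t \in `[0, 1] -> is_derive t 1 (fun t => f (pt u s + t *: pt h 0))
    ('D_(pt h 0) f (pt u s + t *: pt h 0)).
  by move=> t01; apply: is_derive_line; apply: df; rewrite ptl; exact: (cyl_pt s (HU _ (small _ t01))).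
have dlo (t : R) : t \in `]0, 1[ -> is_derive t 1 (fun t => f (pt u s + t *: pt h 0))
    ('D_(pt h 0) f (pt u s + t *: pt h 0)).
  by move=> t01; apply: dl; exact: subset_itv_oo_cc t01.
have cl : {within `[0, 1], continuous (fun t : R => f (pt u s + t *: pt h 0))}.
  apply: continuous_in_subspaceT => t; rewrite inE => /dl[dt _].
  exact/differentiable_continuous/derivable1_diffP.
have [t t01] := MVT_segment ler01 dlo cl.
rewrite scale0r addr0 scale1r -ptD addr0 subr0 mulr1 => ->.
rewrite ptl derive_pt; last by apply: df; exact: (cyl_pt s (HU _ (small _ t01))).
rewrite -sumrB (le_trans (ler_norm_sum _ _ _)) //.
apply: (@le_trans _ _ (\sum_(i < n) `|h| * e)).
  apply: ler_sum => i _; rewrite -mulrBr normrM ler_pM // ?norm_coord //.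
  exact/He/small.
by rewrite sumr_const card_ord -[leLHS]mulr_natl [`|h| * e]mulrC mulrA.
Qed.

Lemma slice_df v (u : 'rV[R]_n) s : U u ->
  {for s, continuous (fun s => 'D_v f (pt u s))}.
Proof. by apply: (@slice_continuous _ _ U ('D_v f)); exact: cdf. Qed.

Let c (u : 'rV[R]_n) (i : 'I_n) : R := intp ('D_(pt 'e_i 0) f) u.

Lemma intp_lin (u h : 'rV[R]_n) : U u ->
  \sum_(i < n) h 0 i * c u i = intp (fun x => \sum_(i < n) h 0 i * 'D_(pt 'e_i 0) f x) u.
Proof.
move=> Uu; rewrite /c /intp.
have sl v s : {for s, continuous (fun s => 'D_v f (pt u s))} by exact: slice_df.
have slc a v s : {for s, continuous (fun s => a * 'D_v f (pt u s))}.
  by apply: continuousM; [exact: cst_continuous|exact: sl].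
elim: (index_enum _) => [|i l IH].
  rewrite big_nil; under eq_Rintegral do rewrite big_nil.
  by rewrite Rintegral_cst ?mul0r.
rewrite big_cons IH; under [RHS]eq_Rintegral do rewrite big_cons.
rewrite RintegralD //; first by rewrite RintegralZl //; exact: integrable01.
  exact: integrable01.
apply: integrable01 => s _.
elim: (l) => [|j l' IHl].
  rewrite (_ : (fun s => _) = fun=> 0); first exact: cst_continuous.
  by apply/funext => t; rewrite big_nil.
rewrite (_ : (fun s => _) = (fun s => h 0 j * 'D_(pt 'e_j 0) f (pt u s)) \+
  (fun s => \sum_(k <- l') h 0 k * 'D_(pt 'e_k 0) f (pt u s))).
  by apply: continuousD.
by apply/funext => t; rewrite big_cons.
Qed.

(** The candidate differential is the integral of the partial differential;
    [unif01] makes the remainder small uniformly in [s], hence after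
    integration. *)
Lemma intp_diff u : U u -> differentiable (intp f) u /\
  forall v, 'D_v (intp f) u = intp ('D_(pt v 0) f) u.
Proof.
move=> Uu; pose L (h : 'rV[R]_n) : R := \sum_(i < n) h 0 i * c u i.
have linL : linear L.
  move=> a h k; rewrite /L scaler_sumr -big_split.
  by apply: eq_bigr => i _; rewrite !mxE mulrDl -mulrA.
pose Ll : {linear 'rV[R]_n -> R} := HB.pack L (GRing.isLinear.Build _ _ _ _ _ linL).
have cL : continuous Ll.
  move=> h; rewrite (_ : (Ll : _ -> _) = fun h => \sum_(i < n) h 0 i * c u i) //.
  elim: (index_enum _) => [|i l IH].
    rewrite (_ : (fun h => _) = fun=> 0); first exact: cst_continuous.
    by apply/funext => t; rewrite big_nil.
  rewrite (_ : (fun h => _) = (fun h : 'rV[R]_n => h 0 i * c u i) \+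
    (fun h => \sum_(k <- l) h 0 k * c u k)).
    apply: continuousD; last exact: IH.
    apply: continuousM; [exact: coord_continuous|exact: cst_continuous].
  by apply/funext => t; rewrite big_cons.
have [e e0|dg dE] := @diff_of_remainder _ _ (intp f) u Ll cL.
  (* The remainder estimate loses a factor [n], the number of partial
     derivatives. *)
  pose e' := e / n.+1%:R.
  have e'0 : 0 < e' by rewrite divr_gt0.
  have N1 : \forall u' \near u, U u' by exact: open_nbhs_nbhs.
  have N2 : \forall u' \near u, forall i s, s \in `[0, 1] ->
      `|'D_(pt 'e_i 0) f (pt u' s) - 'D_(pt 'e_i 0) f (pt u s)| <= e'.
    apply: (@filter_forall _ 'I_n (fun i u' => forall s, s \in `[0, 1] ->
      `|'D_(pt 'e_i 0) f (pt u' s) - 'D_(pt 'e_i 0) f (pt u s)| <= e') (nbhs u)) => i.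
    apply: (@unif01 _ _ (fun us => 'D_(pt 'e_i 0) f (pt us.1 us.2)) u e' e'0) => s _.
    by apply: (@joint_continuous _ _ U ('D_(pt 'e_i 0) f)) => //; exact: cdf.
  have [r /= r0 Hr] := (nbhs_ballP _ _).1 (filterI N1 N2).
  have Hr' h' : `|h'| < r -> U (u + h') /\ forall i s, s \in `[0, 1] ->
      `|'D_(pt 'e_i 0) f (pt (u + h') s) - 'D_(pt 'e_i 0) f (pt u s)| <= e'.
    by move=> h'r; apply: Hr; rewrite -ball_normE /= opprD addNKr normrN.
  near=> h.
  have hr : `|h| < r.
    near: h; apply/nbhs_ballP; exists r => //= h; by rewrite -ball_normE /= sub0r normrN.
  have Uh := (Hr' h hr).1.
  have slf s w : U w -> {for s, continuous (fun s => f (pt w s))}.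
    by move=> Uw; exact: (slice_continuous cf Uw).
  rewrite -[X in `|X| <= _]/(intp f (h + u) - (intp f u + L h)) opprD addrA.
  rewrite /L intp_lin // [h + u]addrC /intp.
  have cS s : {for s, continuous
      (fun s => \sum_(i < n) h 0 i * 'D_(pt 'e_i 0) f (pt u s))}.
    elim: (index_enum _) => [|i l IH].
      rewrite (_ : (fun h => _) = fun=> 0); first exact: cst_continuous.
      by apply/funext => t; rewrite big_nil.
    rewrite (_ : (fun s => _) = (fun s => h 0 i * 'D_(pt 'e_i 0) f (pt u s)) \+
      (fun s => \sum_(k <- l) h 0 k * 'D_(pt 'e_k 0) f (pt u s))).
      apply: continuousD; last exact: IH.
      by apply: continuousM; [exact: cst_continuous|exact: slice_df].
    by apply/funext => t; rewrite big_cons.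
  rewrite -RintegralB //; [|by apply: integrable01 => s _; exact: slf..].
  rewrite -RintegralB //; last 2 first.
  - by apply: integrable01 => s _; apply: continuousB; exact: slf.
  - by apply: integrable01 => s _; exact: cS.
  apply: I01_norm_le => [s _|s s01].
    by apply: continuousB; [apply: continuousB; exact: slf|exact: cS].
  apply: le_trans (pt_remainder (r := r) (e := e') _ _ hr) _.
  - by move=> h' /Hr'[].
  - by move=> h' i /Hr'[_]; apply.
  rewrite ler_wpM2r // /e' mulrCA -[leRHS]mulr1 ler_wpM2l ?ltW //.
  by rewrite ltr_pdivrMr // mul1r ltr_nat.
split=> // v; rewrite (deriveE _ dg) dE -[LHS]/(L v) /L intp_lin //.
apply: eq_Rintegral => s _; by rewrite (derive_pt _ (df (cyl_pt s Uu))).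
Unshelve. all: by end_near. Qed.

End DiffUnderIntegral.

(** The directional derivatives of the integral are integrals of directional
    derivatives, so that the induction on [k] applies to them. *)
Lemma Ck_intp {R : realType} (n k : nat) (U : set 'rV[R]_n)
    (f : 'rV[R]_(n + 1) -> R) : open U ->
  smooth_on (cyl U) f -> Ck k U (intp f).
Proof.
move=> oU; elim: k f => [|k IH] f fs.
  by move=> u Uu; apply: (intp_continuous oU _ Uu); exact: (fs 0%N).
have [df _] := fs 1%N.
have Ds v : smooth_on (cyl U) ('D_v f) by move=> l; have [_] := fs l.+1; exact.
have H u (Uu : U u) := intp_diff oU df (fun v => Ds v 0%N) Uu.
split=> [u /H[]//|v]; apply: (Ck_eq oU) (IH _ (Ds (pt v 0))) => u.
by rewrite inE => /H[_ ->].
Qed.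

(** * Smooth majorants uniform in time *)

Section Majorant.
Context {R : realType}.

Lemma Ck_lsubmx k n (U : set 'rV[R]_(n + 1)) : open U ->
  Ck k U (fun x : 'rV[R]_(n + 1) => lsubmx x : 'rV[R]_n).
Proof.
move=> oU; apply: (@Ck_eq _ _ _ _ _
  (fun x : 'rV[R]_(n + 1) => \sum_(j < n) x 0 (lshift 1 j) *: 'e_j)) => //.
  by move=> x _; rewrite [RHS]row_sum_delta; apply: eq_bigr => j _; rewrite mxE.
apply: Ck_sum => // j; apply: (CkZ oU); last exact: Ck_cst.
exact: (Ck_coord (lshift 1 j) oU (Ck_id k U)).
Qed.

Lemma Ck_pt k n (U : set 'rV[R]_n) (g : 'rV[R]_n -> R) : open U -> Ck k U g ->
  Ck k U (fun x => pt x (g x)).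
Proof.
move=> oU Cg; apply: (@Ck_eq _ _ _ _ _
  (fun x : 'rV[R]_n => \sum_(j < n) x 0 j *: pt 'e_j 0 + g x *: pt 0 1)) => //.
  move=> x _; rewrite -ptZ scaler0 mulr1.
  have -> : \sum_(j < n) x 0 j *: pt 'e_j 0 = pt x 0.
    rewrite [in RHS](row_sum_delta x); elim/big_rec2: _ => [|i y z _ ->].
      by rewrite /pt raddf0 row_mx0.
    by rewrite -ptZ mulr0 -ptD addr0.
  by rewrite -ptD addr0 add0r.
apply: (CkD oU).
  apply: Ck_sum => // j; apply: (CkZ oU); last exact: Ck_cst.
  exact: (Ck_coord j oU (Ck_id k U)).
by apply: (CkZ oU Cg); exact: Ck_cst.
Qed.

Lemma pt_line n (u : 'rV[R]_n) (s : R) : pt u s = pt u 0 + s *: pt 0 1.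
Proof. by rewrite -ptZ scaler0 mulr1 -ptD addr0 add0r. Qed.

Lemma is_derive_pt n (f : 'rV[R]_(n + 1) -> R) u s : differentiable f (pt u s) ->
  is_derive s 1 (fun s => f (pt u s)) ('D_(pt 0 1) f (pt u s)).
Proof.
rewrite pt_line => df; under eq_fun do rewrite pt_line; exact: is_derive_line.
Qed.

Context {X : diffSpace R}.
Local Notation XR := (prodSpace X (realSpace R)).

(** Smoothness of [F] on the product, tested on the plot of [X * R] defined by
    the cylinder over [p]. *)
Lemma cylinder_rep (F : XR -> R) (U : edom R) (p : U -> X) : sm F -> plot p ->
  exists2 f : 'rV[R]_(edim U + 1) -> R, smooth_on (cyl U) f &
    forall u s, f (pt (\val u) s) = F (p u, s).
Proof.
move=> Fs pp; pose C := Edom (open_cyl (@eopen R U)).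
have CU (x : C) : @eset R U (lsubmx (\val x)) by exact: (set_valP x).
pose l (x : C) : U := SigSub (mem_set (CU x)).
have ls : edom_smooth l.
  exists (fun x : 'rV[R]_(edim U + 1) => lsubmx x) => // k.
    exact: (Ck_lsubmx k (@eopen R C)).
have rs : @plot R (realSpace R) C (fun x => \val x 0 (rshift (edim U) 0)).
  exists (fun x : 'rV[R]_(edim U + 1) => x 0 (rshift (edim U) 0)) => // k.
  exact: (Ck_coord _ (@eopen R C) (Ck_id k _)).
have qp : @plot R XR C (fun x => (p (l x), \val x 0 (rshift (edim U) 0))).
  by split => //; exact: (plots_comp pp ls).
have [f fs fE] := Fs C _ qp; exists f => // u s.
have cu : cyl U (pt (\val u) s) by apply: cyl_pt; exact: set_valP.
have := fE (SigSub (mem_set cu) : C) => /= ->; congr (F (_, _)).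
  by congr p; apply: val_inj; rewrite /= lsubmx_pt.
by rewrite -[RHS](rsubmx_pt (\val u) s) [RHS]mxE.
Qed.

Definition dtime (F : XR -> R) (z : XR) : R := 'D_1 (fun t : R => F (z.1, t)) z.2.

Lemma dtimeE (F : XR -> R) (U : edom R) (p : U -> X)
    (f : 'rV[R]_(edim U + 1) -> R) (u : U) (s : R) :
  smooth_on (cyl U) f -> (forall (u : U) (s : R), f (pt (\val u) s) = F (p u, s)) ->
  is_derive s 1 (fun t : R => F (p u, t)) ('D_(pt 0 1) f (pt (\val u) s)).
Proof.
move=> fs fE; under eq_fun do rewrite -fE; apply: is_derive_pt.
by have [df _] := fs 1%N; exact: (df _ (cyl_pt s (set_valP u))).
Qed.

Lemma sm_dtime (F : XR -> R) : sm F -> sm (dtime F).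
Proof.
move=> Fs U P [p1 [g gs gE]]; have [f fs fE] := cylinder_rep Fs p1.
exists (fun x => 'D_(pt 0 1) f (pt x (g x))) => [k|u].
  have Cg : Ck k U (fun x => pt x (g x)) by exact: (Ck_pt (@eopen R U) (gs k)).
  have Df : Ck k (cyl U) ('D_(pt 0 1) f) by have [_] := fs k.+1; exact.
  apply: (Ck_comp (@eopen R U) _ Cg Df) => x; exact: cyl_pt.
rewrite gE /= /dtime /=.
by have [_ <-] := dtimeE u (P u).2 fs fE.
Qed.

Lemma is_derive_dtime (F : XR -> R) (x : X) (s : R) : sm F ->
  is_derive s 1 (fun t : R => F (x, t)) (dtime F (x, s)).
Proof.
move=> Fs; pose U := @Edom R 0 setT openT.
have pp : @plot R X U (fun=> x) by exact: plots_cst.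
have [f fs fE] := cylinder_rep Fs pp.
have := dtimeE (SigSub (mem_set (Logic.I : [set: 'rV[R]_0] 0)) : U) s fs fE.
by rewrite /= /dtime /= => D; have [_ ->] := D; case: D => D <-.
Qed.

Lemma continuous_time (F : XR -> R) x (s : R) : sm F ->
  {for s, continuous (fun t : R => F (x, t))}.
Proof.
move=> Fs; have [D _] := is_derive_dtime x s Fs.
exact/differentiable_continuous/derivable1_diffP.
Qed.

Local Notation I01 phi := (\int[@lebesgue_measure R]_(s in `[0%R, 1%R]) (phi s)).

Lemma sm_I01 (F : XR -> R) : sm F -> sm (fun x => I01 (fun s => F (x, s))).
Proof.
move=> Fs U p pp; have [f fs fE] := cylinder_rep Fs pp.
exists (intp f) => [k|u]; first exact: Ck_intp (@eopen R U) fs.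
by apply: eq_Rintegral => s _; rewrite fE.
Qed.

(** The fundamental theorem of calculus on the segment from [a] to [b],
    followed by enlarging the domain of the integral to the unit interval: the
    bound depends on neither [a] nor [b]. *)
Lemma variation01 (phi dphi psi : R -> R) :
  (forall s : R, is_derive s 1 phi (dphi s)) ->
  (forall s : R, {for s, continuous dphi}) -> (forall s : R, {for s, continuous psi}) ->
  (forall s : R, `|dphi s| <= psi s) ->
  forall a b, 0 <= a -> a < b -> b <= 1 -> `|phi b - phi a| <= I01 psi.
Proof.
move=> D cd cp le a b a0 ab b1.
have cphi s : {for s, continuous phi}.
  by have [d _] := D s; exact/differentiable_continuous/derivable1_diffP.
have iab (g : R -> R) : (forall s, {for s, continuous g}) ->
    (@lebesgue_measure R).-integrable `[a, b] (EFin \o g).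
  move=> cg; apply: continuous_compact_integrable; first exact: segment_compact.
  by apply: continuous_in_subspaceT => s _; exact: cg.
have -> : phi b - phi a = \int[@lebesgue_measure R]_(s in `[a, b]) dphi s.
  rewrite /Rintegral (@continuous_FTC2 _ dphi phi a b ab) //.
  - by apply: continuous_in_subspaceT => s _; exact: cd.
  - split.
    + by move=> s _; have [] := D s.
    + exact/cvg_at_right_filter/cphi.
    + exact/cvg_at_left_filter/cphi.
  - by move=> s _; rewrite derive1E; have [_ ->] := D s.
apply: (@le_trans _ _ (\int[@lebesgue_measure R]_(s in `[a, b]) psi s)).
  apply: le_trans (le_normr_Rintegral _ (iab _ cd)) _ => //.
  apply: le_Rintegral => //; last exact: iab.
  apply: iab => s; apply: continuous_comp; first exact: cd.
  exact: norm_continuous.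
have i01 := integrable01 (fun s _ => cp s).
rewrite /Rintegral fine_le //.
- apply: integrable_fin_num => //; exact: iab.
- exact: integrable_fin_num.
apply: ge0_subset_integral => //.
- exact: (measurable_int _ i01).
- by move=> s _; rewrite lee_fin (le_trans _ (le s)).
- by apply: subset_itv; rewrite bnd_simp.
Qed.

Let norm_sub_le (p q r : R) : `|q - p| <= r -> p - r <= q.
Proof. rewrite ler_norml => /andP[+ _]; lra. Qed.

Let norm_le_sqr (a : R) : `|a| <= 1 + a ^+ 2.
Proof.
rewrite -(real_normK (num_real a)); have := sqr_ge0 (`|a| - 1); have := sqr_ge0 (`|a|).
by rewrite !expr2; lra.
Qed.

(** The square of [F] at time [s] exceeds its mean over the unit interval by at
    most its variation, and the derivative [2 * F * F'] is at most [F ^ 2 + F'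
    ^ 2]; both integrals depend smoothly on [x], whereas the supremum over [s]
    does not. *)
Lemma majorant (F : XR -> R) : sm F ->
  exists2 M : X -> R, sm M & forall x s, s \in `[0, 1] -> `|F (x, s)| <= M x.
Proof.
move=> Fs; have Ds := sm_dtime Fs.
have FF : sm (fun z : XR => F z * F z) by exact: smM.
have DD : sm (fun z : XR => dtime F z * dtime F z) by exact: smM.
have SS : sm (fun z : XR => F z * F z + dtime F z * dtime F z) by exact: smD.
exists (fun x => 1 + (I01 (fun s => F (x, s) * F (x, s)) +
    I01 (fun s => F (x, s) * F (x, s) + dtime F (x, s) * dtime F (x, s)))).
  by apply: smD; [exact: sm_cst|apply: smD; [exact: (sm_I01 FF)|exact: (sm_I01 SS)]].
move=> x s s01; pose phi (t : R) : R := F (x, t) * F (x, t).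
pose psi (t : R) : R := F (x, t) * F (x, t) + dtime F (x, t) * dtime F (x, t).
pose dphi (t : R) : R := 2 * (F (x, t) * dtime F (x, t)).
have Dphi (t : R) : is_derive t 1 phi (dphi t).
  have D := is_derive_dtime x t Fs; apply: is_derive_eq (is_deriveM D D) _.
  rewrite /dphi; move: (F (x, t) : R) (dtime F (x, t)) => c d.
  by rewrite -[c *: d]/(c * d); ring.
have cphi (t : R) : {for t, continuous phi} by have := @continuous_time (fun z => F z * F z) x t FF.
have cdphi (t : R) : {for t, continuous dphi}.
  have E : sm (fun z : XR => 2 * (F z * dtime F z)).
    by apply: smM; [exact: sm_cst|exact: smM].
  by have := @continuous_time (fun z => 2 * (F z * dtime F z)) x t E.
have cpsi (t : R) : {for t, continuous psi}.
  by have := @continuous_time (fun z => F z * F z + dtime F z * dtime F z) x t SS.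
have dpsi t : `|dphi t| <= psi t.
  rewrite /dphi /psi ler_norml; apply/andP; split.
    have := sqr_ge0 (F (x, t) + dtime F (x, t)); rewrite expr2; lra.
  have := sqr_ge0 (F (x, t) - dtime F (x, t)); rewrite expr2; lra.
have V := variation01 Dphi cdphi cpsi dpsi.
have key : phi s <= I01 phi + I01 psi.
  have psi0 : 0 <= I01 psi.
    by apply: Rintegral_ge0 => t _; rewrite (le_trans _ (dpsi t)).
  have step t : t \in `[0, 1] -> phi s - I01 psi <= phi t.
    move: s01; rewrite !in_itv /= => /andP[s0 s1] /andP[t0 t1].
    have [st|ts|->] := ltgtP s t; last by rewrite lerBlDr lerDl.
      exact/norm_sub_le/(V s t s0 st t1).
    by apply: norm_sub_le; rewrite distrC; exact: (V t s t0 ts s1).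
  rewrite -lerBlDr; set c := phi s - _.
  have -> : c = I01 (fun=> c).
    by rewrite Rintegral_cst //= lebesgue_measure_itv /= lte_fin ltr01 oppr0 adde0 mulr1.
  apply: le_Rintegral => //.
  - by apply: integrable01 => t _; exact: cst_continuous.
  - by apply: integrable01 => t _; exact: cphi.
apply: (@le_trans _ _ (1 + phi s)); last by rewrite lerD2l.
rewrite /phi -expr2; exact: norm_le_sqr.
Qed.

End Majorant.

(** * Coordinates on [EG] and [BG] *)

Section GroupPlots.
Context {R : realType} (G : diffGroup R).

Lemma plot_mulg (U : edom R) (a b : U -> G) :
  plot a -> plot b -> plot (fun u => (a u * b u)%g : G).
Proof. by move=> pa pb; exact: (@dgroup_mul R G U (fun u => (a u, b u)) (conj pa pb)). Qed.

Lemma plot_invg (U : edom R) (a : U -> G) : plot a -> plot (fun u => (a u)^-1%g : G).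
Proof. by move=> pa; exact: (@dgroup_inv R G U a pa). Qed.

End GroupPlots.

Section Weights.
Context {R : realType}.
Implicit Types t : nat -> R.

Definition weights t : Prop :=
  [/\ forall i, 0 <= t i <= 1, finite_set [set i | t i <> 0] &
      \sum_(i \in [set: nat]) t i = 1].

Lemma weights_of_tail t N : (forall i, 0 <= t i <= 1) ->
  (forall i, i \notin iota 0 N -> t i = 0) -> \sum_(i \in [set: nat]) t i = 1 ->
  weights t.
Proof.
move=> t01 tN t1; split=> //; apply: (@sub_finite_set _ _ [set` iota 0 N]).
  by move=> i /= ti; apply: contrapT => /negP/tN.
exact: finite_seq.
Qed.

Lemma weights_tail t : weights t -> exists N, forall i, i \notin iota 0 N -> t i = 0.
Proof.
move=> [_ + _]; move=> /finite_seqP[r rE].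
exists (\max_(i <- r) i).+1 => i; rewrite mem_iota /= add0n -leqNgt => ir.
apply: contrapT => ti; have : i \in r by move: ti; rewrite -[_ <> _]/([set i | t i <> 0] i) rE.
by move=> i_r; have := @leq_bigmax_seq _ r xpredT id i i_r isT; rewrite /= leqNgt ir.
Qed.

Lemma weights_neq0 t : weights t -> exists i, t i <> 0.
Proof.
move=> [_ _ t1]; apply: contrapT => /forallNP H.
suff : \sum_(i \in [set: nat]) t i = 0 by rewrite t1; exact/eqP/oner_neq0.
by apply: fsbig1 => i _; apply: contrapT => /H.
Qed.

Lemma weights_adm t : weights t -> admissible t.
Proof.
move=> H; have [t01 _ t1] := H; split=> //; have [i ti] := weights_neq0 H.
by exists i; rewrite lt0r; move/eqP: ti => ->; have [] := andP (t01 i).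
Qed.

Lemma weights_refine t : admissible t -> weights (refine t).
Proof.
move=> ta; have [N HN] := refine_fin ta; apply: (weights_of_tail (N := N)) => //.
  by move=> i; rewrite refine_ge0 ?refine_le1.
exact: refine_sum.
Qed.

Lemma weights_mix (l : R) t t' : 0 <= l <= 1 -> weights t -> weights t' ->
  weights (fun i => (1 - l) * t i + l * t' i).
Proof.
move=> /andP[l0 l1] H H'; have [N HN] := weights_tail H; have [N' HN'] := weights_tail H'.
have [t01 _ t1] := H; have [t'01 _ t'1] := H'; pose M := maxn N N'.
have iN i : i \notin iota 0 M -> t i = 0 /\ t' i = 0.
  rewrite mem_iota /= add0n -leqNgt geq_max => /andP[Ni N'i]; split.
    by apply: HN; rewrite mem_iota /= add0n -leqNgt.
  by apply: HN'; rewrite mem_iota /= add0n -leqNgt.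
have l10 : 0 <= 1 - l by rewrite subr_ge0.
apply: (weights_of_tail (N := M)) => [i|i /iN[-> ->]|].
- have /andP[a0 a1] := t01 i; have /andP[b0 b1] := t'01 i.
  rewrite addr_ge0 ?mulr_ge0 //=.
  by rewrite -[leRHS](subrK l) lerD // ler_piMr.
- by rewrite !mulr0 addr0.
- rewrite (fsumE (iota_uniq 0 M)); last by move=> i /iN[-> ->]; rewrite !mulr0 addr0.
  have S : \sum_(i <- iota 0 M) t i = 1.
    by rewrite -(fsumE (iota_uniq 0 M)) // => i /iN[].
  have S' : \sum_(i <- iota 0 M) t' i = 1.
    by rewrite -(fsumE (iota_uniq 0 M)) // => i /iN[].
  by rewrite big_split /= -!mulr_sumr S S' !mulr1 subrK.
Qed.

End Weights.

Section Classifying.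
Context {R : realType} {G : diffGroup R}.
Implicit Types (t : nat -> R) (g : nat -> G) (U W : edom R).

Lemma weights_unit t : weights t -> forall i, `[0%R, 1%R]%classic (t i).
Proof. by move=> [t01 _ _] i; rewrite /= in_itv /=. Qed.

Definition unit_weights t (H : weights t) (i : nat) : unitSpace :=
  SigSub (mem_set (weights_unit H i)).

Lemma join_weights t g (H : weights t) : @join_set R G (unit_weights H, g).
Proof. by case: (H). Qed.

Definition mkS t g (H : weights t) : subSpace (@join_set R G) :=
  SigSub (mem_set (join_weights g H)).

(** Packages weights and group components into a point of [EG]; the smooth
    structure and the equality of [EG] are expressed through [mk] alone. *)
Definition mk t g (H : weights t) : EG G := qclass (@join_rel R G) (mkS g H).

Lemma weights_val (s : subSpace (@join_set R G)) :
  weights (fun i => \val ((\val s).1 i)).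
Proof.
have [f s1] := set_valP s; split=> // i.
by have := set_valP ((\val s).1 i); rewrite /= in_itv /=.
Qed.

Lemma mkS_eta (s : subSpace (@join_set R G)) :
  mkS (\val s).2 (weights_val s) = s.
Proof.
apply: val_inj; rewrite /= [RHS]surjective_pairing; congr pair.
by apply/funext => i; apply: val_inj.
Qed.

Lemma mk_eqP t g (H : weights t) t' g' (H' : weights t') :
  mk g H = mk g' H' <->
  (forall i, t i = t' i) /\ (forall i, t i <> 0 -> g i = g' i).
Proof.
split=> [/qclassP|[tt gg]]; last first.
  apply/qclassP/rst_step => i; split; last exact: gg.
  by apply: val_inj; exact: tt.
pose Q (s s' : subSpace (@join_set R G)) :=
  (forall i, \val ((\val s).1 i) = \val ((\val s').1 i)) /\
  (forall i, \val ((\val s).1 i) <> 0 -> (\val s).2 i = (\val s').2 i).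
suff E s s' : clos_refl_sym_trans _ (@join_rel R G) s s' -> Q s s'.
  by move=> /E[/= tt gg]; split.
elim=> {s s'} [s s' H0|s|s s' _ [H1 H2]|s s' s'' _ [H1 H2] _ [H3 H4]]; split=> // i.
- by have [->] := H0 i.
- by have [_] := H0 i.
- by rewrite -H1 => /H2 ->.
- by rewrite H1.
- by move=> si; rewrite H2 // H4 // -H1.
Qed.

(** The weights are well defined on [EG]; the components [gE] depend on the
    chosen representative, but not where the weight is nonzero ([gE_mk]). *)
Definition tE (e : EG G) : nat -> R := fun i => \val ((\val (qrepr e)).1 i).
Definition gE (e : EG G) : nat -> G := (\val (qrepr e)).2.

Lemma weights_tE e : weights (tE e).
Proof. exact: weights_val. Qed.

Lemma qclass_qrepr T (E : T -> T -> Prop) (q : quot E) : qclass E (qrepr q) = q.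
Proof. exact: projT2 (cid (qclass_surj q)). Qed.

Lemma mk_eta e : mk (gE e) (weights_tE e) = e.
Proof.
rewrite -[RHS]qclass_qrepr; congr qclass; rewrite -[RHS]mkS_eta; apply: val_inj.
by congr pair; apply/funext => i; exact: val_inj.
Qed.

Lemma tE_mk t g (H : weights t) : tE (mk g H) = t.
Proof. by have /mk_eqP[E _] := mk_eta (mk g H); exact/funext. Qed.

Lemma gE_mk t g (H : weights t) i : t i <> 0 -> gE (mk g H) i = g i.
Proof. by have /mk_eqP[_ E] := mk_eta (mk g H); move=> ti; apply: E; rewrite tE_mk. Qed.

Lemma tE_neq0 e : exists i, tE e i <> 0.
Proof. exact: weights_neq0 (weights_tE e). Qed.

Lemma EG_ext e e' : (forall i, tE e i = tE e' i) ->
  (forall i, tE e i <> 0 -> gE e i = gE e' i) -> e = e'.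
Proof. by move=> Ht Hg; rewrite -(mk_eta e) -(mk_eta e'); exact/mk_eqP. Qed.

Lemma EG_act_mk t g (H : weights t) a :
  EG_act (mk g H) a = mk (fun i => (g i * a)%g) H.
Proof.
rewrite /EG_act qmapE; congr qclass; apply: val_inj => /=; congr pair.
Qed.

Implicit Types e : EG G.

Lemma tE_act e a : tE (EG_act e a) = tE e.
Proof. by rewrite -[in LHS](mk_eta e) EG_act_mk tE_mk. Qed.

Lemma gE_act e a i : tE e i <> 0 -> gE (EG_act e a) i = (gE e i * a)%g.
Proof. by move=> ti; rewrite -[in LHS](mk_eta e) EG_act_mk gE_mk. Qed.

Lemma EG_act1 e : EG_act e 1%g = e.
Proof. by apply: EG_ext => i; rewrite tE_act // => ti; rewrite gE_act // mulg1. Qed.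

Lemma EG_actM e a b : EG_act (EG_act e a) b = EG_act e (a * b)%g.
Proof.
apply: EG_ext => i; rewrite !tE_act // => ti.
by rewrite !gE_act ?tE_act // mulgA.
Qed.

Lemma EG_act_inj e a b : EG_act e a = EG_act e b -> a = b.
Proof.
move=> E; have [i ti] := tE_neq0 e.
by apply: (@mulgI _ (gE e i)); rewrite -!gE_act // E.
Qed.

Lemma plot_mk U (t : U -> nat -> R) (g : U -> nat -> G) (H : forall u, weights (t u)) :
  (forall i, smooth_map (t^~ i)) -> (forall i, plot (g^~ i)) ->
  @plot R (EG G) U (fun u => mk (g u) (H u)).
Proof.
move=> ts gs u; apply: locally_self.
by exists (fun u => mkS (g u) (H u)).
Qed.

Lemma EG_plot_rect U (p : U -> EG G) (Y : diffSpace R) (r : U -> Y) : plot p ->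
  (forall W (j : W -> U) (t : W -> nat -> R) (g : W -> nat -> G)
     (H : forall w, weights (t w)), edom_smooth j ->
     (forall i, smooth_map (t^~ i)) -> (forall i, plot (g^~ i)) ->
     (forall w, p (j w) = mk (g w) (H w)) -> plot (r \o j)) ->
  plot r.
Proof.
move=> pp H; apply: (plot_quot_rect pp) => W j s js [s1 s2] sE.
apply: (H W j _ _ (fun w => weights_val (s w)) js) => // w.
by rewrite sE /mk mkS_eta.
Qed.

Lemma sm_tE i : sm (fun e => tE e i).
Proof.
move=> U p pp; apply: (EG_plot_rect pp) => W j t g H js ts gs pE.
rewrite (_ : _ \o _ = t^~ i); first exact: ts.
by apply/funext => w /=; rewrite pE tE_mk.
Qed.

Lemma plot_gE U (p : U -> EG G) i : plot p -> (forall u, tE (p u) i <> 0) ->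
  plot (fun u => gE (p u) i : G).
Proof.
move=> pp ti; apply: (EG_plot_rect pp) => W j t g H js ts gs pE.
rewrite (_ : _ \o _ = g^~ i); first exact: gs.
by apply/funext => w /=; rewrite pE gE_mk // -(tE_mk (g w) (H w)) -pE.
Qed.

Lemma plot_act U (p : U -> EG G) (a : U -> G) : plot p -> plot a ->
  @plot R (EG G) U (fun u => EG_act (p u) (a u)).
Proof.
move=> pp pa; apply: (EG_plot_rect pp) => W j t g H js ts gs pE.
rewrite (_ : _ \o _ = fun w => mk (fun i => (g w i * a (j w))%g) (H w)).
  by apply: plot_mk => // i; apply: plot_mulg => //; exact: plots_comp pa js.
by apply/funext => w /=; rewrite pE EG_act_mk.
Qed.

Definition piE (e : EG G) : BG G := qclass (fun e e' => exists a : G, e' = EG_act e a) e.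

Lemma piEP e e' : piE e = piE e' <-> exists a, e' = EG_act e a.
Proof.
split=> [/qclassP|H]; last by apply/qclassP/rst_step.
elim=> {e e'} [//|e|e e' _ [a ->]|e e' e'' _ [a ->] _ [b ->]].
- by exists 1%g; rewrite EG_act1.
- by exists a^-1%g; rewrite EG_actM mulgV EG_act1.
- by exists (a * b)%g; rewrite EG_actM.
Qed.

Lemma piE_act e a : piE (EG_act e a) = piE e.
Proof. by apply/esym/piEP; exists a. Qed.

Lemma piE_qrepr (b : BG G) : piE (qrepr b) = b.
Proof. exact: qclass_qrepr. Qed.

Lemma dsmooth_piE : @dsmooth R (EG G) (BG G) piE.
Proof. by move=> U p pp u; apply: locally_self; exists p. Qed.

Lemma BG_plot_rect U (p : U -> BG G) (Y : diffSpace R) (r : U -> Y) : plot p ->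
  (forall W (j : W -> U) (s : W -> EG G), edom_smooth j -> plot s ->
     (forall w, p (j w) = piE (s w)) -> plot (r \o j)) ->
  plot r.
Proof. exact: plot_quot_rect. Qed.

Definition tB (b : BG G) : nat -> R := tE (qrepr b).

Lemma tB_pi e : tB (piE e) = tE e.
Proof. by rewrite /tB; have /piEP[a ->] := esym (piE_qrepr (piE e)); rewrite tE_act. Qed.

Lemma sm_tB i : sm (fun b => tB b i).
Proof.
move=> U p pp; apply: (BG_plot_rect pp) => W j s js sp pE.
rewrite (_ : _ \o _ = fun w => tE (s w) i); first exact: sm_tE sp.
by apply/funext => w /=; rewrite pE tB_pi.
Qed.

(** Total in its two arguments, with the junk value 1 off the fibre product. *)
Definition divE (e e' : EG G) : G :=
  if pselect (exists a, e' = EG_act e a) is left H then projT1 (cid H) else 1%g.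

Lemma divE_act e a : divE e (EG_act e a) = a.
Proof.
rewrite /divE; case: pselect => [H|[]]; last by exists a.
by case: cid => b /= /EG_act_inj.
Qed.

Lemma act_divE e e' : piE e = piE e' -> EG_act e (divE e e') = e'.
Proof. by move=> /piEP[a ->]; rewrite divE_act. Qed.

(** Where the [i]-th weight is nonzero, the quotient of the [i]-th group
    components computes the difference. *)
Lemma plot_divE U (p p' : U -> EG G) : plot p -> plot p' ->
  (forall u, piE (p u) = piE (p' u)) -> plot (fun u => divE (p u) (p' u) : G).
Proof.
move=> pp pp' E; apply: plot_near => u; have [i ti] := tE_neq0 (p u).
have ti0 : 0 < tE (p u) i.
  have [t01 _ _] := weights_tE (p u); rewrite lt0r; have [-> _] := andP (t01 i).
  by rewrite andbT; exact/eqP.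
exists [set w | 0 < tE (p w) i]; first exact: (nb_gt (sm_tE i pp)).
move=> W j js jA; have tj w : tE (p (j w)) i <> 0 by apply/eqP; rewrite gt_eqF ?jA.
have pj : @plot R (EG G) W (p \o j) by exact: plots_comp pp js.
have pj' : @plot R (EG G) W (p' \o j) by exact: plots_comp pp' js.
rewrite (_ : _ \o _ = fun w => ((gE (p (j w)) i)^-1 * gE (p' (j w)) i)%g).
  apply: plot_mulg; first by apply: plot_invg; exact: (plot_gE pj).
  apply: (plot_gE pj') => w; have /piEP[a /= ->] := E (j w); by rewrite tE_act.
apply/funext => w /=; have /piEP[a ->] := E (j w).
by rewrite divE_act gE_act // mulKg.
Qed.

(** The point of the fibre over [b] with the same [i]-th group component as
    [e]. It is a parallel transport defined wherever the [i]-th weight is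
    nonzero, and it is the identity over the base point of [e] ([slot_id]). *)
Definition slot (i : nat) (e : EG G) (b : BG G) : EG G :=
  EG_act (qrepr b) ((gE (qrepr b) i)^-1 * gE e i)%g.

Lemma piE_slot i e b : piE (slot i e b) = b.
Proof. by rewrite piE_act piE_qrepr. Qed.

Lemma slot_pi i e e' : tE e' i <> 0 ->
  slot i e (piE e') = EG_act e' ((gE e' i)^-1 * gE e i)%g.
Proof.
move=> ti; rewrite /slot; have /piEP[a ->] := esym (piE_qrepr (piE e')).
by rewrite EG_actM gE_act // invgM !mulgA mulgV mul1g.
Qed.

Lemma slot_id i e : tE e i <> 0 -> slot i e (piE e) = e.
Proof. by move=> ti; rewrite slot_pi // mulVg EG_act1. Qed.

Lemma slot_act i e b a : tE e i <> 0 ->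
  slot i (EG_act e a) b = EG_act (slot i e b) a.
Proof. by move=> ti; rewrite /slot gE_act // EG_actM mulgA. Qed.

Lemma plot_slot i U (p : U -> EG G) (b : U -> BG G) : plot p -> plot b ->
  (forall u, tE (p u) i <> 0) -> (forall u, tB (b u) i <> 0) ->
  @plot R (EG G) U (fun u => slot i (p u) (b u)).
Proof.
move=> pp pb tp tb; apply: (BG_plot_rect pb) => W j s js sp bE.
have ts w : tE (s w) i <> 0 by rewrite -tB_pi -bE.
rewrite (_ : _ \o _ = fun w => EG_act (s w) ((gE (s w) i)^-1 * gE (p (j w)) i)%g).
  apply: plot_act => //; apply: plot_mulg; first exact/plot_invg/plot_gE.
  have pj : @plot R (EG G) W (p \o j) by exact: plots_comp pp js.
  by apply: (plot_gE pj) => w; exact: tp.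
by apply/funext => w /=; rewrite bE slot_pi.
Qed.

End Classifying.

(** * Nebulae of generating families *)

Section Nebulae.
Context {R : realType} {X : diffSpace R}.
Implicit Types (Q : genFamily X) (U W : edom R).

Lemma plot_nebula Q (q : Q) U (s : U -> pdom (\val q)) : edom_smooth s ->
  @plot R (nebula Q) U (fun u => existT _ q (s u)).
Proof. by move=> ss u; apply: locally_self; exists q, s. Qed.

Lemma nebula_plot_rect Q U (p : U -> nebula Q) (Y : diffSpace R) (r : U -> Y) : plot p ->
  (forall W (j : W -> U) (q : Q) (s : W -> pdom (\val q)), edom_smooth j ->
     edom_smooth s -> (forall w, p (j w) = existT _ q (s w)) -> plot (r \o j)) ->
  plot r.
Proof.
move=> pp H; apply: plots_local => u.
have [W [oW [WU [Wu [q [s [ss sE]]]]]]] := pp u; exists W, oW, WU; split=> //.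
apply: (H _ _ q s) => //; first exact: edom_smooth_subfun.
by move=> w; have /funeqP/(_ w) := sE.
Qed.

Lemma dsmooth_ev Q : dsmooth (@ev R X Q).
Proof.
move=> U p pp; apply: (nebula_plot_rect pp) => W j q s js ss pE.
rewrite (_ : _ \o _ = @Defs.pmap _ _ (\val q) \o s); first exact: plots_comp (pmapP _) ss.
by apply/funext => w /=; rewrite pE.
Qed.

(** A generating family lifts plots of [X] locally to its nebula, so that
    smoothness on [X] can be tested on plots that come with a lift. *)
Lemma gen_rect Q U (p : U -> X) (Y : diffSpace R) (r : U -> Y) : plot p ->
  (forall W (j : W -> U) (a : W -> nebula Q), edom_smooth j -> plot a ->
     (forall w, ev (a w) = p (j w)) -> plot (r \o j)) ->
  plot r.
Proof.
move=> pp H; apply: plots_local => u.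
have [W [oW [WU [Wu [q Qq [f fs fE]]]]]] := @gfamP _ _ Q U p pp u.
exists W, oW, WU; split=> //; pose q' : Q := SigSub (mem_set Qq).
apply: (H _ _ (fun w => existT _ q' (f w))); first exact: edom_smooth_subfun.
  exact: (@plot_nebula Q q').
by move=> w; rewrite /ev /=; have /funeqP/(_ w) := fE.
Qed.

Lemma ev_surj Q (x : X) : exists v : nebula Q, ev v = x.
Proof.
pose U := @Edom R 0 setT openT.
pose u : U := SigSub (mem_set (Logic.I : [set: 'rV[R]_0] 0)).
have [W [oW [WU [Wu [q Qq [f fs fE]]]]]] := @gfamP _ _ Q U (fun=> x) (plots_cst _ U x) u.
exists (existT _ (SigSub (mem_set Qq)) (f (SigSub (mem_set Wu)))).
by rewrite /ev /=; have /funeqP/(_ (SigSub (mem_set Wu))) := fE.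
Qed.

(** An arbitrary section of [ev]; only maps that are constant on the fibres of
    [ev] are composed with it. *)
Definition over Q (x : X) : nebula Q := projT1 (cid (ev_surj Q x)).

Lemma ev_over Q x : ev (over Q x) = x.
Proof. exact: projT2 (cid (ev_surj Q x)). Qed.

(** A map that is constant on the fibres of [ev] can be computed with the local
    lifts of [gen_rect] in place of the section [over]. *)
Lemma dsmooth_descend Q (Y : diffSpace R) (K : prodSpace (nebula Q) (realSpace R) -> Y) :
  dsmooth K -> (forall v v' s, ev v = ev v' -> K (v, s) = K (v', s)) ->
  @dsmooth R (prodSpace X (realSpace R)) Y (fun z => K (over Q z.1, z.2)).
Proof.
move=> Ks KE U p [p1 p2]; apply: (@gen_rect Q _ _ _ _ p1) => W j a js pa aE.
rewrite (_ : _ \o _ = fun w => K (a w, (p (j w)).2)).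
  apply: (Ks W (fun w => (a w, (p (j w)).2))); split => //.
  exact: (plots_comp p2 js).
by apply/funext => w /=; apply: KE; rewrite ev_over aE.
Qed.

Lemma dsmooth_descend0 Q (Y : diffSpace R) (K : nebula Q -> Y) :
  dsmooth K -> (forall v v', ev v = ev v' -> K v = K v') ->
  dsmooth (fun x => K (over Q x)).
Proof.
move=> Ks KE U p pp; apply: (@gen_rect Q _ _ _ _ pp) => W j a js pa aE.
rewrite (_ : _ \o _ = K \o a); first exact: Ks.
by apply/funext => w /=; apply: KE; rewrite ev_over aE.
Qed.

End Nebulae.

(** * Cocycles and lifts to [EG] *)

Section Cocycles.
Context {R : realType} {G : diffGroup R} {X : diffSpace R}.
Hypothesis abelianG : forall g h : dgroup G, (g * h = h * g)%g.
Implicit Types (Q : genFamily X) (U W : edom R).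

Lemma pair_nerve_subproof Q (v v' : nebula Q) : ev v = ev v' ->
  [set w : famSpace (fun _ : 'I_2 => nebula Q) | forall a b, ev (w a) = ev (w b)]
    (fun i => if i == ord0 then v else v').
Proof. by move=> E a b /=; case: ifP => _; case: ifP => _. Qed.

Definition pair_nerve Q (v v' : nebula Q) (E : ev v = ev v') : nerve Q 1 :=
  SigSub (mem_set (pair_nerve_subproof E)).

(** A 1-cochain as a function of two points of the nebula, with the junk value
    1 off the fibre product; this avoids carrying proofs of [ev v = ev v']. *)
Definition c2 Q (c : nerve Q 1 -> G) (v v' : nebula Q) : G :=
  if pselect (ev v = ev v') is left E then c (pair_nerve E) else 1%g.

Lemma c2E Q (c : nerve Q 1 -> G) (w : nerve Q 1) : c w = c2 c (\val w ord0) (\val w ord_max).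
Proof.
rewrite /c2; case: pselect => [E|[]]; last exact: (set_valP w).
congr c; apply: val_inj; apply/funext => i /=.
case: ifP => [/eqP->//|/eqP i0]; congr (\val w _); apply: val_inj => /=.
by case: i i0 => [[|[|i]] //= ? []]; apply: val_inj.
Qed.

Lemma c2_pair Q (c : nerve Q 1 -> G) v v' (E : ev v = ev v') : c2 c v v' = c (pair_nerve E).
Proof.
rewrite /c2; case: pselect => [E'|//]; congr c; exact: val_inj.
Qed.

Lemma plot_c2 Q (c : nerve Q 1 -> G) U (a b : U -> nebula Q) : dsmooth c -> plot a -> plot b ->
  (forall u, ev (a u) = ev (b u)) -> plot (fun u => c2 c (a u) (b u) : G).
Proof.
move=> cs pa pb E; rewrite (_ : (fun u => _) = fun u => c (pair_nerve (E u))).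
  apply: cs => i /=; case: (i == ord0); [exact: pa|exact: pb].
by apply/funext => u; exact: c2_pair.
Qed.

Lemma triple_nerve_subproof Q (v0 v1 v2 : nebula Q) : ev v0 = ev v1 -> ev v1 = ev v2 ->
  [set w : famSpace (fun _ : 'I_3 => nebula Q) | forall a b, ev (w a) = ev (w b)]
    (fun i => nth v0 [:: v0; v1; v2] i).
Proof.
move=> E1 E2; have H (i : 'I_3) : ev (nth v0 [:: v0; v1; v2] i) = ev v0.
  by case: i => [[|[|[|i]]]] //= _; rewrite -?E2 -E1.
by move=> a b /=; rewrite !H.
Qed.

Lemma cobound1 Q (c : nerve Q 1 -> G) (w : nerve Q 2) :
  cobound c w = (c2 c (\val w (inord 1)) (\val w (inord 2)) *
    (c2 c (\val w (inord 0)) (\val w (inord 2)))^-1 *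
    c2 c (\val w (inord 0)) (\val w (inord 1)))%g.
Proof.
rewrite /cobound !big_ord_recl big_ord0 /= mulg1 mulgA !c2E /=.
by congr (_ * _^-1 * _)%g; congr c2; congr (\val w _); apply: val_inj; rewrite /= inordK.
Qed.

Lemma c2_cocycle Q (c : cocycle G Q 1) v0 v1 v2 : ev v0 = ev v1 -> ev v1 = ev v2 ->
  c2 c v0 v2 = (c2 c v0 v1 * c2 c v1 v2)%g.
Proof.
move=> E1 E2; pose w : nerve Q 2 := SigSub (mem_set (triple_nerve_subproof E1 E2)).
have := cocycleP c w; rewrite cobound1 /= !inordK //=.
move=> /(canRL (mulgK _)); rewrite mul1g => /(canRL (mulKg _)).
by move=> /(canRL invgK); rewrite invgM !invgK.
Qed.

Lemma c2_id Q (c : cocycle G Q 1) v : c2 c v v = 1%g.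
Proof. by apply: (@mulgI _ (c2 c v v)); rewrite -c2_cocycle // mulg1. Qed.

Section MkCocycle.
Variables (Q : genFamily X) (k : nebula Q -> nebula Q -> G).
Hypothesis k_smooth : forall U (a b : U -> nebula Q), plot a -> plot b ->
  (forall u, ev (a u) = ev (b u)) -> plot (fun u => k (a u) (b u) : G).
Hypothesis k_cocycle : forall v0 v1 v2, ev v0 = ev v1 -> ev v1 = ev v2 ->
  k v0 v2 = (k v0 v1 * k v1 v2)%g.

Let kw (w : nerve Q 1) : G := k (\val w ord0) (\val w ord_max).

Let kw_smooth : dsmooth kw.
Proof.
move=> U p pp; apply: (k_smooth (pp ord0) (pp ord_max)) => u; exact: (set_valP (p u)).
Qed.

Let c2_kw v v' : ev v = ev v' -> c2 kw v v' = k v v'.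
Proof. by move=> E; rewrite (c2_pair _ E). Qed.

Let kw_cocycle w : cobound kw w = 1%g.
Proof.
have E i j : ev (\val w i) = ev (\val w j) by exact: (set_valP w).
rewrite cobound1 !c2_kw // (k_cocycle (E (inord 0) (inord 1)) (E _ (inord 2))).
by rewrite invgM mulgA mulgV mul1g mulVg.
Qed.

Definition mkCocycle : cocycle G Q 1 := Cocycle (cochain := SMap kw_smooth) kw_cocycle.

Lemma c2_mkCocycle v v' : ev v = ev v' -> c2 mkCocycle v v' = k v v'.
Proof. exact: c2_kw. Qed.

End MkCocycle.

Lemma pt_nerve_subproof Q (v : nebula Q) :
  [set w : famSpace (fun _ : 'I_1 => nebula Q) | forall a b, ev (w a) = ev (w b)]
    (fun i => v).
Proof. by []. Qed.

Definition pt_nerve Q (v : nebula Q) : nerve Q 0 := SigSub (mem_set (pt_nerve_subproof v)).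

Lemma cobound0 Q (h : nerve Q 0 -> G) (w : nerve Q 1) :
  cobound h w = (h (pt_nerve (\val w ord_max)) * (h (pt_nerve (\val w ord0)))^-1)%g.
Proof.
rewrite /cobound !big_ord_recl big_ord0 /= mulg1.
by congr (h _ * (h _)^-1)%g; apply: val_inj; apply/funext => i /=;
  congr (\val w _); apply: val_inj; case: i => -[|i] // ?.
Qed.

(** The coboundary acts by twisting on both sides; [G] being abelian, the two
    factors can be separated. *)
Lemma cohomologousP Q (c c' : cocycle G Q 1) :
  cohomologous c c' <-> exists2 h : nebula Q -> G, dsmooth h &
    forall v v', ev v = ev v' -> c2 c v v' = ((h v)^-1 * c2 c' v v' * h v')%g.
Proof.
split=> [[h hE]|[h hs hE]].
  exists (fun v => h (pt_nerve v)); first by move=> U p pp; apply: (@smapP _ _ _ h) => i.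
  move=> v v' E; rewrite !(c2_pair _ E) hE cobound0 /=.
  by rewrite mulgA abelianG mulgA.
have h's : @dsmooth R (nerve Q 0) G (fun w => h (\val w ord0)).
  by move=> U p pp; exact: hs (pp ord0).
exists (SMap h's) => w; rewrite cobound0 /= !c2E hE; last exact: (set_valP w).
by rewrite -mulgA [RHS]mulgA; exact: abelianG.
Qed.

(** Such an [F] is an equivariant map to [EG] from the principal bundle defined
    by [c], over [f]. *)
Definition Lifts (f : X -> BG G) Q (c : nerve Q 1 -> G) (F : nebula Q -> EG G) : Prop :=
  [/\ dsmooth F, forall v, piE (F v) = f (ev v) &
      forall v v', ev v = ev v' -> F v' = EG_act (F v) (c2 c v v')].

Definition classified (f : X -> BG G) Q (c : cocycle G Q 1) : Prop :=
  exists F, Lifts f c F.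

Lemma dsmooth_act (Z : diffSpace R) (F : Z -> EG G) (h : Z -> G) : dsmooth F -> dsmooth h ->
  @dsmooth R Z (EG G) (fun v => EG_act (F v) (h v)).
Proof. by move=> Fs hs U p pp; apply: plot_act; [exact: Fs|exact: hs]. Qed.

Lemma classified_cohomologous f Q (c c' : cocycle G Q 1) :
  cohomologous c c' -> classified f c' -> classified f c.
Proof.
move=> /cohomologousP[h hs hE] [F [Fs Ff FE]].
exists (fun v => EG_act (F v) (h v)); split.
- exact: dsmooth_act.
- by move=> v; rewrite piE_act.
- by move=> v v' E; rewrite (FE v v' E) hE // !EG_actM !mulgA mulgV mul1g.
Qed.

Lemma cohomologous_sym Q (c c' : cocycle G Q 1) : cohomologous c c' -> cohomologous c' c.
Proof.
move=> /cohomologousP[h hs hE]; apply/cohomologousP; exists (fun v => (h v)^-1)%g.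
  by move=> U p pp; exact: plot_invg (hs U p pp).
by move=> v v' E; rewrite hE // invgK !mulgA mulgV mul1g mulgK.
Qed.

(** The generating family consists of the plots along which [f] has a smooth
    lift to [EG]; it generates because the plots of the quotient [BG] lift
    locally. *)
Lemma classified_exists (f : X -> BG G) : dsmooth f ->
  exists Q (c : cocycle G Q 1), classified f c.
Proof.
move=> fs.
pose lift (q : plotOf X) (s : pdom q -> EG G) := @plot R (EG G) _ s /\ forall u, piE (s u) = f (q u).
have gen : generating [set q : plotOf X | exists s, lift q s].
  move=> U p pp u; have [W [oW [WU [Wu [s sp sE]]]]] := fs U p pp u.
  exists W, oW, WU; split=> //.
  have pW : plot (p \o @subfun _ W U WU : Edom oW -> X).
    exact: (plots_comp pp (edom_smooth_subfun oW WU)).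
  exists (PlotOf pW); last by exists id; [exact: edom_smooth_id|].
  by exists s; split=> // w; have /funeqP/(_ w) := sE.
pose Q := GenFamily gen.
have HQ (q : Q) : exists s, @lift (\val q) s by exact: (set_valP q).
pose S q := projT1 (cid (HQ q)); have SP q : lift _ (S q) := projT2 (cid (HQ q)).
pose F (v : nebula Q) : EG G := S (tag v) (tagged v).
have Fs : dsmooth F.
  move=> U p pp; apply: (nebula_plot_rect pp) => W j q s js ss pE.
  rewrite (_ : _ \o _ = S q \o s); first exact: (plots_comp (SP q).1 ss).
  by apply/funext => w /=; rewrite /F pE.
have Ff v : piE (F v) = f (ev v) by exact: (SP (tag v)).2.
have ks U (a b : U -> nebula Q) : plot a -> plot b -> (forall u, ev (a u) = ev (b u)) ->
    plot (fun u => divE (F (a u)) (F (b u)) : G).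
  by move=> pa pb E; apply: plot_divE; [exact: Fs|exact: Fs|move=> u; rewrite !Ff E].
have kc v0 v1 v2 : ev v0 = ev v1 -> ev v1 = ev v2 ->
    divE (F v0) (F v2) = (divE (F v0) (F v1) * divE (F v1) (F v2))%g.
  move=> E1 E2; apply: (@EG_act_inj _ _ (F v0)).
  by rewrite -EG_actM !act_divE // !Ff ?E1 ?E2.
exists Q, (mkCocycle ks kc); exists F; split=> // v v' E.
by rewrite (c2_mkCocycle ks kc E) act_divE // !Ff E.
Qed.

End Cocycles.

(** * Independence of the generating family *)

Section CechClasses.
Context {R : realType} {G : diffGroup R}.
Hypothesis abelianG : forall g h : dgroup G, (g * h = h * g)%g.

Lemma c2_pull (X Y : diffSpace R) (f : smap Y X) (Q : genFamily X) (P : genFamily Y)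
    (F : nebulaMap f Q P) (c : cocycle G Q 1) v v' : ev v = ev v' ->
  c2 (cocycle_pull F c) v v' = c2 c (F v) (F v').
Proof.
move=> E; have E' : ev (F v) = ev (F v') by rewrite !nmapP E.
rewrite (c2_pair _ E) (c2_pair _ E') /=; congr (cochain c _); apply: val_inj => /=.
by apply/funext => i; case: ifP.
Qed.

Lemma classified_pull (X Y : diffSpace R) (f : smap Y X) (Q : genFamily X)
    (P : genFamily Y) (F : nebulaMap f Q P) (c : cocycle G Q 1) (b : X -> BG G) :
  classified b c -> classified (b \o f) (cocycle_pull F c).
Proof.
move=> [L [Ls Lf LE]]; exists (L \o F); split.
- exact: dsmooth_comp (@smapP _ _ _ F) Ls.
- by move=> v /=; rewrite Lf nmapP.
- by move=> v v' E /=; rewrite (c2_pull _ _ E); apply: LE; rewrite !nmapP E.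
Qed.

Context {X : diffSpace R}.
Implicit Types (Q P : genFamily X) (f : X -> BG G).

(** Two lifts of [f] differ in each fibre by an element of [G], which is the
    required 0-cochain. *)
Lemma classified_unique f Q (c c' : cocycle G Q 1) :
  classified f c -> classified f c' -> cohomologous c c'.
Proof.
move=> [F [Fs Ff FE]] [F' [F's F'f F'E]]; apply/cohomologousP => //.
have E v : piE (F' v) = piE (F v) by rewrite Ff F'f.
exists (fun v => divE (F' v) (F v)).
  by move=> U p pp; apply: plot_divE => [||u]; [exact: F's|exact: Fs|exact: E].
move=> v v' Ev; apply: (@EG_act_inj _ _ (F v)).
rewrite -(FE v v' Ev); set d := divE (F' v) (F v).
rewrite -[F v in RHS](act_divE (E v)) -/d EG_actM !mulgA mulgV mul1g.
by rewrite -EG_actM -(F'E v v' Ev) act_divE.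
Qed.

(** The plots that factor through a member of each of the two families. *)
Lemma common_refinement Q Q' :
  exists P, inhabited (refinement Q P) /\ inhabited (refinement Q' P).
Proof.
pose fac (r q : plotOf X) (g : pdom r -> pdom q) := edom_smooth g /\ forall u, q (g u) = r u.
pose P0 := [set r : plotOf X | (exists (q : Q) g, fac r (\val q) g) /\
                               (exists (q : Q') g, fac r (\val q) g)].
have gen : generating P0.
  move=> U p pp u; apply: locally_trans.
  have [W [oW [WU [Wu [q Qq [f fs fE]]]]]] := @gfamP _ _ Q U p pp u.
  exists W, oW, WU; split=> // w.
  have pW : plot (p \o @subfun _ W U WU : Edom oW -> X).
    exact: (plots_comp pp (edom_smooth_subfun oW WU)).
  have [W' [oW' [W'W [W'w [q' Q'q' [f' f's f'E]]]]]] := @gfamP _ _ Q' _ _ pW w.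
  exists W', oW', W'W; split=> //.
  have sW' := @edom_smooth_subfun R (Edom oW) W' oW' W'W.
  have pW' : plot ((p \o @subfun _ W U WU) \o @subfun _ W' W W'W : Edom oW' -> X).
    exact: (plots_comp pW sW').
  exists (PlotOf pW'); last by exists id; [exact: edom_smooth_id|].
  split.
    exists (SigSub (mem_set Qq)), (f \o @subfun _ W' W W'W); split.
      exact: edom_smooth_comp sW' fs.
    by move=> v; have /funeqP/(_ (subfun W'W v)) := fE.
  exists (SigSub (mem_set Q'q')), f'; split=> // v.
  by have /funeqP/(_ v) := f'E.
pose P := GenFamily gen.
have ref (Q1 : genFamily X) : (forall r : P, exists (q : Q1) g, fac (\val r) (\val q) g) ->
    inhabited (refinement Q1 P).
  move=> H; have H' (r : P) : exists z : {q : Q1 & pdom (\val r) -> pdom (\val q)},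
      fac (\val r) (\val (tag z)) (tagged z).
    by have [q [g H']] := H r; exists (existT _ q g).
  pose z r := projT1 (cid (H' r)); have zP r := projT2 (cid (H' r)).
  constructor; apply: (@Refinement _ X Q1 P (fun r => tag (z r)) (fun r => tagged (z r))) => r.
    exact: (zP r).1.
  by move=> u; exact: (zP r).2.
by exists P; split; apply: ref => r; have [] := set_valP r.
Qed.

Lemma cech_class_refine Q P (r : refinement Q P) (c : cocycle G Q 1) :
  cech_class (qclass (@cohomologous _ G _ Q 1) c) =
  cech_class (qclass (@cohomologous _ G _ P 1) (cocycle_pull (refinement_map r) c)).
Proof. by apply/qclassP/rst_step; exists r; rewrite /= /cech_pull qmapE. Qed.

Lemma classified_cech f Q Q' (c : cocycle G Q 1) (c' : cocycle G Q' 1) :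
  classified f c -> classified f c' ->
  cech_class (qclass (@cohomologous _ G _ Q 1) c) =
  cech_class (qclass (@cohomologous _ G _ Q' 1) c').
Proof.
move=> H H'; have [P [[r] [r']]] := common_refinement Q Q'.
rewrite (cech_class_refine r) (cech_class_refine r'); congr cech_class.
apply/qclassP/rst_step/(@classified_unique f).
  exact: (classified_pull (refinement_map r) H).
exact: (classified_pull (refinement_map r') H').
Qed.

(** Move the value of the lift at any point of the refinement in the same fibre
    by the cocycle; the cocycle identity makes the result independent of that
    point, and thus smooth. *)
Lemma classified_descend f Q P (r : refinement Q P) (c : cocycle G Q 1) :
  classified f (cocycle_pull (refinement_map r) c) -> classified f c.
Proof.
set phi := refinement_map r; move=> [F [Fs Ff FE]].
have phiE w : ev (phi w) = ev w by exact: (nmapP phi w).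
have indep w w' v : ev w = ev v -> ev w' = ev v ->
    EG_act (F w) (c2 c (phi w) v) = EG_act (F w') (c2 c (phi w') v).
  move=> E E'; have Ew : ev w = ev w' by rewrite E'.
  rewrite (FE w w' Ew) EG_actM (c2_pull _ _ Ew) -c2_cocycle ?phiE //.
exists (fun v => EG_act (F (over P (ev v))) (c2 c (phi (over P (ev v))) v)); split.
- move=> U a pa; apply: (@gen_rect _ _ P _ _ _ _ (@dsmooth_ev _ _ Q _ _ pa)) => W j b js pb bE.
  rewrite (_ : _ \o _ = fun w => EG_act (F (b w)) (c2 c (phi (b w)) (a (j w)))).
    apply: plot_act; first exact: Fs.
    apply: plot_c2; [exact: smapP|exact: (@smapP _ _ _ phi)|exact: plots_comp pa js|].
    by move=> w; rewrite phiE bE.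
  by apply/funext => w /=; apply: indep; rewrite ?ev_over // bE.
- by move=> v; rewrite piE_act Ff ev_over.
- move=> v v' E; rewrite EG_actM -E -c2_cocycle ?phiE ?ev_over //.
Qed.

Lemma classified_qclass f Q (c c' : cocycle G Q 1) :
  qclass (@cohomologous _ G _ Q 1) c = qclass (@cohomologous _ G _ Q 1) c' ->
  classified f c <-> classified f c'.
Proof.
move=> /qclassP; elim=> {c c'} [c c' H|c|c c' _ IH|c c' c'' _ IH _ IH'].
- split; last exact: classified_cohomologous.
  by apply: classified_cohomologous => //; exact: cohomologous_sym.
- by [].
- by split=> /IH.
- by split=> [/IH/IH'|/IH'/IH].
Qed.

Let Cl f (z : {Q : genFamily X & cechFam G Q 1}) := classified f (qrepr (tagged z)).

Let Cl_step f z z' : cech_step z z' -> Cl f z <-> Cl f z'.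
Proof.
case: z z' => [Q a] [P b] [r /= bE]; rewrite /Cl /=.
have E : qclass (@cohomologous _ G _ P 1) (qrepr b) =
    qclass (@cohomologous _ G _ P 1) (cocycle_pull (refinement_map r) (qrepr a)).
  by rewrite qclass_qrepr bE.
split=> [H|/(classified_qclass f E)].
  by apply/(classified_qclass f E); exact: (classified_pull (refinement_map r) H).
exact: classified_descend.
Qed.

(** Stated with representatives; [ClassifiedP] shows that the choice is
    immaterial. *)
Definition Classified f (a : cech G X 1) : Prop := classified f (qrepr (tagged (qrepr a))).

Lemma ClassifiedP f Q (c : cocycle G Q 1) :
  Classified f (cech_class (qclass (@cohomologous _ G _ Q 1) c)) <-> classified f c.
Proof.
have E : classified f (qrepr (qclass (@cohomologous _ G _ Q 1) c)) <-> classified f c.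
  by apply: classified_qclass; rewrite qclass_qrepr.
suff H z z' : clos_refl_sym_trans _ (@cech_step _ G X 1) z z' -> Cl f z <-> Cl f z'.
  rewrite -E; apply: (H _ (existT _ Q (qclass _ c))); apply/qclassP.
  by rewrite qclass_qrepr.
elim=> {z z'} [z z' /(Cl_step f)//|//|z z' _ IH|z z' z'' _ IH _ IH'].
  by split=> /IH.
by split=> [/IH/IH'|/IH'/IH].
Qed.

Lemma cech_rep (a : cech G X 1) : exists Q (c : cocycle G Q 1),
  a = cech_class (qclass (@cohomologous _ G _ Q 1) c).
Proof.
have [[Q b] <-] := qclass_surj a; have [c <-] := qclass_surj b.
by exists Q, c.
Qed.

Lemma Classified_unique f a a' : Classified f a -> Classified f a' -> a = a'.
Proof.
have [Q [c ->]] := cech_rep a; have [Q' [c' ->]] := cech_rep a'.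
by move=> /ClassifiedP H /ClassifiedP H'; exact: classified_cech H H'.
Qed.

Lemma Classified_exists f : dsmooth f -> exists a, Classified f a.
Proof.
move=> /classified_exists[Q [c H]].
by exists (cech_class (qclass (@cohomologous _ G _ Q 1) c)); apply/ClassifiedP.
Qed.

End CechClasses.

(** * Homotopies by mixing weights *)

Section Step.
Context {R : realType}.

(** Smooth, equal to 0 before time 0 and to 1 after time 1. *)
Definition step (s : R) : R := flat 0 s / (flat 0 s + flat 0 (1 - s)).

Let step_den (s : R) : 0 < flat 0 s + flat 0 (1 - s).
Proof.
have [s0|s0] := leP s 0; last by rewrite ltr_pwDl ?flat_gt0 ?flat_ge0.
by rewrite ltr_wpDl ?flat_ge0 // flat_gt0 // subr_gt0 (le_lt_trans s0).
Qed.

Lemma step_le0 (s : R) : s <= 0 -> step s = 0.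
Proof. by move=> s0; rewrite /step flat_le0 // mul0r. Qed.

Lemma step_ge1 (s : R) : 1 <= s -> step s = 1.
Proof.
move=> s1; rewrite /step [flat 0 (1 - s)]flat_le0 ?subr_le0 // addr0 mulfV // gt_eqF //.
by rewrite flat_gt0 // (lt_le_trans ltr01).
Qed.

Lemma step_itv (s : R) : 0 <= step s <= 1.
Proof.
rewrite divr_ge0 ?flat_ge0 ?(ltW (step_den s)) //= ler_pdivrMr // mul1r lerDl.
exact: flat_ge0.
Qed.

Lemma sm_id : @sm R (realSpace R) id.
Proof. by move=> U p pp. Qed.

Lemma sm_step (X : diffSpace R) (f : X -> R) : sm f -> sm (fun x => step (f x)).
Proof.
move=> fs; apply: sm_div; first exact: sm_flat.
  by apply: smD; apply: sm_flat => //; apply: smB => //; exact: sm_cst.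
by move=> x; rewrite gt_eqF.
Qed.

End Step.

Section Mixing.
Context {R : realType} {G : diffGroup R}.
Implicit Types (t : nat -> R) (g : nat -> G) (U W : edom R) (e : EG G).

(** Two points with common group components span a segment in [EG]. *)
Definition common e e' g : Prop :=
  e = mk g (weights_tE e) /\ e' = mk g (weights_tE e').

Lemma mk_irr t t' g (H : weights t) (H' : weights t') : t =1 t' -> mk g H = mk g H'.
Proof. by move=> E; apply/mk_eqP. Qed.

Lemma common_mk t t' g (H : weights t) (H' : weights t') : common (mk g H) (mk g H') g.
Proof. by split; apply: mk_irr; rewrite tE_mk. Qed.

(** The point at [l] of the segment from [e] to [e'], with the junk value [e]
    when there is no such segment. *)
Definition mixE (l : R) e e' : EG G :=
  if pselect (0 <= l <= 1) is left l01 then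
    if pselect (exists g, common e e' g) is left H then
      mk (projT1 (cid H)) (weights_mix l01 (weights_tE e) (weights_tE e'))
    else e
  else e.

Lemma mixE_common l e e' g (l01 : 0 <= l <= 1) : common e e' g ->
  mixE l e e' = mk g (weights_mix l01 (weights_tE e) (weights_tE e')).
Proof.
move=> C; rewrite /mixE; case: pselect => // l01'; case: pselect => [H|[]]; last by exists g.
case: cid => g' /= [E1 E2]; apply/mk_eqP; split=> // i; have [F1 F2] := C.
have /mk_eqP[_ H1] : mk g' (weights_tE e) = mk g (weights_tE e) by rewrite -E1 -F1.
have /mk_eqP[_ H2] : mk g' (weights_tE e') = mk g (weights_tE e') by rewrite -E2 -F2.
have [->|/eqP t0 _] := eqVneq (tE e i) 0; last exact: H1.
rewrite mulr0 add0r => lt; apply: H2 => t'0; apply: lt; by rewrite t'0 mulr0.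
Qed.

Lemma mixE_mk l t t' g (H : weights t) (H' : weights t') (l01 : 0 <= l <= 1) :
  mixE l (mk g H) (mk g H') = mk g (weights_mix l01 H H').
Proof.
rewrite (mixE_common l01 (common_mk g H H')); apply: mk_irr => i.
by rewrite !tE_mk.
Qed.

Lemma mixE0 e e' : (exists g, common e e' g) -> mixE 0 e e' = e.
Proof.
have l01 : 0 <= (0 : R) <= 1 by rewrite lexx ler01.
move=> [g C]; rewrite (mixE_common l01 C) [RHS]C.1; apply: mk_irr => i.
by rewrite subr0 mul1r mul0r addr0.
Qed.

Lemma mixE1 e e' : (exists g, common e e' g) -> mixE 1 e e' = e'.
Proof.
have l01 : 0 <= (1 : R) <= 1 by rewrite lexx ler01.
move=> [g C]; rewrite (mixE_common l01 C) [RHS]C.2; apply: mk_irr => i.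
by rewrite subrr mul1r mul0r add0r.
Qed.

Lemma mixE_act l e e' a : 0 <= l <= 1 -> (exists g, common e e' g) ->
  mixE l (EG_act e a) (EG_act e' a) = EG_act (mixE l e e') a.
Proof.
move=> l01 [g C]; rewrite (mixE_common l01 C) EG_act_mk.
have C' : common (EG_act e a) (EG_act e' a) (fun i => (g i * a)%g).
  by have [E1 E2] := C; rewrite E1 E2 !EG_act_mk; exact: common_mk.
by rewrite (mixE_common l01 C'); apply: mk_irr => i; rewrite !tE_act.
Qed.

Lemma EG_local U (p : U -> EG G) : plot p -> forall u, locally u (fun W j =>
  exists (t : W -> nat -> R) (g : W -> nat -> G) (H : forall w, weights (t w)),
    [/\ forall i, smooth_map (t^~ i), forall i, plot (g^~ i) &
        forall w, p (j w) = mk (g w) (H w)]).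
Proof.
move=> pp u; apply: locally_mono (pp u) => W j [s [s1 s2] sE].
exists (fun w i => \val ((\val (s w)).1 i)), (fun w => (\val (s w)).2),
  (fun w => weights_val (s w)); split=> // w.
by rewrite /mk mkS_eta; have /funeqP/(_ w) := sE.
Qed.

(** The group components must be shared locally by plots, and not only
    pointwise, for the segment to vary smoothly. *)
Definition compatible (Z : diffSpace R) (F F' : Z -> EG G) : Prop :=
  forall U (p : U -> Z), plot p -> forall u, locally u (fun W j => edom_smooth j /\
    exists (t t' : W -> nat -> R) (g : W -> nat -> G) (H : forall w, weights (t w))
      (H' : forall w, weights (t' w)),
    [/\ (forall i, smooth_map (t^~ i)) /\ (forall i, smooth_map (t'^~ i)),
        forall i, plot (g^~ i), forall w, F (p (j w)) = mk (g w) (H w) &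
        forall w, F' (p (j w)) = mk (g w) (H' w)]).

Lemma compatible_common (Z : diffSpace R) (F F' : Z -> EG G) z : compatible F F' ->
  exists g, common (F z) (F' z) g.
Proof.
move=> /(_ (@Edom R 0 setT openT) (fun=> z) (plots_cst _ _ z)).
move=> /(_ (SigSub (mem_set (Logic.I : [set: 'rV[R]_0] 0)))).
move=> [W [oW [WU [Wu [_ [t [t' [g [H [H' [_ _ E E']]]]]]]]]]].
pose w : Edom oW := SigSub (mem_set Wu).
by exists (g w); rewrite (E w) (E' w); exact: common_mk.
Qed.

Lemma dsmooth_mix (Z : diffSpace R) (F F' : Z -> EG G) : compatible F F' ->
  @dsmooth R (prodSpace Z (realSpace R)) (EG G) (fun zs => mixE (step zs.2) (F zs.1) (F' zs.1)).
Proof.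
move=> C U p [p1 p2]; apply: plots_local => u.
apply: locally_mono (C U _ p1 u) => W j [js [t [t' [g [H [H' [[ts t's] gs E E']]]]]]].
have l01 (w : W) := step_itv (p (j w)).2.
rewrite (_ : _ \o j = fun w => mk (g w) (weights_mix (l01 w) (H w) (H' w))).
  apply: plot_mk => // i.
  have ps : smooth_map (fun w => step (p (j w)).2).
    have := @sm_step _ _ _ (@sm_id R) _ _ (plots_comp p2 js); exact.
  apply: smooth_mapD; last exact: smooth_mapM.
  apply: smooth_mapM => //; apply: smooth_mapD; first exact: (plots_cst (dstruct (realSpace R)) W 1).
  rewrite (_ : (fun w => _) = fun w => -1 * step (p (j w)).2); last first.
    by apply/funext => w; rewrite mulN1r.
  by apply: smooth_mapM => //; exact: (plots_cst (dstruct (realSpace R)) W (-1)).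
apply/funext => w /=; have -> := E w; have -> := E' w; exact: mixE_mk.
Qed.

(** The segment between the two lifts is equivariant, hence descends to a
    homotopy. *)
Lemma compatible_homotopic (X : diffSpace R) (Q : genFamily X) (c : cocycle G Q 1)
    (F F' : nebula Q -> EG G) (f f' : smap X (BG G)) :
  Lifts f c F -> Lifts f' c F' -> compatible F F' -> smooth_homotopic f f'.
Proof.
move=> [Fs Ff FE] [F's F'f F'E] C.
have Ks := dsmooth_comp (dsmooth_mix C) (@dsmooth_piE R G).
have KE v v' s : ev v = ev v' ->
    piE (mixE (step s) (F v) (F' v)) = piE (mixE (step s) (F v') (F' v')).
  move=> E; rewrite (FE _ _ E) (F'E _ _ E) mixE_act ?piE_act ?step_itv //.
  exact: compatible_common.
exists (SMap (dsmooth_descend Ks KE)); split=> x /=.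
  by rewrite step_le0 // mixE0 ?Ff ?ev_over //; exact: compatible_common.
by rewrite step_ge1 // mixE1 ?F'f ?ev_over //; exact: compatible_common.
Qed.

End Mixing.

(** * Moving slots apart *)

Section Slots.
Context {R : realType} {G : diffGroup R}.
Implicit Types (t : nat -> R) (g : nat -> G) (U W : edom R) (e : EG G).

(** The 2-adic valuation of the successor of the half of [i] takes every value
    infinitely often, along even and along odd indices ([slot_srcP]). *)
Definition slot_src (i : nat) : nat := logn 2 (i./2).+1.

Lemma slot_srcP (eps : bool) (j k : nat) :
  exists i, [/\ (k <= i)%N, odd i = eps & slot_src i = j].
Proof.
pose m := (2 ^ j * (2 * k).+1).-1; exists (m.*2 + eps)%N.
have p2 : (0 < 2 ^ j)%N by rewrite expn_gt0.
have mS : m.+1 = (2 ^ j * (2 * k).+1)%N by rewrite prednK // muln_gt0 p2.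
have km : (k <= m)%N.
  rewrite -ltnS mS; apply: (@leq_trans (2 * k).+1); first by rewrite ltnS leq_pmull.
  by rewrite leq_pmull.
split.
- by rewrite (leq_trans km) // -addnn -addnA leq_addr.
- by rewrite oddD odd_double; case: eps.
- rewrite /slot_src addnC half_bit_double mS lognM // pfactorK // (@logn_coprime 2) ?addn0 //.
  by rewrite coprime_sym coprimen2 /= oddM.
Qed.

(** The quantity compared with [t i] by [cutoff]: the refined weight of slot
    [i] vanishes as soon as it exceeds 1 ([refine_delay]). *)
Definition delay t (i : nat) : R := i%:R * \sum_(l < i) t l.

(** Copies the refined weight of slot [j] to the slots [i] of parity [eps] with
    [slot_src i = j], damped so that only those with delay above 2 remain. At
    each point these slots are disjoint from the slots of the refined weights,
    which have delay at most 1; the space between 1 and 2 makes this hold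
    locally. *)
Definition spread (eps : bool) t (i : nat) : R :=
  if odd i == eps then refine t (slot_src i) * flat 0 (delay t i - 2) else 0.

(** Every slot with a nonzero refined weight is the source of arbitrarily late
    slots of parity [eps], and the delay tends to infinity. *)
Lemma spread_adm eps t : weights t -> admissible (spread eps t).
Proof.
move=> H; have ta := weights_adm H; split.
  move=> i; rewrite /spread; case: ifP => _; last by rewrite lexx ler01.
  apply/andP; split; first by rewrite mulr_ge0 ?refine_ge0 ?flat_ge0.
  rewrite -[X in _ <= X]mulr1.
  by rewrite ler_pM ?refine_ge0 ?flat_ge0 ?refine_le1 ?flat0_le1.
have [j rj] := refine_gt0 ta; have [t01 [l tl]] := ta.
pose k := maxn l.+1 (Num.bound (2 / t l)).
have [i [ki oi si]] := slot_srcP eps j k; exists i.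
rewrite /spread oi eqxx si mulr_gt0 // flat_gt0 // subr_gt0 /delay.
have li : (l < i)%N by rewrite (leq_trans _ ki) // leq_max ltnSn.
have sl : t l <= \sum_(m < i) t m.
  rewrite (bigD1 (Ordinal li)) //= lerDl sumr_ge0 // => m _.
  by have [] := andP (t01 m).
apply: (@lt_le_trans _ _ (i%:R * t l)); last by rewrite ler_wpM2l.
rewrite -ltr_pdivrMr //; apply: (@lt_le_trans _ _ (Num.bound (2 / t l))%:R).
  by rewrite archi_boundP // divr_ge0 // ltW.
by rewrite ler_nat (leq_trans _ ki) // leq_max leqnn orbT.
Qed.

Lemma spread_neq0 eps t i : weights t -> refine (spread eps t) i <> 0 ->
  [/\ odd i = eps, t (slot_src i) <> 0 & 2 < delay t i].
Proof.
move=> H /eqP ri; have := refine_neq0 (spread_adm eps H) ri.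
rewrite /spread; case: eqP => [oi|_]; last by rewrite ltxx.
move=> s0; split=> //.
  move=> t0; have [|] := ltrP 0 (refine t (slot_src i)); last first.
    move=> r0; move: s0; rewrite ltNge; apply/negP.
    by rewrite negbK mulr_le0_ge0 ?flat_ge0.
  move=> r0; have := refine_neq0 (weights_adm H) (lt0r_neq0 r0).
  by rewrite t0 ltxx.
rewrite ltNge; apply/negP => d2; move: s0.
by rewrite flat_le0 ?subr_le0 // mulr0 ltxx.
Qed.

Lemma refine_delay t i : weights t -> 1 < delay t i -> refine t i = 0.
Proof.
move=> [t01 _ _] d1; apply/refine_eq0/cutoff_eq0; have /andP[_ ti] := t01 i.
exact/(le_trans ti)/ltW.
Qed.

(** Passing to refined weights keeps the group components, and makes the plots
    of [EG] locally finite. *)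
Definition refineE e : EG G := mk (gE e) (weights_refine (weights_adm (weights_tE e))).

(** The group component of a slot is that of its source. *)
Definition spreadE (eps : bool) e : EG G :=
  mk (fun i => gE e (slot_src i)) (weights_refine (spread_adm eps (weights_tE e))).

Lemma refineE_mk t g (H : weights t) (H' : weights (refine t)) :
  refineE (mk g H) = mk g H'.
Proof.
apply/mk_eqP; rewrite tE_mk; split=> // i /eqP/(refine_neq0 (weights_adm H)) ti.
by rewrite gE_mk //; apply/eqP; rewrite gt_eqF.
Qed.

Lemma spreadE_mk eps t g (H : weights t) (H' : weights (refine (spread eps t))) :
  spreadE eps (mk g H) = mk (fun i => g (slot_src i)) H'.
Proof.
apply/mk_eqP; rewrite tE_mk; split=> // i /(spread_neq0 H)[_ ti _].
by rewrite gE_mk.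
Qed.

Lemma refineE_act e a : refineE (EG_act e a) = EG_act (refineE e) a.
Proof.
have Hr := weights_refine (weights_adm (weights_tE e)).
rewrite -{1}(mk_eta e) EG_act_mk (refineE_mk _ _ Hr) /refineE EG_act_mk.
exact: mk_irr.
Qed.

Lemma spreadE_act eps e a : spreadE eps (EG_act e a) = EG_act (spreadE eps e) a.
Proof.
have Hr := weights_refine (spread_adm eps (weights_tE e)).
rewrite -{1}(mk_eta e) EG_act_mk (spreadE_mk _ _ Hr) /spreadE EG_act_mk.
exact: mk_irr.
Qed.

Let adm_tE e : admissible (tE e). Proof. exact/weights_adm/weights_tE. Qed.

Lemma sm_refine_tE i : sm (fun e => refine (tE e) i).
Proof. exact: (@sm_refine _ _ (fun m e => tE e m) (@sm_tE R G) adm_tE). Qed.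

Lemma locfin_refine_tE : @locfin R (EG G) nat (fun i e => refine (tE e) i).
Proof. exact: (@locfin_refine _ _ (fun m e => tE e m) (@sm_tE R G) adm_tE). Qed.

Lemma sm_delay i : sm (fun e => delay (tE e) i).
Proof.
apply: smM; first exact: sm_cst.
exact: (sm_sum _ (fun l : 'I_i => @sm_tE R G l)).
Qed.

Lemma sm_spread eps i : sm (fun e => spread eps (tE e) i).
Proof.
rewrite /spread; case: (odd i == eps); last exact: sm_cst.
apply: smM; first exact: sm_refine_tE.
by apply: sm_flat; apply: smB; [exact: sm_delay|exact: sm_cst].
Qed.

Let adm_spread eps e : admissible (spread eps (tE e)).
Proof. exact/spread_adm/weights_tE. Qed.

Lemma sm_refine_spread eps i : sm (fun e => refine (spread eps (tE e)) i).
Proof. exact: (@sm_refine _ _ (fun m e => spread eps (tE e) m) (sm_spread eps) (adm_spread eps)). Qed.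

Lemma locfin_refine_spread eps : @locfin R (EG G) nat (fun i e => refine (spread eps (tE e)) i).
Proof. exact: (@locfin_refine _ _ (fun m e => spread eps (tE e) m) (sm_spread eps) (adm_spread eps)). Qed.

Lemma smooth_weight (T : (nat -> R) -> R) U (p : U -> EG G) (t : U -> nat -> R)
    (g : U -> nat -> G) (H : forall u, weights (t u)) :
  sm (fun e => T (tE e)) -> plot p -> (forall u, p u = mk (g u) (H u)) ->
  smooth_map (fun u => T (t u)).
Proof.
move=> Ts pp pE; suff <- : (fun e => T (tE e)) \o p = (fun u => T (t u)) by exact: Ts.
by apply/funext => u /=; rewrite pE tE_mk.
Qed.

Lemma dsmooth_refineE : @dsmooth R (EG G) (EG G) refineE.
Proof.
move=> U p pp; apply: (EG_plot_rect pp) => W j t g H js ts gs pE.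
have Hr w := weights_refine (weights_adm (H w)).
rewrite (_ : _ \o _ = fun w => mk (g w) (Hr w)); last first.
  by apply/funext => w /=; rewrite pE (refineE_mk _ _ (Hr w)).
apply: plot_mk => // i.
exact: (smooth_weight (T := fun t => refine t i) (sm_refine_tE i) (plots_comp pp js) pE).
Qed.

Lemma dsmooth_spreadE eps : @dsmooth R (EG G) (EG G) (spreadE eps).
Proof.
move=> U p pp; apply: (EG_plot_rect pp) => W j t g H js ts gs pE.
have Hr w := weights_refine (spread_adm eps (H w)).
rewrite (_ : _ \o _ = fun w => mk (fun i => g w (slot_src i)) (Hr w)); last first.
  by apply/funext => w /=; rewrite pE (spreadE_mk _ _ (Hr w)).
apply: plot_mk => // i.
exact: (smooth_weight (T := fun t => refine (spread eps t) i)
  (sm_refine_spread eps i) (plots_comp pp js) pE).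
Qed.

Lemma compatible_refineE : @compatible R G (EG G) id refineE.
Proof.
move=> U p pp u; have [W [oW [WU [Wu [t [g [H [ts gs pE]]]]]]]] := EG_local pp u.
exists W, oW, WU; split=> //; have js := edom_smooth_subfun oW WU; split=> //.
have Hr w := weights_refine (weights_adm (H w)).
exists t, (fun w => refine (t w)), g, H, Hr; split=> //.
- split=> // i.
  exact: (smooth_weight (T := fun t => refine t i) (sm_refine_tE i) (plots_comp pp js) pE).
- by move=> w; rewrite pE (refineE_mk _ _ (Hr w)).
Qed.

(** Near a point, a slot is used either by the refined weights or by the spread
    weights, according to its delay at that point; by local finiteness only
    finitely many slots have to be examined. Taking the group component from
    the slot in the first case and from its source in the second yields common
    components. *)
Lemma compatible_spreadE eps : @compatible R G (EG G) refineE (spreadE eps).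
Proof.
move=> U p pp u; apply: locally_trans.
have [W [oW [WU [Wu [t [g [H [ts gs pE]]]]]]]] := EG_local pp u.
exists W, oW, WU; split=> //; have js := edom_smooth_subfun oW WU => w0.
set j := subfun WU in pE js *; have pj := plots_comp pp js.
have [r1 _ Hr1] := locfin_refine_tE pj w0.
have [r2 _ Hr2] := @locfin_refine_spread eps _ _ pj w0.
pose far i := 1 < delay (t w0) i.
have tpE w : tE (p (j w)) = t w by rewrite pE tE_mk.
pose good (w : Edom oW) i := if far i then 1 < delay (t w) i else delay (t w) i < 2.
have sd i : smooth_map (fun w => delay (t w) i).
  exact: (smooth_weight (T := fun t => delay t i) (sm_delay i) pj pE).
have Hgood : nb w0 [set w | forall i, i \in r1 ++ r2 -> good w i].
  apply: (@nb_all_in _ _ _ _ _ (fun i w => good w i)) => i _; rewrite /good.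
  case: (boolP (far i)) => fi; first exact: (nb_gt (sd i) fi).
  by apply: (nb_lt (sd i)); rewrite -leNgt in fi; rewrite (le_lt_trans fi) // ltr1n.
apply: (nb_locally (filterI (filterI Hr1 Hr2) Hgood)) => W' j' j's Hj'.
split; first exact: edom_smooth_comp j's js.
pose g' w i := if far i then g (j' w) (slot_src i) else g (j' w) i.
have Hb w := weights_refine (weights_adm (H (j' w))).
have Ho w := weights_refine (spread_adm eps (H (j' w))).
exists (fun w => refine (t (j' w))), (fun w => refine (spread eps (t (j' w)))), g', Hb, Ho.
have pj' := plots_comp pj j's; have pE' w := pE (j' w).
split.
- split=> i.
    exact: (smooth_weight (T := fun t => refine t i) (sm_refine_tE i) pj' pE').
  exact: (smooth_weight (T := fun t => refine (spread eps t) i) (sm_refine_spread eps i) pj' pE').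
- move=> i; rewrite /g'; case: (far i); exact: plots_comp (gs _) j's.
- move=> w /=; rewrite -/(j _) pE (refineE_mk _ _ (Hb w)); apply/mk_eqP; split=> // i ri.
  have [[K1 K2] K3] := Hj' w; rewrite /= tpE in K1; rewrite /g'; case: ifPn => // fi; exfalso.
  apply: ri; have [ir|/K1//] := boolP (i \in r1).
  have := K3 i; rewrite mem_cat ir /good fi => /(_ isT); exact: refine_delay.
- move=> w /=; rewrite -/(j _) pE (spreadE_mk _ _ (Ho w)); apply/mk_eqP; split=> // i ri.
  have [[K1 K2] K3] := Hj' w; rewrite /= tpE in K2; rewrite /g'; case: ifPn => // fi; exfalso.
  have [_ _ d2] := spread_neq0 (H (j' w)) ri.
  have [ir|/K2//] := boolP (i \in r2).
  have := K3 i; rewrite mem_cat ir orbT /good (negbTE fi) => /(_ isT).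
  by move=> /(lt_trans d2); rewrite ltxx.
Qed.

Lemma compatible_comp (Z Z' : diffSpace R) (h : Z' -> Z) (F F' : Z -> EG G) :
  dsmooth h -> compatible F F' -> compatible (F \o h) (F' \o h).
Proof. by move=> hs C U p pp; exact: C (hs U p pp). Qed.

(** The two sets of slots are disjoint, so that the group components can be
    chosen slot by slot. *)
Lemma compatible_parity (Z : diffSpace R) (F F' : Z -> EG G) : dsmooth F -> dsmooth F' ->
  compatible (spreadE false \o F) (spreadE true \o F').
Proof.
move=> Fs F's U p pp u; apply: locally_trans.
have [W [oW [WU [Wu [t [g [H [ts gs pE]]]]]]]] := EG_local (Fs U p pp) u.
exists W, oW, WU; split=> //; have js := edom_smooth_subfun oW WU => w0.
set j := subfun WU in pE js *; have pj := plots_comp pp js.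
have [W' [oW' [W'W [W'u [t' [g' [H' [t's g's p'E]]]]]]]] := EG_local (F's _ _ pj) w0.
exists W', oW', W'W; split=> //; have j's := @edom_smooth_subfun R (Edom oW) W' oW' W'W.
set j' := subfun W'W in p'E j's *; have pj' := plots_comp pj j's.
split; first exact: edom_smooth_comp j's js.
have Ho w := weights_refine (spread_adm false (H (j' w))).
have Ho' w := weights_refine (spread_adm true (H' w)).
exists _, _, (fun w i => if odd i then g' w (slot_src i) else g (j' w) (slot_src i)), Ho, Ho'.
split.
- split=> i.
    exact: (smooth_weight (T := fun t => refine (spread false t) i) (sm_refine_spread false i)
      (Fs _ _ pj') (fun w => pE (j' w))).
  exact: (smooth_weight (T := fun t => refine (spread true t) i)
    (sm_refine_spread true i) (F's _ _ pj') p'E).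
- by move=> i; case: (odd i); [exact: g's|exact: plots_comp (gs _) j's].
- move=> w; have /= -> := pE (j' w); rewrite (spreadE_mk _ _ (Ho w)); apply/mk_eqP; split=> //.
  by move=> i /(spread_neq0 (H (j' w)))[-> _ _].
- move=> w; have /= -> := p'E w; rewrite (spreadE_mk _ _ (Ho' w)); apply/mk_eqP; split=> //.
  by move=> i /(spread_neq0 (H' w))[-> _ _].
Qed.

Section Uniqueness.
Context {X : diffSpace R} {Q : genFamily X} {c : cocycle G Q 1}.

(** By equivariance the composite with the projection is constant on the fibres
    of [ev]. *)
Lemma lift_base (F : nebula Q -> EG G) : dsmooth F ->
  (forall v v', ev v = ev v' -> F v' = EG_act (F v) (c2 c v v')) ->
  exists f : smap X (BG G), Lifts f c F.
Proof.
move=> Fs FE; have Ks := dsmooth_comp Fs (@dsmooth_piE R G).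
have KE v v' : ev v = ev v' -> piE (F v) = piE (F v').
  by move=> E; rewrite (FE v v' E) piE_act.
exists (SMap (dsmooth_descend0 Ks KE)); split=> // v /=.
by apply: KE; rewrite ev_over.
Qed.

Lemma lift_equivariant (h : EG G -> EG G) (F : nebula Q -> EG G) (f : X -> BG G) :
  @dsmooth R (EG G) (EG G) h -> (forall e a, h (EG_act e a) = EG_act (h e) a) -> Lifts f c F ->
  exists f' : smap X (BG G), Lifts f' c (h \o F).
Proof.
move=> hs hE [Fs _ FE]; apply: lift_base; first exact: dsmooth_comp Fs hs.
by move=> v v' E /=; rewrite (FE v v' E) hE.
Qed.

(** The chain of segments is [F], [refineE F], [spreadE false F], [spreadE true
    F'], [refineE F'], [F']. Concatenation of homotopies is avoided, as
    homotopy classes are those of the generated equivalence relation. *)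
Lemma classified_homotopic (f f' : smap X (BG G)) :
  classified f c -> classified f' c ->
  qclass (@smooth_homotopic _ X (BG G)) f = qclass (@smooth_homotopic _ X (BG G)) f'.
Proof.
move=> [F LF] [F' LF'].
have chain eps (k : smap X (BG G)) K : Lifts k c K -> exists2 k' : smap X (BG G),
    Lifts k' c (spreadE eps \o K) &
    qclass (@smooth_homotopic _ X (BG G)) k = qclass (@smooth_homotopic _ X (BG G)) k'.
  move=> LK; have [k1 L1] := lift_equivariant dsmooth_refineE refineE_act LK.
  have [k2 L2] := lift_equivariant (dsmooth_spreadE eps) (spreadE_act eps) LK.
  have [Ks _ _] := LK; exists k2 => //; apply/qclassP; apply: (@rst_trans _ _ _ k1).
    apply: rst_step; apply: (compatible_homotopic LK L1).
    exact: (compatible_comp Ks compatible_refineE).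
  apply: rst_step; apply: (compatible_homotopic L1 L2).
  exact: (compatible_comp Ks (compatible_spreadE eps)).
have [k0 L0 ->] := chain false f F LF; have [k1 L1 ->] := chain true f' F' LF'.
apply/qclassP/rst_step/(compatible_homotopic L0 L1).
by apply: compatible_parity; [case: LF|case: LF'].
Qed.

End Uniqueness.

End Slots.

(** * The principal bundle of a cocycle *)

Lemma plot_qclass {R : realType} (X : diffSpace R) (E : X -> X -> Prop) (U : edom R)
    (s : U -> X) : plot s -> @plot R (quotSpace E) U (fun u => qclass E (s u)).
Proof. by move=> ps u; apply: locally_self; exists s. Qed.

Section CocycleBundle.
Context {R : realType} {G : diffGroup R} {X : diffSpace R} {Q : genFamily X}.
Variable c : cocycle G Q 1.
Implicit Types (U W : edom R).

(** An equivalence relation, by the cocycle identity; see [bptP]. *)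
Definition bundle_rel (z z' : prodSpace (nebula Q) G) : Prop :=
  ev z.1 = ev z'.1 /\ z.2 = (c2 c z.1 z'.1 * z'.2)%g.

Definition bundle_total : diffSpace R := quotSpace bundle_rel.

Definition bpt (v : nebula Q) (g : G) : bundle_total := qclass bundle_rel (v, g).

Lemma bptP v g v' g' : bpt v g = bpt v' g' <->
  ev v = ev v' /\ g = (c2 c v v' * g')%g.
Proof.
split=> [/qclassP|H]; last by apply/qclassP/rst_step.
suff K z z' : clos_refl_sym_trans _ bundle_rel z z' -> bundle_rel z z' by move=> /K.
elim=> {z z'} [//|z|z z' _ [E1 E2]|z z' z'' _ [E1 E2] _ [E3 E4]].
- by split=> //; rewrite c2_id mul1g.
- split=> //; rewrite E2 mulgA -(c2_cocycle c (esym E1) E1) c2_id mul1g //.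
- by split; [rewrite E1|rewrite E2 E4 mulgA -(c2_cocycle c E1 E3)].
Qed.

Lemma bpt_surj (e : bundle_total) : bpt (qrepr e).1 (qrepr e).2 = e.
Proof. by rewrite /bpt -surjective_pairing qclass_qrepr. Qed.

Lemma bundle_act_rel (a : G) z z' : bundle_rel z z' ->
  bundle_rel (z.1, (z.2 * a)%g) (z'.1, (z'.2 * a)%g).
Proof. by move=> [E1 E2]; split=> //=; rewrite E2 mulgA. Qed.

Definition bundle_act (e : bundle_total) (a : G) : bundle_total :=
  qmap (@bundle_act_rel a) e.

Lemma bundle_actE v g a : bundle_act (bpt v g) a = bpt v (g * a)%g.
Proof. by rewrite /bundle_act /bpt qmapE. Qed.

Definition bundle_proj (e : bundle_total) : X := ev (qrepr e).1.

Lemma bundle_projE v g : bundle_proj (bpt v g) = ev v.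
Proof. by have /bptP[] := bpt_surj (bpt v g). Qed.

Lemma bundle_plot_rect U (p : U -> bundle_total) (Y : diffSpace R) (r : U -> Y) : plot p ->
  (forall W (j : W -> U) (a : W -> nebula Q) (g : W -> G), edom_smooth j -> plot a -> plot g ->
    (forall w, p (j w) = bpt (a w) (g w)) -> plot (r \o j)) ->
  plot r.
Proof.
move=> pp H; apply: (plot_quot_rect pp) => W j s js [s1 s2] sE.
by apply: (H W j _ _ js s1 s2) => w; rewrite sE /bpt -surjective_pairing.
Qed.

Lemma plot_bpt U (a : U -> nebula Q) (g : U -> G) : plot a -> plot g ->
  @plot R bundle_total U (fun u => bpt (a u) (g u)).
Proof. by move=> pa pg; apply: (@plot_qclass _ (prodSpace (nebula Q) G)). Qed.

Lemma bundle_act_smooth : @dsmooth R (prodSpace bundle_total G) bundle_total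
  (fun eg => bundle_act eg.1 eg.2).
Proof.
move=> U p [p1 p2]; apply: (bundle_plot_rect p1) => W j a g js pa pg pE.
rewrite (_ : _ \o _ = fun w => bpt (a w) (g w * (p (j w)).2)%g).
  by apply: plot_bpt => //; apply: plot_mulg => //; exact: plots_comp p2 js.
by apply/funext => w /=; have /= -> := pE w; rewrite bundle_actE.
Qed.

Lemma bundle_act1 e : bundle_act e 1%g = e.
Proof. by rewrite -(bpt_surj e) bundle_actE mulg1. Qed.

Lemma bundle_actM e g h : bundle_act (bundle_act e g) h = bundle_act e (g * h)%g.
Proof. by rewrite -(bpt_surj e) !bundle_actE mulgA. Qed.

Lemma bundle_proj_smooth : dsmooth bundle_proj.
Proof.
move=> U p pp; apply: (bundle_plot_rect pp) => W j a g js pa pg pE.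
rewrite (_ : _ \o _ = @ev R X Q \o a); first exact: dsmooth_ev.
by apply/funext => w /=; rewrite pE bundle_projE.
Qed.

Lemma bundle_proj_act e g : bundle_proj (bundle_act e g) = bundle_proj e.
Proof. by rewrite -(bpt_surj e) bundle_actE !bundle_projE. Qed.

Definition bundle : Gspace G X := @GSpace R G X bundle_total bundle_act bundle_proj
  bundle_act_smooth bundle_act1 bundle_actM bundle_proj_smooth bundle_proj_act.

Lemma bundle_fibre (e e' : bundle_total) :
  bundle_proj e = bundle_proj e' <-> exists g, e' = bundle_act e g.
Proof.
split=> [|[g ->]]; last by rewrite bundle_proj_act.
rewrite -(bpt_surj e) -(bpt_surj e') !bundle_projE.
move: (qrepr e).1 (qrepr e').1 (qrepr e).2 (qrepr e').2 => v v' a a' E.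
exists (a^-1 * (c2 c v v' * a'))%g; rewrite bundle_actE !mulgA mulgV mul1g -?mulgA.
by apply/esym/bptP.
Qed.

(** Locally on plots, [bpt] parametrizes the total space by the nebula and [G];
    the division map is [g^-1 * c2 c a a' * g'] in these coordinates. *)
Lemma bundle_principal : principal bundle.
Proof.
split; [split| |].
- move=> x; have [v vx] := ev_surj Q x; by exists (bpt v 1%g); rewrite /= bundle_projE.
- move=> U p; split=> [pp|H].
    move=> u; have [W [oW [WU [Wu [q Qq [f fs fE]]]]]] := @gfamP _ _ Q U p pp u.
    exists W, oW, WU; split=> //; pose q' : Q := SigSub (mem_set Qq).
    exists (fun w => bpt (existT _ q' (f w)) 1%g).
      apply: plot_bpt; first exact: (@plot_nebula _ _ Q q').
      exact: (plots_cst (dstruct (G : diffSpace R))).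
    by apply/funext => w /=; rewrite bundle_projE /ev /=; have /funeqP/(_ w) := fE.
  apply: plots_local => u; apply: locally_mono (H u) => W j [s sp ->].
  exact: bundle_proj_smooth.
- exact: bundle_fibre.
split.
  move=> U p [p1 p2]; split=> //=; exact: (bundle_act_smooth (conj p1 p2)).
have inv (z : subSpace (@fiber_square R G X bundle)) :
    exists g, (\val z).2 = bundle_act (\val z).1 g.
  by apply/bundle_fibre; exact: (set_valP z).
have free e g g' : bundle_act e g = bundle_act e g' -> g = g'.
  rewrite -(bpt_surj e) !bundle_actE => /bptP[_]; rewrite c2_id mul1g; exact: mulgI.
exists (fun z => ((\val z).1, projT1 (cid (inv z)))); split.
- move=> U p [p1 p2]; split=> //=.
  apply: (bundle_plot_rect p1) => W j a g js pa pg pE.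
  have p2j := plots_comp p2 js.
  apply: (bundle_plot_rect p2j) => W' j' a' g' j's pa' pg' p'E.
  have E w : ev (a (j' w)) = ev (a' w).
    have := set_valP (p (j (j' w))); rewrite /fiber_square /=.
    have /= -> := pE (j' w); have /= -> := p'E w; by rewrite !bundle_projE.
  rewrite (_ : _ \o _ = fun w => ((g (j' w))^-1 * (c2 c (a (j' w)) (a' w) * g' w))%g).
    apply: plot_mulg; first by apply: plot_invg; exact: plots_comp pg j's.
    apply: plot_mulg => //; apply: plot_c2 => //; first exact: smapP.
    exact: plots_comp pa j's.
  apply/funext => w /=; case: cid => b /= bE.
  apply: (free (\val (p (j (j' w)))).1); rewrite -bE.
  have /= -> := pE (j' w); have /= -> := p'E w.
  rewrite bundle_actE !mulgA mulgV mul1g.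
  by apply/esym/bptP; split; first exact: E.
- move=> [e g] /=; congr pair; case: cid => b /= bE.
  exact/esym/(free _ _ _ bE).
- move=> z; apply: val_inj => /=; case: cid => b /= bE.
  by rewrite [RHS]surjective_pairing -bE.
Qed.

Section Trivialization.
Variable V : set X.
Hypothesis triv : trivializable (restrict_bundle bundle V).

(** The value at [bpt v 1] of a trivialization over [V] is a 0-cochain whose
    coboundary is [c] over [V]. *)
Lemma trivialization : exists h : nebula Q -> G,
  (forall U (a : U -> nebula Q), plot a -> (forall u, V (ev (a u))) -> plot (h \o a)) /\
  (forall v v', ev v = ev v' -> V (ev v) -> h v' = (h v * c2 c v v')%g).
Proof.
have [Phi [[Phis _] Phi1 PhiE]] := triv.
have Vp (v : nebula Q) (g : G) : V (ev v) -> (@Defs.proj R G X bundle @^-1` V) (bpt v g).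
  by move=> Vv; rewrite /preimage /= bundle_projE.
pose pt (v : nebula Q) (g : G) (H : V (ev v)) :
    Defs.total (restrict_bundle bundle V) := SigSub (mem_set (Vp v g H)).
exists (fun v => if pselect (V (ev v)) is left H then (Phi (pt v 1%g H)).2 else 1%g); split.
  move=> U a pa Va.
  rewrite (_ : _ \o _ = fun u => (Phi (pt (a u) 1%g (Va u))).2).
    have pp : @plot R (Defs.total (restrict_bundle bundle V)) U (fun u => pt (a u) 1%g (Va u)).
      apply: plot_bpt => //; exact: (plots_cst (dstruct (G : diffSpace R))).
    by have [_] := Phis U _ pp.
  apply/funext => u /=; case: pselect => [H|//].
  by congr (Phi _).2; exact: val_inj.
move=> v v' E Vv; case: pselect => [Vv'|]; last by rewrite -E.
case: pselect => [Vv0|//].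
have -> : pt v' 1%g Vv' = action (pt v 1%g Vv0) (c2 c v v').
  apply: val_inj => /=; rewrite bundle_actE mul1g; apply/bptP; split=> //.
  by rewrite -(c2_cocycle c (esym E) E) c2_id.
by rewrite PhiE.
Qed.

End Trivialization.

End CocycleBundle.

(** * From a partition of unity to countably many slots *)

Section CountablePartition.
Context {R : realType}.

(** The scale of the [m]-th slot. *)
Definition eps (m : nat) : R := m.+1%:R^-1.

Lemma eps_gt0 m : 0 < eps m. Proof. by rewrite invr_gt0 ltr0n. Qed.
Lemma eps_le1 m : eps m <= 1. Proof. by rewrite invf_le1 ?ltr0n // ler1n. Qed.

(** Half of the value that a single index contributes at least to [small] when
    [z i] lies between [eps m] and [2 * eps m]. *)
Definition gap (m : nat) : R := eps m * flat 0 (eps m) / 2.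

Lemma gap_gt0 m : 0 < gap m.
Proof. by rewrite /gap divr_gt0 // mulr_gt0 ?flat_gt0 // eps_gt0. Qed.

Context {I : choiceType}.
Implicit Types z : I -> R.

(** Measures the mass of the indices with [0 < z i < 3 * eps m]. When it is at
    most [gap m], no value lies between [eps m] and [2 * eps m] ([small_gap])
    and some value lies above ([small_large]); it vanishes for large [m]. *)
Definition small m z : R := \sum_(i \in [set: I]) z i * flat 0 (3 * eps m - z i).

(** The threshold lies inside the interval avoided by the values of [z]; so
    this set is locally constant where [small] is at most [gap]. *)
Definition large m z : set I := [set i | 3 / 2 * eps m < z i].

Section Pointwise.
Variables (m : nat) (z : I -> R) (r : seq I).
Hypotheses (ur : uniq r) (z0 : forall i, i \notin r -> z i = 0)
  (zge0 : forall i, 0 <= z i) (z1 : \sum_(i \in [set: I]) z i = 1).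

Let term_ge0 i : 0 <= z i * flat 0 (3 * eps m - z i).
Proof. by rewrite mulr_ge0 ?flat_ge0. Qed.

Let term0 i : i \notin r -> z i * flat 0 (3 * eps m - z i) = 0.
Proof. by move=> /z0 ->; rewrite mul0r. Qed.

Lemma small_gap i : small m z <= gap m -> z i < eps m \/ 2 * eps m < z i.
Proof.
move=> sg; have [|ze] := ltrP (z i) (eps m); first by left.
have [|ze2] := ltrP (2 * eps m) (z i); first by right.
have e0 := eps_gt0 m; have f0 := flat_gt0 0 e0.
have H : z i * flat 0 (3 * eps m - z i) <= gap m.
  exact: (le_trans (fsum_ge i ur term0 term_ge0) sg).
have : eps m * flat 0 (eps m) <= z i * flat 0 (3 * eps m - z i).
  by rewrite ler_pM ?flat_ge0 ?(ltW e0) // flat0_mono //; lra.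
move=> /le_trans/(_ H); rewrite /gap => K.
suff : 0 < eps m * flat 0 (eps m) by lra.
exact: mulr_gt0.
Qed.

Lemma small_large : small m z <= gap m -> exists i, 2 * eps m < z i.
Proof.
move=> sg; apply: contrapT => /forallNP H.
have ze i : z i < eps m by have [//|/H] := small_gap i sg.
have e0 := eps_gt0 m; have f0 := flat_gt0 0 e0.
have : flat 0 (eps m) <= small m z.
  rewrite /small (fsumE ur term0).
  apply: (@le_trans _ _ ((\sum_(i <- r) z i) * flat 0 (eps m))).
    by rewrite -(fsumE ur z0) z1 mul1r.
  rewrite mulr_suml.
  apply: ler_sum => i _; apply: ler_wpM2l => //; apply: flat0_mono.
  have := ze i; lra.
move=> /le_trans/(_ sg); rewrite /gap.
suff : eps m * flat 0 (eps m) <= flat 0 (eps m) by lra.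
by rewrite ler_piMl ?eps_le1 // ltW.
Qed.

End Pointwise.

Definition wave z (m : nat) : R := flat 0 (gap m - small m z).

Lemma wave_gt0P z m : 0 < wave z m -> small m z <= gap m.
Proof.
move=> w0; rewrite leNgt; apply/negP => H; move: w0.
by rewrite /wave flat_le0 ?ltxx // subr_le0 ltW.
Qed.

(** Some scale is below a third of all the nonzero values of [z], which are
    finite in number; there [small] vanishes. *)
Lemma wave_adm z (r : seq I) : uniq r -> (forall i, i \notin r -> z i = 0) ->
  (forall i, 0 <= z i) -> admissible (wave z).
Proof.
move=> ur z0 zge0; split=> [m|]; first by rewrite flat_ge0 flat0_le1.
(* [S] is at least [3 / z i] for each nonzero value, so that [3 * eps m] is
   below every nonzero value once [m] is at least [S]. *)
pose S := \sum_(i <- r) 3 / z i.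
have S0 i : 0 <= 3 / z i by rewrite divr_ge0.
exists (Num.bound S); rewrite /wave flat_gt0 // subr_gt0.
rewrite /small fsbig1 ?gap_gt0 // => i _.
have [->|zi] := eqVneq (z i) 0; first by rewrite mul0r.
have zi0 : 0 < z i by rewrite lt0r zi zge0.
rewrite flat_le0 ?mulr0 // subr_le0 /eps ler_pdivrMr ?ltr0n // -ler_pdivrMl //.
have ir : i \in r by apply: contraNT zi => /z0 ->.
rewrite mulrC (@le_trans _ _ S) //; first by rewrite /S (big_rem i ir) /= lerDl sumr_ge0.
by rewrite (@le_trans _ _ (Num.bound S)%:R) ?ler_nat // ltW // archi_boundP // sumr_ge0.
Qed.

End CountablePartition.

Section Classifying.
Context {R : realType} {G : diffGroup R} {X : diffSpace R} {Q : genFamily X}.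
Variable c : cocycle G Q 1.

Lemma nb_D_open (U : edom R) (p : U -> X) (u : U) (A : set X) :
  plot p -> D_open A -> A (p u) -> nb u [set w | A (p w)].
Proof.
move=> pp oA Au; have oB := oA U p pp.
have : nbhs (\val u) (\val @` (p @^-1` A)) by apply: open_nbhs_nbhs; split=> //; exists u.
apply: (@filterS _ (nbhs (\val u))) => y [w Aw <-] w' /val_inj ->; exact: Aw.
Qed.

Lemma partition_locfin (I : choiceType) (V : I -> set X) (zeta : I -> smap X (realSpace R)) :
  partition_of_unity V zeta -> locfin (fun i x => zeta i x : R).
Proof.
move=> [_ _ lf _] U p pp u; have [W [oW Wu fW]] := lf (p u).
have /finite_seqP[r rE] := fW; exists (undup r); first exact: undup_uniq.
apply: filterS (nb_D_open pp oW Wu) => w Ww i; rewrite mem_undup => ir.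
apply: contrapT => zi; move/negP: ir; apply.
have : [set i | W `&` D_support (zeta i) !=set0] i.
  by exists (p w); split=> // C [_]; apply.
by rewrite rE.
Qed.

(** The [m]-th weight comes from [wave], refined to be locally finite, and the
    [m]-th group component from the trivialization over the member of the cover
    selected in [large m]. Smoothness uses that this member is locally constant
    where the weight is nonzero; elsewhere the component is irrelevant. *)
Theorem cocycle_classified : D_numerable (bundle c) ->
  exists f : smap X (BG G), classified f c.
Proof.
move=> [I [V [zeta [oV cV triv pou]]]].
have lf := partition_locfin pou; have [zge0 sV _ z1] := pou.
have zV i x : 0 < (zeta i x : R) -> V i x.
  by move=> z0; apply: sV => C [_]; apply; apply/eqP; rewrite gt_eqF.
pose h i := projT1 (cid (trivialization (triv i))).
have hP i := projT2 (cid (trivialization (triv i))).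
pose z x i : R := zeta i x.
have fin x := locfin_pt x lf.
have adm x : admissible (wave (z x)).
  by have [r ur zr] := fin x; exact: (wave_adm ur zr (zge0^~ x)).
have sm_zeta i : sm (fun x => z x i) by exact: (@smapP _ _ _ (zeta i)).
have sm_small m : sm (fun x => small m (z x)).
  apply: (sm_fsum (F := fun i x => z x i * flat 0 (3 * eps m - z x i))).
    by move=> i; apply: smM => //; apply: sm_flat; apply: smB => //; exact: sm_cst.
  by apply: locfin_sub lf => i x zi; rewrite /z zi mul0r.
have sm_wave m : sm (fun x => wave (z x) m).
  by apply: sm_flat; apply: smB => //; exact: sm_cst.
(* A choice function of the set itself, so that a locally constant set has a
   locally constant selected element. *)
pose sel (A : set I) : option I :=
  if pselect (exists i, A i) is left H then Some (projT1 (cid H)) else None.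
have selP A i : sel A = Some i -> A i.
  by rewrite /sel; case: pselect => // H [<-]; exact: projT2 (cid H).
have selN (A : set I) i : A i -> sel A <> None.
  by rewrite /sel => Ai; case: pselect => // H _; apply: H; exists i.
pose g m v := if sel (large m (z (ev v))) is Some i then h i v else 1%g.
have largeV m x i : large m (z x) i -> V i x.
  move=> li; apply: zV; apply: lt_trans li; have := @eps_gt0 R m; lra.
have nonempty m x : small m (z x) <= gap m -> exists i, sel (large m (z x)) = Some i.
  move=> sg; have [r ur zr] := fin x.
  have [i zi] := small_large ur zr (zge0^~ x) (z1 x) sg.
  case E : (sel _) => [k|]; first by exists k.
  exfalso; apply: selN E; rewrite /large /=; apply: lt_trans zi; have := @eps_gt0 R m; lra.
pose Hw (v : nebula Q) := weights_refine (adm (ev v)).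
pose F v := mk (g^~ v) (Hw v).
have wave_small x m : refine (wave (z x)) m <> 0 -> small m (z x) <= gap m.
  by move=> /eqP/(refine_neq0 (adm x))/wave_gt0P.
have FE v v' : ev v = ev v' -> F v' = EG_act (F v) (c2 c v v').
  move=> E; rewrite EG_act_mk; apply/mk_eqP; rewrite -E; split=> // m /wave_small sg.
  have [i si] := nonempty _ _ sg; rewrite /g -E si.
  exact: (hP i).2 _ _ E (largeV m _ _ (selP _ _ si)).
have Fs : dsmooth F.
  move=> U a pa; have px : plot (fun u => ev (a u)) by exact: dsmooth_ev pa.
  have lfr := locfin_refine sm_wave adm.
  apply: plot_near => u0; set x0 := ev (a u0).
  have [r ur nr] := lf _ _ px u0; have [r' _ nr'] := lfr _ _ px u0.
  (* The slots that may be used near [u0]. A slot that is not alive at [u0] has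
     weight zero nearby. *)
  pose alive m := small m (z x0) <= gap m.
  pose near_ok m u := if alive m then large m (z (ev (a u))) = large m (z x0)
                      else gap m < small m (z (ev (a u))).
  have Hok : nb u0 [set u | forall m, m \in r' -> near_ok m u].
    apply: (@nb_all_in _ _ _ _ _ (fun m u => near_ok m u)) => m _; rewrite /near_ok.
    case: (boolP (alive m)) => am; last first.
      by apply: (nb_gt (sm_small m _ _ px)); rewrite ltNge.
    (* The finitely many indices of [r] stay on the same side of the gap. *)
    have side : nb u0 [set u | forall i, i \in r ->
        if z x0 i < eps m then z (ev (a u)) i < eps m else 2 * eps m < z (ev (a u)) i].
      apply: (@nb_all_in _ _ _ _ _ (fun i u =>
        if z x0 i < eps m then z (ev (a u)) i < eps m else 2 * eps m < z (ev (a u)) i)) => i _.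
      case: (boolP (z x0 i < eps m)) => zi; first exact: (nb_lt (sm_zeta i _ _ px)).
      apply: (nb_gt (sm_zeta i _ _ px)).
      have [q uq zq] := fin x0; have [|//] := small_gap uq zq (zge0^~ x0) i am.
      by move=> zi'; rewrite zi' in zi.
    have zu0 := nb_self nr; apply: filterS2 nr side => u zu su; apply/seteqP.
    have e0 := @eps_gt0 R m.
    have out i : i \notin r -> ~ large m (z (ev (a u))) i /\ ~ large m (z x0) i.
      by move=> ir; rewrite /large /= /z (zu i ir) (zu0 i ir); split; apply/negP; rewrite -leNgt; lra.
    have inn i : i \in r -> large m (z (ev (a u))) i <-> large m (z x0) i.
      move=> ir; have := su i ir; rewrite /large /=; case: ifPn => zi zi'.
        by split=> H; exfalso; move: H; apply/negP; rewrite -leNgt; lra.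
      have [q uq zq] := fin x0; have [zi2|zi2] := small_gap uq zq (zge0^~ x0) i am.
        by rewrite zi2 in zi.
      by rewrite -[zeta i x0 : R]/(z x0 i) in zi2; split=> _; lra.
    split=> i; have [ir|ir] := boolP (i \in r).
    - by move=> /(inn i ir).
    - by move=> li; have [/(_ li)] := out i ir.
    - by move=> /(inn i ir).
    - by move=> li; have [_ /(_ li)] := out i ir.
  exists [set u | (forall m, m \notin r' -> refine (wave (z (ev (a u)))) m = 0) /\
                  (forall m, m \in r' -> near_ok m u)].
    exact: filterI nr' Hok.
  move=> W j js Hj; pose use m := (m \in r') && alive m.
  pose g' w m := if use m then g m (a (j w)) else 1%g.
  have paj := plots_comp pa js; have pxj := plots_comp px js.
  rewrite (_ : F \o a \o j = fun w => mk (g' w) (Hw (a (j w)))).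
    apply: plot_mk => m; first exact: (sm_refine sm_wave adm m pxj).
    rewrite /g'; case: (boolP (use m)) => [/andP[mr am]|_]; last first.
      exact: (plots_cst (dstruct (G : diffSpace R))).
    have [i si] := nonempty _ _ am.
    have Lw w : large m (z (ev (a (j w)))) = large m (z x0).
      by have [_ /(_ m mr)] := Hj w; rewrite /near_ok am.
    rewrite (_ : (fun w => _) = h i \o (a \o j)).
      apply: (hP i).1 => // w; apply: (largeV m); rewrite /= Lw; exact: selP si.
    by apply/funext => w; rewrite /g /= Lw si.
  apply/funext => w /=; apply/mk_eqP; split=> // m rm; rewrite /g' /use.
  have [Z K] := Hj w.
  have [mr|/Z//] := boolP (m \in r'); case: (boolP (alive m)) => //= am.
  exfalso; have := K m mr; rewrite /near_ok (negbTE am) ltNge.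
  by rewrite (wave_small _ _ rm).
have [f Lf] := lift_base Fs FE.
by exists f, F.
Qed.

End Classifying.

(** * Uniform control of the weights along a homotopy *)

Section StepSize.
Context {R : realType} {G : diffGroup R} {X : diffSpace R}.
Local Notation XR := (prodSpace X (realSpace R)).

Let adm_tB (b : BG G) : admissible (tB b). Proof. exact/weights_adm/weights_tE. Qed.

(** Refined weights form a locally finite partition of unity on [BG] by smooth
    functions; the [j]-th is positive only where transport in slot [j] is
    possible ([bump_gt0]). *)
Definition bump (j : nat) (b : BG G) : R := refine (tB b) j.

Lemma sm_bump j : sm (bump j).
Proof. exact: (@sm_refine _ _ (fun m b => tB b m) (@sm_tB R G) adm_tB). Qed.

Lemma locfin_bump : @locfin R (BG G) nat bump.
Proof. exact: (@locfin_refine _ _ (fun m b => tB b m) (@sm_tB R G) adm_tB). Qed.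

Lemma bump_ge0 j b : 0 <= bump j b. Proof. exact: refine_ge0. Qed.

Lemma bump_sum b : \sum_(j \in [set: nat]) bump j b = 1. Proof. exact: refine_sum. Qed.

Lemma bump_gt0 j b : 0 < bump j b -> tB b j <> 0.
Proof. by move=> b0; apply/eqP/lt0r_neq0/(refine_neq0 (adm_tB b)); rewrite gt_eqF. Qed.

Variable K : XR -> BG G.
Hypothesis Ks : dsmooth K.
Hypothesis K1 : forall x s, 1 <= s -> K (x, s) = K (x, 1).

Let beta j (z : XR) : R := bump j (K z).

Let sm_beta j : sm (beta j). Proof. exact: sm_comp Ks (sm_bump j). Qed.
Let lf_beta : locfin beta. Proof. exact: locfin_comp Ks locfin_bump. Qed.

(** The sum [q] of the squares of the bumps is positive, and some bump is at
    least [q] because the bumps have sum 1; a majorant of [q^-1] bounds [q]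
    from below uniformly in time. The hypothesis [K1] extends the bound to all
    nonnegative times. *)
Lemma threshold : exists kappa : X -> R, [/\ sm kappa, forall x, 0 < kappa x &
  forall x (s : R), 0 <= s -> exists j, kappa x <= beta j (x, s)].
Proof.
pose q (z : XR) : R := \sum_(j \in [set: nat]) (beta j z * beta j z).
have sq : sm q.
  apply: (sm_fsum (F := fun j z => beta j z * beta j z)); first by move=> j; exact: smM.
  by apply: locfin_sub lf_beta => j z ->; rewrite mul0r.
have q0 z : 0 < q z.
  have [j bj] := refine_gt0 (adm_tB (K z)); have [r ur zr] := locfin_pt z lf_beta.
  apply: (fsum_gt0 (r := r) (i := j)) => //.
  - by move=> i /zr ->; rewrite mul0r.
  - by move=> i; rewrite mulr_ge0 ?bump_ge0.
  - exact: mulr_gt0.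
have sq' : sm (fun z => (q z)^-1) by apply: smV => // z; rewrite gt_eqF.
have [M sM Mq] := majorant sq'.
have M0 x : 0 < M x.
  have := Mq x 0; rewrite in_itv /= lexx ler01 => /(_ isT); apply: lt_le_trans.
  by rewrite normr_gt0 invr_neq0 // gt_eqF.
exists (fun x => (2 * M x)^-1); split.
- apply: smV; first by apply: smM => //; exact: sm_cst.
  by move=> x; rewrite mulf_neq0 // gt_eqF.
- by move=> x; rewrite invr_gt0 mulr_gt0.
move=> x s s0; wlog s1 : s s0 / s <= 1.
  move=> H; have [s1|s1] := leP s 1; first exact: H.
  by have [j] := H 1 ler01 (lexx 1); exists j; rewrite /beta K1 // ltW.
set k := (2 * M x)^-1; have k0 : 0 < k by rewrite invr_gt0 mulr_gt0.
apply: contrapT => /forallNP H.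
have bk j : beta j (x, s) <= k by rewrite ltW // ltNge; apply/negP/H.
have [r ur zr] := locfin_pt ((x, s) : XR) lf_beta.
have : q (x, s) <= k.
  rewrite /q (fsumE ur); last by move=> i /zr ->; rewrite mul0r.
  rewrite -[leRHS]mulr1 -(bump_sum (K (x, s))) (fsumE ur zr) mulr_sumr.
  by apply: ler_sum => i _; apply: ler_wpM2r => //; exact: bump_ge0.
have : 2 * k <= q (x, s).
  rewrite /k invfM mulrA mulfV ?mul1r // -[leRHS]invrK lef_pV2 ?posrE ?invr_gt0 //.
  have := Mq x s; rewrite in_itv /= s0 s1 => /(_ isT).
  by rewrite gtr0_norm // invr_gt0.
lra.
Qed.

Let E (z : prodSpace XR (realSpace R)) : R :=
  \sum_(j \in [set: nat]) ((beta j z.1 - beta j (z.1.1, z.2)) ^+ 2).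

Let lf_E : locfin (fun j (z : prodSpace XR (realSpace R)) =>
  (beta j z.1 - beta j (z.1.1, z.2)) ^+ 2).
Proof.
move=> U p [p1 p2] u; have [r1 _ n1] := lf_beta p1 u.
have p3 : @plot R XR U (fun u => ((p u).1.1, (p u).2)) by split=> //; exact: p1.1.
have [r2 _ n2] := lf_beta p3 u; exists (undup (r1 ++ r2)); first exact: undup_uniq.
apply: filterS2 n1 n2 => w H1 H2 j.
rewrite mem_undup mem_cat negb_or => /andP[j1 j2].
by have /= -> := H1 j j1; have /= -> := H2 j j2; rewrite subrr expr0n.
Qed.

Let sm_E : sm E.
Proof.
apply: (sm_fsum _ lf_E) => j.
have s1 : sm (fun z : prodSpace XR (realSpace R) => beta j z.1).
  by move=> U p [p1 p2]; exact: (sm_beta j p1).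
have s2 : sm (fun z : prodSpace XR (realSpace R) => beta j (z.1.1, z.2)).
  move=> U p [p1 p2]; apply: (sm_beta j (p := fun u => ((p u).1.1, (p u).2))).
  by split=> //; exact: p1.1.
have s12 : sm (fun z : prodSpace XR (realSpace R) => beta j z.1 - beta j (z.1.1, z.2)).
  exact: smB.
exact: (smM s12).
Qed.

(** The function [E] sums over all slots the squared variation between two
    times. It is locally finite, hence smooth, and vanishes on the diagonal, so
    that the mean value theorem and a majorant in both times apply to all slots
    at once. *)
Lemma modulus : exists M : X -> R, [/\ sm M, forall x, 0 <= M x &
  forall x (s s' : R) j, 0 <= s -> 0 <= s' ->
    (beta j (x, s) - beta j (x, s')) ^+ 2 <= M x * `|s - s'|].
Proof.
have [N sN NE] := majorant (sm_dtime sm_E); have [M sM MN] := majorant sN.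
have M0 x : 0 <= M x.
  have := MN x 0; rewrite in_itv /= lexx ler01 => /(_ isT); apply: le_trans.
  exact: normr_ge0.
exists M; split=> // x s s' j; wlog ss' : s s' / s <= s'.
  move=> H s0 s0'; have [|/ltW] := leP s s'; first by move=> ?; exact: H.
  by move=> /H/(_ s0' s0); rewrite -sqrrN opprB distrC.
move=> s0 s0'; wlog s1 : s s' ss' s0 s0' / s' <= 1.
  move=> H; have [s1|s1] := leP s' 1; first exact: H.
  have [s2|s2] := leP s 1; last first.
    by rewrite /beta !K1 ?(ltW s1) ?(ltW s2) // subrr expr0n mulr_ge0.
  have := H s 1 s2 s0 ler01 (lexx 1); rewrite /beta (K1 x (ltW s1)) => H'.
  apply: (le_trans H'); apply: ler_wpM2l => //.
  rewrite !ler0_norm ?subr_le0 // !opprB; lra.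
have [r ur zr] := locfin_pt (((x, s), s') : prodSpace XR (realSpace R)) lf_E.
apply: (@le_trans _ _ (E ((x, s), s'))).
  apply: (fsum_ge (F := fun j => (beta j (x, s) - beta j (x, s')) ^+ 2) j ur zr).
  by move=> i; exact: sqr_ge0.
have E0 : E ((x, s), s) = 0 by apply: fsbig1 => i _; rewrite /= subrr expr0n.
have cE0 (t : R) : {for t, continuous (fun t : R => E ((x, s), t))}.
  by have := @continuous_time R XR E ((x, s) : XR) t sm_E.
have cE : {within `[s, s'], continuous (fun t : R => E ((x, s), t))}.
  by apply: continuous_in_subspaceT => t _; exact: cE0.
have dE (t : R) : t \in `]s, s'[ ->
    is_derive t 1 (fun t : R => E ((x, s), t)) (dtime E ((x, s), t)).
  by move=> _; exact: is_derive_dtime.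
have [t] := MVT_segment ss' dE cE; rewrite E0 subr0 in_itv /= => /andP[st ts'] ->.
have sp : 0 <= s' - s by rewrite subr_ge0.
rewrite distrC (ger0_norm sp); apply: ler_wpM2r => //.
have t01 : t \in `[0, 1] by rewrite in_itv /= (le_trans s0 st) (le_trans ts' s1).
have s01 : s \in `[0, 1] by rewrite in_itv /= s0 (le_trans ss' s1).
apply: (le_trans (ler_norm _)); apply: (le_trans (NE (x, s) t t01)).
exact: (le_trans (ler_norm _) (MN x s s01)).
Qed.

(** Over a duration [delta], a squared bump difference is at most [M * delta],
    which the choice of [delta] makes at most [kappa ^ 2 / 16]. *)
Lemma step_size : exists kappa delta : X -> R,
  [/\ sm kappa /\ sm delta, forall x, 0 < kappa x /\ 0 < delta x,
      forall x (s : R), 0 <= s -> exists j, kappa x <= bump j (K (x, s)) &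
      forall x (s s' : R) j, 0 <= s -> 0 <= s' -> `|s - s'| <= delta x ->
        `|bump j (K (x, s)) - bump j (K (x, s'))| <= kappa x / 4].
Proof.
have [kappa [sk k0 kP]] := threshold; have [M [sM M0 MP]] := modulus.
have M1 x : 0 < 16 * (1 + M x) by rewrite mulr_gt0 // ltr_wpDr.
exists kappa, (fun x => kappa x * kappa x / (16 * (1 + M x))); split.
- split=> //; apply: sm_div; first exact: smM.
    by apply: smM; [exact: sm_cst|apply: smD => //; exact: sm_cst].
  by move=> x; rewrite gt_eqF.
- by move=> x; split=> //; rewrite divr_gt0 // mulr_gt0.
- exact: kP.
move=> x s s' j s0 s0'; rewrite ler_pdivlMr // => H.
have := MP x s s' j s0 s0'; rewrite /beta => H2.
rewrite -(@ler_pXn2r _ 2) ?nnegrE ?divr_ge0 ?(ltW (k0 x)) //.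
rewrite real_normK ?num_real //; apply: (le_trans H2).
have a0 : 0 <= `|s - s'| := normr_ge0 _.
rewrite expr_div_n expr2; move: H (M0 x) a0; move: (kappa x * kappa x) (M x) `|s - s'|.
by move=> k m d; nra.
Qed.

End StepSize.

(** * Transport of lifts and homotopy invariance *)

Section Transport.
Context {R : realType} {G : diffGroup R} {X : diffSpace R} {Q : genFamily X}.
Variable c : cocycle G Q 1.
Implicit Types (b : X -> BG G) (A : set X) (U : edom R).

(** The lift is unchanged over [A]; this is what lets infinitely many
    transports be composed ([transports_limit]). *)
Definition transports A b b' : Prop := forall e, Lifts b c e ->
  exists2 e', Lifts b' c e' & forall v, A (ev v) -> e' v = e v.

(** Where the [i]-th weights do not vanish, transport in slot [i] commutes with
    the action of [G]; it glues with the identity where the two maps agree,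
    since it is the identity there. *)
Lemma transports_slot (i : nat) b b' : dsmooth b' ->
  (forall U (p : U -> X), plot p -> forall u,
     nb u [set w | b (p w) = b' (p w)] \/
     nb u [set w | tB (b (p w)) i <> 0 /\ tB (b' (p w)) i <> 0]) ->
  transports [set x | b x = b' x] b b'.
Proof.
move=> b's H e [es eb eE]; pose ok x := tB (b x) i <> 0 /\ tB (b' x) i <> 0.
have Hpt x : b x = b' x \/ ok x.
  have [n|n] := H (@Edom R 0 setT openT) (fun=> x) (plots_cst _ _ x)
    (SigSub (mem_set (Logic.I : [set: 'rV[R]_0] 0))); [left|right]; exact: (nb_self n).
have te v : tE (e v) = tB (b (ev v)) by rewrite -eb tB_pi.
pose e' v := if `[< ok (ev v) >] then slot i (e v) (b' (ev v)) else e v.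
have e'E v : b (ev v) = b' (ev v) -> e' v = e v.
  move=> E; rewrite /e'; case: asboolP => [[t1 _]|//].
  by rewrite -E -eb slot_id // te.
exists e' => //; split.
- move=> U p pp; have px := @dsmooth_ev _ _ Q _ _ pp.
  apply: plot_near => u; have [n|n] := H U _ px u; refine (ex_intro2 _ _ _ n _) => W j js Hj.
     rewrite (_ : _ \o _ = e \o (p \o j)).
      by apply: es; exact: plots_comp pp js.
    by apply/funext => w /=; apply: e'E; exact: Hj.
  have pj := plots_comp pp js; have pxj := plots_comp px js.
  rewrite (_ : _ \o _ = fun w => slot i (e (p (j w))) (b' (ev (p (j w))))).
    apply: (plot_slot (es _ _ pj) (b's _ _ pxj)) => w /=; last by have [] := Hj w.
    by rewrite te; have [] := Hj w.
  by apply/funext => w /=; rewrite /e'; case: asboolP => // - []; exact: Hj.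
- move=> v; rewrite /e'; case: asboolP => K; first by rewrite piE_slot.
  by rewrite eb; have [//|/K] := Hpt (ev v).
- move=> v v' E; rewrite /e' -E; case: asboolP => K; last exact: eE.
  by rewrite (eE v v' E) slot_act // te; case: K.
Qed.

(** Locally along plots the sequence of lifts is eventually constant, so that
    its limit is smooth. *)
Lemma transports_limit (b : nat -> X -> BG G) (A : nat -> set X) (binf : X -> BG G) :
  (forall n, transports (A n) (b n) (b n.+1)) ->
  (forall U (p : U -> X), plot p -> forall u, exists N, nb u [set w | forall n, (N <= n)%N ->
     A n (p w) /\ b n (p w) = binf (p w)]) ->
  transports (\bigcap_n A n) (b 0) binf.
Proof.
move=> tr lim e Le.
(* Each lift is chosen from the previous one, by dependent choice. *)
pose seqe := fix F n : {e | Lifts (b n) c e} := match n with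
  | 0 => exist _ e Le
  | n.+1 => let: exist e Le := F n in
      let: exist2 e' Le' _ := cid2 (tr n e Le) in exist _ e' Le' end.
pose E n := projT1 (seqe n).
have EL n : Lifts (b n) c (E n) by exact: (projT2 (seqe n)).
have ES n v : A n (ev v) -> E n.+1 v = E n v.
  by rewrite /E /=; case: (seqe n) => en Len /=; case: cid2 => e' Le' H; exact: H.
have stab N v : (forall n, (N <= n)%N -> A n (ev v)) -> forall n, (N <= n)%N -> E n v = E N v.
  move=> H; elim=> [|n IH]; first by rewrite leqn0 => /eqP ->.
  rewrite leq_eqVlt => /predU1P[<-//|]; rewrite ltnS => Nn.
  by rewrite ES ?IH //; exact: H.
have limx x : exists N, forall n, (N <= n)%N -> A n x /\ b n x = binf x.
  have [N n] := lim (@Edom R 0 setT openT) (fun=> x) (plots_cst _ _ x)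
    (SigSub (mem_set (Logic.I : [set: 'rV[R]_0] 0))).
  by exists N; exact: (nb_self n).
pose N x := projT1 (cid (limx x)).
have NP x n : (N x <= n)%N -> A n x /\ b n x = binf x by exact: (projT2 (cid (limx x))).
pose einf v := E (N (ev v)) v.
have einfE v n : (forall m, (n <= m)%N -> A m (ev v)) -> einf v = E n v.
  move=> H; rewrite -(stab n v H (maxn n (N (ev v)))) ?leq_maxl //.
  by rewrite (stab (N (ev v)) v) ?leq_maxr // => m /NP[].
exists einf; last by move=> v Av; rewrite (einfE v 0%N) // => m _; exact: Av.
split.
- move=> U p pp; have px := @dsmooth_ev _ _ Q _ _ pp.
  apply: plot_near => u; have [k nk] := lim U _ px u; refine (ex_intro2 _ _ _ nk _) => W j js Hj.
  rewrite (_ : _ \o _ = E k \o (p \o j)).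
    by have [Es _ _] := EL k; apply: Es; exact: plots_comp pp js.
  by apply/funext => w /=; apply: einfE => m km; have [] := Hj w m km.
- move=> v; rewrite /einf; have [_ -> _] := EL (N (ev v)).
  by have [] := NP (ev v) _ (leqnn _).
- by move=> v v' H; rewrite /einf -H; have [_ _] := EL (N (ev v)); exact.
Qed.

End Transport.

Section HomotopyInvariance.
Context {R : realType} {G : diffGroup R} {X : diffSpace R} {Q : genFamily X}.
Variable c : cocycle G Q 1.
Local Notation XR := (prodSpace X (realSpace R)).

Lemma gt0_of_close (p q k : R) : k < p -> `|p - q| <= k -> 0 < q.
Proof. by move=> kp; rewrite ler_norml => /andP[_]; lra. Qed.

(** Time runs from [n * delta x] to [(n + 1) * delta x] in infinitely many
    steps, one for each slot: the step for slot [m] advances by the fraction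
    [zt n m x] of [delta x], which is nonzero only where the bump of slot [m]
    exceeds [kappa x / 2] at time [n * delta x]. During the whole interval this
    bump stays positive, so that [transports_slot] applies. The steps are
    locally finite within an interval, and finitely many intervals reach time 1
    near each point; so the limit is taken twice. *)
Theorem classified_homotopy (f0 f1 : smap X (BG G)) :
  smooth_homotopic f0 f1 -> classified f0 c -> classified f1 c.
Proof.
(* Reparametrizing by [step] makes the homotopy constant after time 1, so that
   overshooting does no harm. *)
move=> [H [H0 H1]]; pose K (z : XR) : BG G := H (z.1, step z.2).
have Ks : dsmooth K.
  move=> U p [p1 p2]; apply: (@smapP _ _ _ H U (fun u => ((p u).1, step (p u).2))).
  split=> //; have := @sm_step _ _ _ (@sm_id R) _ _ p2; exact.
have K1 x s : 1 <= s -> K (x, s) = K (x, 1) by move=> s1; rewrite /K !step_ge1 //=.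
have K00 x : K (x, 0) = f0 x by rewrite /K step_le0 // H0.
have K11 x : K (x, 1) = f1 x by rewrite /K step_ge1 // H1.
have [kappa [delta [[sk sd] kd0 slotP modP]]] := step_size Ks K1.
have k0 x : 0 < kappa x by have [] := kd0 x.
have d0 x : 0 < delta x by have [] := kd0 x.
pose bm n j x := bump j (K (x, n%:R * delta x)).
have st n : @dsmooth R X XR (fun x => (x, n%:R * delta x)).
  by move=> U p pp; split=> //; apply: (smM (sm_cst _) sd pp).
have sbm n j : sm (bm n j) by exact: sm_comp (dsmooth_comp (st n) Ks) (sm_bump j).
have lfbm n : locfin (bm n) by exact: locfin_comp (dsmooth_comp (st n) Ks) locfin_bump.
have nd0 n x : 0 <= n%:R * delta x by rewrite mulr_ge0 // ltW.
pose a n j x := flat 0 (bm n j x - kappa x / 2).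
have sa n j : sm (a n j).
  by apply: sm_flat; apply: smB => //; apply: smM => //; exact: sm_cst.
have lfa n : locfin (a n).
  apply: locfin_sub (lfbm n) => j x b0; rewrite /a b0 flat_le0 // sub0r oppr_le0.
  by rewrite divr_ge0 // ltW.
have a_ge0 n j x : 0 <= a n j x by exact: flat_ge0.
have S0 n x : 0 < \sum_(j \in [set: nat]) a n j x.
  have [j kj] := slotP x _ (nd0 n x); have [r ur zr] := locfin_pt x (lfa n).
  apply: (fsum_gt0 (i := j) ur zr) => //; apply: flat_gt0.
  by rewrite subr_gt0 (lt_le_trans _ kj) // ltr_pdivrMr // ltr_pMr // ltr1n.
pose zt n j x := a n j x / \sum_(j \in [set: nat]) a n j x.
have szt n j : sm (zt n j).
  by apply: sm_div => //; [exact: sm_fsum|move=> x; rewrite gt_eqF].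
have zt_ge0 n j x : 0 <= zt n j x by rewrite divr_ge0 // ltW.
pose La n m x := \sum_(j < m) zt n j x.
have La_ge0 n m x : 0 <= La n m x by rewrite sumr_ge0.
have zt_sum n x : \sum_(j \in [set: nat]) zt n j x = 1.
  by rewrite -mulr_fsuml mulfV // gt_eqF.
have zt_tail n x (r : seq nat) : uniq r -> (forall i, i \notin r -> a n i x = 0) ->
    \sum_(j <- r) zt n j x = 1.
  by move=> ur zr; rewrite -(zt_sum n x) (fsumE ur) // => i /zr; rewrite /zt => ->; rewrite mul0r.
have tail_eq n x (r : seq nat) N : uniq r -> (forall i, i \notin r -> a n i x = 0) ->
    (forall i, i \in r -> (i < N)%N) -> forall m, (N <= m)%N -> La n m x = 1.
  move=> ur zr rN m Nm; rewrite /La -(big_mkord xpredT (fun j => zt n j x)) /index_iota subn0.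
  rewrite -(zt_tail n x (iota 0 m)) ?iota_uniq // => i.
  rewrite mem_iota /= add0n -leqNgt => mi; apply: zr; apply/negP => /rN.
  by rewrite ltnNge (leq_trans Nm mi).
have La_le1 n m x : La n m x <= 1.
  have [r ur zr] := locfin_pt x (lfa n).
  pose N := maxn m (\max_(i <- r) i).+1.
  have rN i : i \in r -> (i < N)%N.
    by move=> ir; rewrite leq_max ltnS (@leq_bigmax_seq _ r xpredT id i ir isT) orbT.
  rewrite -(tail_eq n x r N ur zr rN N (leqnn _)) /La.
  rewrite -(big_mkord xpredT (fun j => zt n j x)) -(big_mkord xpredT (fun j => zt n j x)).
  by rewrite [leRHS](big_cat_nat (leq0n m) (leq_maxl _ _)) /= lerDl sumr_ge0.
pose sg n m x : R := (n%:R + La n m x) * delta x.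
have ssg n m : sm (sg n m).
  apply: smM => //; apply: smD; first exact: sm_cst.
  exact: (sm_sum _ (fun j : 'I_m => szt n j)).
have sg_ge0 n m x : 0 <= sg n m x by rewrite mulr_ge0 ?addr_ge0 // ltW.
have sg0 n x : sg n 0 x = n%:R * delta x by rewrite /sg /La big_ord0 addr0.
pose b n m x := K (x, sg n m x).
have bs n m : dsmooth (b n m).
  by move=> U p pp; apply: Ks; split=> //; exact: (ssg n m _ _ pp).
have sg_near n m x : `|n%:R * delta x - sg n m x| <= delta x.
  rewrite /sg -mulrBl normrM (gtr0_norm (d0 x)) ler_piMl ?(ltW (d0 x)) //.
  by rewrite opprD addNKr normrN ger0_norm.
have stepT n m : transports c [set x | b n m x = b n m.+1 x] (b n m) (b n m.+1).
  apply: (transports_slot (i := m)) => // U p pp u.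
  (* A bump above a quarter of [kappa] stays so nearby, and [modP] then keeps
     the weight positive during the whole interval; a bump below half of
     [kappa] stays so nearby, and the step is then trivial. *)
  have [far|near] := ltrP (kappa (p u) / 4) (bm n m (p u)).
    right; have sb : sm (fun x => bm n m x - kappa x / 4).
      by apply: smB => //; apply: smM => //; exact: sm_cst.
    have pos : 0 < bm n m (p u) - kappa (p u) / 4 by rewrite subr_gt0.
    apply: filterS (nb_gt (sb _ _ pp) pos) => w /=; rewrite subr_gt0 => bw.
    have big m' : tB (b n m' (p w)) m <> 0.
      apply: bump_gt0; apply: (gt0_of_close bw).
      exact: (modP (p w) _ _ m (nd0 n (p w)) (sg_ge0 n m' (p w)) (sg_near n m' (p w))).
    by split; exact: big.
  left; have kp := k0 (p u).
  have sb : sm (fun x => kappa x / 2 - bm n m x).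
    by apply: smB => //; apply: smM => //; exact: sm_cst.
  have pos : 0 < kappa (p u) / 2 - bm n m (p u) by lra.
  apply: filterS (nb_gt (sb _ _ pp) pos) => w /=; rewrite subr_gt0 => bw.
  rewrite /b /sg /La big_ord_recr /=; congr (K (_, (_ + _) * _)).
  by rewrite /zt /a flat_le0 ?mul0r ?addr0 // subr_le0 ltW.
have innerT n : transports c (\bigcap_m [set x | b n m x = b n m.+1 x]) (b n 0) (b n.+1 0).
  apply: transports_limit => // U p pp u.
  have [r ur nr] := lfa n U p pp u; exists (\max_(i <- r) i).+1.
  apply: filterS nr => w zw m Nm.
  have rN i : i \in r -> (i < (\max_(i <- r) i).+1)%N.
    by move=> ir; rewrite ltnS (@leq_bigmax_seq _ r xpredT id i ir isT).
  have L1 m' : ((\max_(i <- r) i).+1 <= m')%N -> b n m' (p w) = b n.+1 0 (p w).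
    move=> Nm'; rewrite /b sg0 /sg (tail_eq n (p w) r _ ur zw rN m' Nm').
    by rewrite -natr1.
  by split=> /=; rewrite !L1 // ltnW.
have outerT : transports c (\bigcap_n \bigcap_m [set x | b n m x = b n m.+1 x]) (b 0 0) f1.
  apply: (transports_limit innerT) => U p pp u.
  pose d := delta (p u) / 2.
  have dd : 0 < d by rewrite divr_gt0.
  have du : d < delta (p u) by rewrite /d; have := d0 (p u); lra.
  exists (Num.bound d^-1); apply: filterS (nb_gt (sd _ _ pp) du) => w /= dw n Nn.
  have late m : b n m (p w) = f1 (p w).
    rewrite /b K1 ?K11 //; apply: (@le_trans _ _ (n%:R * d)).
      rewrite -ler_pdivrMr // mul1r (@le_trans _ _ (Num.bound d^-1)%:R) ?ler_nat //.
      by rewrite ltW // archi_boundP // invr_ge0 ltW.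
    by rewrite /sg ler_pM ?lerDl // ltW.
  by split; [move=> m _ /=; rewrite !late|exact: late].
move=> [e [es ef eE]].
have L0 : Lifts (b 0 0) c e.
  by split=> // v; rewrite ef /b sg0 mul0r K00.
by have [e' Le' _] := outerT e L0; exists e'.
Qed.

End HomotopyInvariance.

(** * The classification *)

Section Classification.
Context {R : realType} {G : diffGroup R}.
Hypothesis abelianG : forall g h : dgroup G, (g * h = h * g)%g.

Lemma smooth_homotopic_sym (X B : diffSpace R) (f0 f1 : smap X B) :
  smooth_homotopic f0 f1 -> smooth_homotopic f1 f0.
Proof.
move=> [H [H0 H1]].
have Hs : @dsmooth R (prodSpace X (realSpace R)) B (fun xs => H (xs.1, 1 - xs.2)).
  move=> U p [p1 p2]; apply: (@smapP _ _ _ H U (fun u => ((p u).1, 1 - (p u).2))).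
  split=> //; exact: (smB (sm_cst 1) (@sm_id R) p2).
by exists (SMap Hs); split=> x /=; rewrite ?subr0 ?subrr ?H0 ?H1.
Qed.

(** Homotopy classes are those of the equivalence relation generated by
    homotopy; each generating homotopy can be reversed. *)
Lemma Classified_homotopy (X : diffSpace R) (f0 f1 : smap X (BG G)) (a : cech G X 1) :
  qclass (@smooth_homotopic _ X (BG G)) f0 = qclass (@smooth_homotopic _ X (BG G)) f1 ->
  Classified f0 a <-> Classified f1 a.
Proof.
have [Q [c ->]] := cech_rep a; rewrite !ClassifiedP // => /qclassP.
elim=> {f0 f1} [f0 f1 H|//|f0 f1 _ IH|f0 f1 f2 _ IH _ IH'].
- by split; apply: classified_homotopy => //; exact: smooth_homotopic_sym.
- by split=> /IH.
- by split=> [/IH/IH'|/IH'/IH].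
Qed.

Lemma Classified_homotopic (X : diffSpace R) (f0 f1 : smap X (BG G)) (a : cech G X 1) :
  Classified f0 a -> Classified f1 a ->
  qclass (@smooth_homotopic _ X (BG G)) f0 = qclass (@smooth_homotopic _ X (BG G)) f1.
Proof.
have [Q [c ->]] := cech_rep a => /ClassifiedP H0 /ClassifiedP H1.
exact: classified_homotopic (H0 abelianG) (H1 abelianG).
Qed.

Lemma Classified_surj (X : diffSpace R) (a : cech G X 1) : all_D_numerable G X ->
  exists f : smap X (BG G), Classified f a.
Proof.
move=> hX; have [Q [c ->]] := cech_rep a.
have [f Lf] := cocycle_classified (hX _ (bundle_principal c)).
by exists f; apply/ClassifiedP.
Qed.

End Classification.

Local Open Scope group_scope.

Theorem mainTheorem2 (R : realType) (G : diffGroup R)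
    (abelianG : forall g h : dgroup G, g * h = h * g) :
  exists Phi : forall X : diffSpace R,
      all_D_numerable G X -> cech G X 1 -> htpy X (BG G),
    (forall (X : diffSpace R) (hX : all_D_numerable G X), bijective (Phi X hX)) /\
    (forall (X Y : diffSpace R) (hX : all_D_numerable G X)
        (hY : all_D_numerable G Y) (f : smap Y X)
        (Q : genFamily X) (P : genFamily Y) (F : nebulaMap f Q P)
        (a : cechFam G Q 1),
      Phi Y hY (cech_class (cech_pull F a)) =
      htpy_precomp f (Phi X hX (cech_class a))).
Proof.
pose cls X hX a := projT1 (cid (@Classified_surj R G abelianG X a hX)).
have clsP X hX a : Classified (cls X hX a) a.
  exact: projT2 (cid (@Classified_surj R G abelianG X a hX)).
exists (fun X hX a => qclass (@smooth_homotopic _ X (BG G)) (cls X hX a)); split.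
  move=> X hX; pose toC (q : htpy X (BG G)) : cech G X 1 :=
    projT1 (cid (Classified_exists abelianG (@smapP _ _ _ (qrepr q)))).
  have toCP (q : htpy X (BG G)) : Classified (qrepr q) (toC q).
    exact: projT2 (cid (Classified_exists abelianG (@smapP _ _ _ (qrepr q)))).
  exists toC => [a|q].
    apply: (Classified_unique abelianG (f := cls X hX a)) => //.
    apply/(Classified_homotopy abelianG (toC _) (f0 := qrepr _)) => //.
    by rewrite qclass_qrepr.
  rewrite -[RHS]qclass_qrepr; apply: (Classified_homotopic abelianG (a := toC q)) => //.
move=> X Y hX hY f Q P F a; have [c <-] := qclass_surj a.
rewrite /htpy_precomp qmapE /cech_pull qmapE.
apply: (Classified_homotopic abelianG (clsP _ _ _)).
apply/ClassifiedP => //; apply: (classified_pull F).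
by apply/(ClassifiedP abelianG); exact: clsP.
Qed.
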